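(* Let $\Theta_0,\Theta_1,\Theta_\infty\in\mathbb C$ with $\Theta_0,\Theta_1\notin\mathbb Z$, and let $\sigma,s^2,r\in\mathbb C\setminus\{0\}$ with $\Re\sigma\in[0,1)$. Then there exists a unique solution $(y,z,u)$ of the isomonodromy deformation system given in the context with the following asymptotic expansion as $t\to0$: \begin{align*} y&=\frac{(a(\sigma)+s^2d(-\sigma)a(-\sigma)t^\sigma)(b(\sigma)+s^2d(\sigma)b(-\sigma)t^\sigma)}{(a(\sigma)+s^2d(\sigma)a(-\sigma)t^\sigma)(b(\sigma)+s^2d(-\sigma)b(-\sigma)t^\sigma)}+\frac{1-\Theta_1-\Theta_0}{(1-\sigma)^2}\,t+\mathcal O(t^{1+\Re\sigma})+\mathcal O(t^{2-\Re\sigma}),\\ z&=\frac{(c(\sigma)+s^2d(\sigma)c(-\sigma)t^\sigma)(b(\sigma)+s^2d(-\sigma)b(-\sigma)t^\sigma)}{\sigma^2s^2t^\sigma}+2\left(\frac{b(\sigma)c(\sigma)}{\sigma^2(1-\sigma)s^2t^\sigma}\right)^2t+\mathcal O(t^{1-\Re\sigma})+\mathcal O(t^{2-3\Re\sigma}),\\ u&=-r\,t^{\Theta_\infty}\left(\frac{b(\sigma)+s^2d(-\sigma)b(-\sigma)t^\sigma}{b(\sigma)+s^2d(\sigma)b(-\sigma)t^\sigma}\right)(1+\mathcal O(t)). \end{align*}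
   Context: Notation: $b(\sigma)=\frac{\Theta_1+\Theta_0+\sigma}2$, $c(\sigma)=\frac{\Theta_1-\Theta_0+\sigma}2$, $d(\sigma)=\frac{\Theta_\infty+\sigma}2$, $a(\sigma)=b(\sigma)c(\sigma)$. The argument $\arg t$ is fixed in the standard way ($\arg t=0$ for $t>0$) and is assumed to be bounded as $t\to0$; powers of $t$ are defined accordingly. Isomonodromy deformation system with parameters $\Theta_0,\Theta_1,\Theta_\infty$: \begin{align*} t\frac{dy}{dt}&=ty-2z(y-1)^2-(y-1)\Big(\tfrac{\Theta_0-\Theta_1+\Theta_\infty}2y-\tfrac{3\Theta_0+\Theta_1+\Theta_\infty}2\Big),\\ t\frac{dz}{dt}&=yz\Big(z+\tfrac{\Theta_0-\Theta_1+\Theta_\infty}2\Big)-\frac1y(z+\Theta_0)\Big(z+\tfrac{\Theta_0+\Theta_1+\Theta_\infty}2\Big),\\ t\frac{d}{dt}\log u&=-2z-\Theta_0+y\Big(z+\tfrac{\Theta_0-\Theta_1+\Theta_\infty}2\Big)+\frac1y\Big(z+\tfrac{\Theta_0+\Theta_1+\Theta_\infty}2\Big). \end{align*}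
   Formalization: Assumes a(σ)≠0, or Re σ=0 with d(σ),d(−σ)≠0 (e.g. for b(σ)=0, 0<Re σ<1 the stated t-coefficient of y is wrong); the y and u expansions hold outside discs of any fixed radius in log t around zeros of the factors in the leading terms, needed only if Re σ=0. *)

(* Defs.v *)
From Stdlib Require Import Reals.
From Coquelicot Require Import Coquelicot.

Open Scope C_scope.

Definition Cexp (z : C) : C := (exp (Re z) * cos (Im z), exp (Re z) * sin (Im z))%R.

(** The functions of the theorem live on the universal cover of [C \ {0}].  A
    point of it is represented by [l = log t = ln |t| + i arg t], an arbitrary
    complex number; functions of [t] become functions of [l], the operator
    [t d/dt] is the complex derivative in [l], and [t -> 0] is [Re l -> -oo]. *)

Definition tpow (l p : C) : C := Cexp (p * l).

Definition tt (l : C) : C := tpow l 1.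

(** [|arg t| < M] and [|t| < exp N]. *)
Definition sector (M N : R) (l : C) : Prop :=
  (Rabs (Im l) < M)%R /\ (Re l < N)%R.

Definition holomorphic_at (f : C -> C) (l : C) : Prop :=
  exists v : C, is_derive (K := C_AbsRing) (V := C_NormedModule) f l v.

(** The value of [f] at [l] itself is irrelevant. *)
Definition meromorphic_at (f : C -> C) (l : C) : Prop :=
  exists (n : nat) (e : R) (h : C -> C), (0 < e)%R /\
    (forall m : C, (Cmod (m - l) < e)%R -> holomorphic_at h m) /\
    (forall m : C, (0 < Cmod (m - l) < e)%R -> f m * (m - l) ^ n = h m).

Definition discrete_in (D P : C -> Prop) : Prop :=
  forall l : C, D l ->
    exists e : R, (0 < e)%R /\ forall m : C, (0 < Cmod (m - l) < e)%R -> ~ P m.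

(** [(y, z, u)] is a meromorphic solution on [D]; [P] is a discrete set
    containing the poles of [y], [z], [u] and the zeros of [y] and [u], at which
    the two sides of the system are not both defined.  The last equation is
    [t d/dt log u = ...] multiplied by [u]. *)
Definition is_solution (Th0 Th1 Thi : C) (D P : C -> Prop) (y z u : C -> C) : Prop :=
  discrete_in D P /\
  (forall l : C, D l ->
     meromorphic_at y l /\ meromorphic_at z l /\ meromorphic_at u l) /\
  (forall l : C, D l -> ~ P l ->
     y l <> 0 /\ u l <> 0 /\
     is_derive (K := C_AbsRing) (V := C_NormedModule) y l
       (tt l * y l - 2 * z l * (y l - 1) ^ 2
        - (y l - 1) * ((Th0 - Th1 + Thi) / 2 * y l - (3 * Th0 + Th1 + Thi) / 2)) /\
     is_derive (K := C_AbsRing) (V := C_NormedModule) z l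
       (y l * z l * (z l + (Th0 - Th1 + Thi) / 2)
        - 1 / y l * (z l + Th0) * (z l + (Th0 + Th1 + Thi) / 2)) /\
     is_derive (K := C_AbsRing) (V := C_NormedModule) u l
       (u l * (- 2 * z l - Th0 + y l * (z l + (Th0 - Th1 + Thi) / 2)
               + 1 / y l * (z l + (Th0 + Th1 + Thi) / 2)))).

Section Expansion.

Variables Th0 Th1 Thi sigma s2 r : C.

Definition b (x : C) : C := (Th1 + Th0 + x) / 2.
Definition c (x : C) : C := (Th1 - Th0 + x) / 2.
Definition d (x : C) : C := (Thi + x) / 2.
Definition a (x : C) : C := b x * c x.

Definition y_num1 (l : C) : C := a sigma + s2 * d (- sigma) * a (- sigma) * tpow l sigma.
Definition y_num2 (l : C) : C := b sigma + s2 * d sigma * b (- sigma) * tpow l sigma.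
Definition y_den1 (l : C) : C := a sigma + s2 * d sigma * a (- sigma) * tpow l sigma.
Definition y_den2 (l : C) : C := b sigma + s2 * d (- sigma) * b (- sigma) * tpow l sigma.

Definition y_main (l : C) : C :=
  (y_num1 l * y_num2 l) / (y_den1 l * y_den2 l)
  + (1 - Th1 - Th0) / (1 - sigma) ^ 2 * tt l.

Definition z_main (l : C) : C :=
  (c sigma + s2 * d sigma * c (- sigma) * tpow l sigma)
    * (b sigma + s2 * d (- sigma) * b (- sigma) * tpow l sigma)
    / (sigma ^ 2 * s2 * tpow l sigma)
  + 2 * (b sigma * c sigma / (sigma ^ 2 * (1 - sigma) * s2 * tpow l sigma)) ^ 2 * tt l.

Definition u_main (l : C) : C := - r * tpow l Thi * (y_den2 l / y_num2 l).

(** [f = O(t^p) + O(t^q)], with real exponents, as [t -> 0] with [|arg t| < M],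
    [t] restricted to the points satisfying [E]. *)
Definition bigO2 (M : R) (E : C -> Prop) (f : C -> C) (p q : R) : Prop :=
  exists K N : R, forall l : C, sector M N l -> E l ->
    (Cmod (f l) <= K * (Cmod (tpow l (RtoC p)) + Cmod (tpow l (RtoC q))))%R.

Definition away (e : R) (g : C -> C) (l : C) : Prop :=
  forall m : C, g m = 0 -> (e <= Cmod (l - m))%R.

(** When [Re sigma = 0] the zeros of the denominators of the main terms may
    accumulate at [t = 0] inside the sector; there [y] and [u] have poles or
    zeros close to, but not at, those of the main terms.  As usual the
    expansions of [y] and [u] are therefore uniform outside discs of arbitrarily
    small fixed radius [e] (in [log t]) around these points.  When
    [Re sigma > 0] and [a sigma <> 0] the discs do not meet a neighbourhood of
    [t = 0] in the sector, and the restriction is void. *)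
Definition has_expansion (M : R) (P : C -> Prop) (y z u : C -> C) : Prop :=
  (forall e : R, (0 < e)%R ->
     bigO2 M (fun l => ~ P l /\ away e (fun m => y_den1 m * y_den2 m) l)
       (fun l => y l - y_main l) (1 + Re sigma) (2 - Re sigma)) /\
  bigO2 M (fun l => ~ P l)
    (fun l => z l - z_main l) (1 - Re sigma) (2 - 3 * Re sigma) /\
  (forall e : R, (0 < e)%R ->
     exists (h : C -> C) (K N : R), forall l : C, sector M N l ->
       ~ P l -> away e (fun m => y_num2 m * y_den2 m) l ->
       u l = u_main l * (1 + h l) /\ (Cmod (h l) <= K * Cmod (tt l))%R).

(** The main terms are meaningful as [t -> 0].  If [Re sigma > 0] then
    [y_den1 * y_den2] tends to [a sigma * b sigma], which must not vanish: the
    coefficient of [t] in [y_main] comes from expanding at that limit, and it is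
    wrong in general when [a sigma = 0].  If [Re sigma = 0] and [a sigma = 0],
    the condition on [d] says that none of the four factors in [y_main]
    vanishes identically. *)
Definition nondegenerate : Prop :=
  a sigma <> 0 \/ (Re sigma = 0%R /\ d sigma <> 0 /\ d (- sigma) <> 0).

End Expansion.

(* Main.v *)
(** Put [v = t ^ (- Thi) u].  The isomonodromy system says that the traceless matrices [A0], [A1]
    with eigenvalues [Th0 / 2, - Th0 / 2] and [Th1 / 2, - Th1 / 2], whose eigenvectors for
    [- Th0 / 2] and [- Th1 / 2] are [(v, 1)] and [(y v, 1)], satisfy in [l = log t] the Schlesinger
    equations [A0' = [A1, A0]], [A1' = [A0 + A1 + (t / 2) s3, A1]], where [s3 = diag (1, -1)].
    The sum [A0 + A1] has a limit with eigenvalues [sigma / 2, - sigma / 2] as [t -> 0].  In the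
    eigenbasis of this limit, and with the powers of [t ^ sigma] removed, the entries of [A1],
    of [A0 + A1] and of the eigenvectors have limits too, and they solve a quadratic system whose
    terms decay like a power of [t].  Such a system has exactly one solution with prescribed limits:
    the Picard iterates are exponential sums in [l], and the Picard map contracts near [t = 0].

    Existence: take the limits dictated by [sigma], [s2], [r].  The eigenvector relations are
    preserved, [v] and [y] are ratios of components of eigenvectors, hence solve Riccati equations,
    and two more steps of the iteration give the expansions.

    Uniqueness: on a horizontal line in [l] that avoids the exceptional sets of two solutions, the
    expansions determine the limits of the entries, so the solutions agree on it; the complement
    of the exceptional sets being connected by segments, they agree everywhere. *)

Require Import Defs.
From Stdlib Require Import Reals Lra Lia List Classical ClassicalEpsilon.
From Coquelicot Require Import Coquelicot.

Open Scope R_scope.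
Open Scope C_scope.

(** * Complex derivatives and exponentials *)

(** In the original basis the entries of [A1] mix [t ^ sigma], [1] and [t ^ (- sigma)], so [A1] has
    no limit there in general. In the eigenbasis of the limit of the sum, [A0 + A1] is the diagonal
    matrix of [sigma / 2, - sigma / 2] plus a correction ((eta, mu T), (nu / T, - eta)), where
    [T = t ^ sigma]. Its upper right entry is kept with its power of [T] (the unknown [Mm]): it has
    order [t], while [mu] has only order [t / T]. In the original basis the diagonal of [A0 + A1] is
    constant, equal to [- Thi / 2, Thi / 2]; this linear relation expresses [nu] through eta and
    [Mm].

    The decay available is [t ^ (1 - Re sigma)]. When [Re sigma = 0] the obstacle is a different
    one: [t ^ sigma] does not tend to 0, and denominators may vanish arbitrarily close to [t = 0].
    Their leading terms [A + B t ^ sigma] have all their zeros on one horizontal line in [l]. For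
    such a factor [f] with [A <> 0], [sigma f - f'] stays away from 0, hence the zeros near [t = 0]
    are simple; this yields meromorphy and a discrete exceptional set. *)

Ltac lt_min :=
  repeat match goal with
    | N := Rmin _ _ |- _ => subst N
    | H : _ < Rmin _ _ |- _ => apply Rmin_Rgt_l in H; destruct H
    | H : Rmin _ _ > _ |- _ => apply Rmin_Rgt_l in H; destruct H
    end; first [assumption | lra].

Ltac min_pos := repeat apply Rmin_pos; assumption.

(** An epsilon-delta form of [is_derive] over [C], without filters and without division by [h], so
    that estimates are carried out directly on [Cmod]. *)
Definition Cder (f : C -> C) (l v : C) : Prop :=
  forall e : R, (0 < e) -> exists dl : R, (0 < dl) /\
    forall h : C, (Cmod h < dl) -> (Cmod (f (l + h) - f l - v * h) <= e * Cmod h).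

Lemma Cder_is_derive (f : C -> C) (l v : C) :
  Cder f l v <-> is_derive (K := C_AbsRing) (V := C_NormedModule) f l v.
Proof.
  split.
  - intros H. split; [apply is_linear_scal_l|].
    intros x Hx.
    assert (E := is_filter_lim_locally_unique (V := AbsRing_NormedModule C_AbsRing) l x Hx). subst x.
    intros eps. destruct (H eps (cond_pos eps)) as [dl [Hd H1]].
    apply (locally_le_locally_norm (K:=C_AbsRing) (V := AbsRing_NormedModule C_AbsRing) l).
    exists (mkposreal dl Hd). intros y Hy.
    unfold ball_norm in Hy. simpl in Hy.
    change C in y. specialize (H1 (y - l) Hy).
    replace (l + (y - l)) with y in H1 by ring.
    change (Cmod (f y - f l - (y - l) * v) <= eps * Cmod (y - l)).
    replace ((y - l) * v) with (v * (y - l)) by ring. exact H1.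
  - intros [_ H] e He. specialize (H l (fun P HP => HP) (mkposreal e He)).
    apply (locally_norm_le_locally (K:=C_AbsRing) (V := AbsRing_NormedModule C_AbsRing) l) in H.
    destruct H as [dl H]. exists dl. split; [apply cond_pos|].
    intros h Hh. specialize (H (l + h)).
    assert (E : l + h - l = h) by ring.
    assert (H' : (Cmod (f (l + h) - f l - (l + h - l) * v) <= e * Cmod (l + h - l))).
    { apply H. unfold ball_norm. change (Cmod (l + h - l) < dl). rewrite E. exact Hh. }
    rewrite E in H'. replace (v * h) with (h * v) by ring. exact H'.
Qed.

Lemma Cmod_sub_comm (x y : C) : Cmod (x - y) = Cmod (y - x).
Proof. rewrite <- Cmod_opp. f_equal. ring. Qed.

Lemma Cmod_triangle_sub (x y : C) : (Cmod (x - y) <= Cmod x + Cmod y).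
Proof. unfold Cminus. rewrite <- (Cmod_opp y). apply Cmod_triangle. Qed.

Lemma Cmod_le_sub (x y : C) : (Cmod x <= Cmod (x - y) + Cmod y).
Proof. replace x with (x - y + y) at 1 by ring. apply Cmod_triangle. Qed.

Lemma Im_le_Cmod (x : C) : (Rabs (Im x) <= Cmod x).
Proof. eapply Rle_trans; [|apply Rmax_Cmod]. apply Rmax_r. Qed.

Lemma Cmod_le_abs (x : C) : (Cmod x <= Rabs (Re x) + Rabs (Im x)).
Proof.
  destruct x as [u v]. simpl.
  replace (u, v) with (RtoC u + Ci * RtoC v) by
    (unfold Cplus, Cmult, RtoC; simpl; f_equal; ring).
  eapply Rle_trans; [apply Cmod_triangle|].
  rewrite Cmod_mult, Cmod_Ci, !Cmod_R. lra.
Qed.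

Lemma Cder_ext (f g : C -> C) (l v : C) (r : R) : (0 < r) ->
  (forall m, (Cmod (m - l) < r) -> f m = g m) -> Cder f l v -> Cder g l v.
Proof.
  intros Hr E H e He. destruct (H e He) as [dl [Hd H1]].
  exists (Rmin r dl). split; [now apply Rmin_pos|].
  intros h Hh. rewrite <- !E.
  - apply H1. lt_min.
  - replace (l - l) with (RtoC 0) by ring. now rewrite Cmod_0.
  - replace (l + h - l) with h by ring. lt_min.
Qed.

Lemma Cder_const (k l : C) : Cder (fun _ => k) l 0.
Proof. rewrite Cder_is_derive. exact (is_derive_const k l). Qed.

Lemma Cder_id (l : C) : Cder (fun x => x) l 1.
Proof.
  intros e He. exists 1%R. split; [lra|]. intros h _.
  replace (l + h - l - 1 * h) with (RtoC 0) by ring. rewrite Cmod_0.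
  apply Rmult_le_pos; [lra|apply Cmod_ge_0].
Qed.

Lemma Cder_plus (f g : C -> C) (l u v : C) :
  Cder f l u -> Cder g l v -> Cder (fun x => f x + g x) l (u + v).
Proof. rewrite !Cder_is_derive. exact (is_derive_plus f g l u v). Qed.

Lemma Cder_opp (f : C -> C) (l v : C) : Cder f l v -> Cder (fun x => - f x) l (- v).
Proof. rewrite !Cder_is_derive. exact (is_derive_opp f l v). Qed.

Lemma Cder_minus (f g : C -> C) (l u v : C) :
  Cder f l u -> Cder g l v -> Cder (fun x => f x - g x) l (u - v).
Proof. intros Hf Hg. apply Cder_plus; [assumption|now apply Cder_opp]. Qed.

Lemma Cder_loc_lip (f : C -> C) (l v : C) : Cder f l v ->
  exists dl, (0 < dl) /\ forall h, (Cmod h < dl) ->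
    (Cmod (f (l + h) - f l) <= (1 + Cmod v) * Cmod h).
Proof.
  intros H. destruct (H 1%R ltac:(lra)) as [dl [Hd H1]].
  exists dl. split; [assumption|]. intros h Hh. specialize (H1 h Hh).
  replace (f (l + h) - f l) with ((f (l + h) - f l - v * h) + v * h) by ring.
  eapply Rle_trans; [apply Cmod_triangle|]. rewrite (Cmod_mult v). lra.
Qed.

Lemma Cder_cont (f : C -> C) (l v : C) : Cder f l v ->
  forall e, (0 < e) -> exists dl, (0 < dl) /\ forall m, (Cmod (m - l) < dl) ->
    (Cmod (f m - f l) < e).
Proof.
  intros H e He. destruct (Cder_loc_lip _ _ _ H) as [dl [Hd H1]].
  assert (Hv := Cmod_ge_0 v).
  exists (Rmin dl (e / (2 + Cmod v)))%R. split.
  { apply Rmin_pos; [assumption|]. apply Rdiv_lt_0_compat; lra. }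
  intros m Hm. specialize (H1 (m - l) ltac:(lt_min)).
  replace (l + (m - l)) with m in H1 by ring.
  assert (Hm2 := Rlt_le_trans _ _ _ Hm (Rmin_r _ _)).
  apply Rlt_div_r in Hm2; [|lra]. assert (H2 := Cmod_ge_0 (m - l)). nra.
Qed.

Lemma Cder_mult (f g : C -> C) (l u v : C) :
  Cder f l u -> Cder g l v -> Cder (fun x => f x * g x) l (u * g l + f l * v).
Proof.
  intros Hf Hg e He.
  assert (P1 := Cmod_ge_0 (f l)). assert (P2 := Cmod_ge_0 (g l)). assert (P3 := Cmod_ge_0 v).
  assert (P4 := Cmod_ge_0 u).
  destruct (Hf (e / 3 / (1 + Cmod (g l)))%R) as [d1 [Hd1 H1]].
  { repeat apply Rdiv_lt_0_compat; lra. }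
  destruct (Hg (e / 3 / (1 + Cmod (f l)))%R) as [d2 [Hd2 H2]].
  { repeat apply Rdiv_lt_0_compat; lra. }
  destruct (Cder_loc_lip _ _ _ Hf) as [d3 [Hd3 H3]].
  destruct (Cder_loc_lip _ _ _ Hg) as [d4 [Hd4 H4]].
  (* Chosen so that the second-order term, at most [(1 + |u|) (1 + |v|) |h| ^ 2], is at most
     [e / 3 * |h|]. *)
  set (d5 := (e / 3 / ((1 + Cmod u) * (1 + Cmod v)))%R).
  assert (Hd5 : (0 < d5)). { unfold d5. repeat apply Rdiv_lt_0_compat; nra. }
  exists (Rmin (Rmin d1 d2) (Rmin (Rmin d3 d4) d5)).
  split; [min_pos|]. intros h Hh.
  assert (G1 : (Cmod h < d1)) by (lt_min).
  assert (G2 : (Cmod h < d2)) by (lt_min).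
  assert (G3 : (Cmod h < d3)) by (eapply Rlt_le_trans; [exact Hh|];
     eapply Rle_trans; [apply Rmin_r|]; eapply Rle_trans; [apply Rmin_l|apply Rmin_l]).
  assert (G4 : (Cmod h < d4)) by (eapply Rlt_le_trans; [exact Hh|];
     eapply Rle_trans; [apply Rmin_r|]; eapply Rle_trans; [apply Rmin_l|apply Rmin_r]).
  assert (G5 : (Cmod h < d5)) by (lt_min).
  specialize (H1 h G1). specialize (H2 h G2). specialize (H3 h G3). specialize (H4 h G4).
  replace (f (l + h) * g (l + h) - f l * g l - (u * g l + f l * v) * h) with
    ((f (l + h) - f l - u * h) * g l + f l * (g (l + h) - g l - v * h)
     + (f (l + h) - f l) * (g (l + h) - g l)) by ring.
  eapply Rle_trans; [apply Cmod_triangle|].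
  eapply Rle_trans; [apply Rplus_le_compat_r; apply Cmod_triangle|].
  rewrite !Cmod_mult.
  assert (P0 := Cmod_ge_0 h).
  assert (Q1 : (Cmod (f (l + h) - f l - u * h) * Cmod (g l) <= e / 3 * Cmod h)).
  { eapply Rle_trans; [apply Rmult_le_compat_r; [assumption|exact H1]|].
    replace (e / 3 / (1 + Cmod (g l)) * Cmod h * Cmod (g l))%R
      with (Cmod (g l) / (1 + Cmod (g l)) * (e / 3 * Cmod h))%R by (field; lra).
    rewrite <- (Rmult_1_l (e / 3 * Cmod h)) at 2. apply Rmult_le_compat_r.
    - apply Rmult_le_pos; lra.
    - apply Rle_div_l; lra. }
  assert (Q2 : (Cmod (f l) * Cmod (g (l + h) - g l - v * h) <= e / 3 * Cmod h)).
  { eapply Rle_trans; [apply Rmult_le_compat_l; [assumption|exact H2]|].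
    replace (Cmod (f l) * (e / 3 / (1 + Cmod (f l)) * Cmod h))%R
      with (Cmod (f l) / (1 + Cmod (f l)) * (e / 3 * Cmod h))%R by (field; lra).
    rewrite <- (Rmult_1_l (e / 3 * Cmod h)) at 2. apply Rmult_le_compat_r.
    - apply Rmult_le_pos; lra.
    - apply Rle_div_l; lra. }
  assert (Q3 : (Cmod (f (l + h) - f l) * Cmod (g (l + h) - g l) <= e / 3 * Cmod h)).
  { eapply Rle_trans.
    - apply Rmult_le_compat; [apply Cmod_ge_0|apply Cmod_ge_0|exact H3|exact H4].
    - replace ((1 + Cmod u) * Cmod h * ((1 + Cmod v) * Cmod h))%R
        with (((1 + Cmod u) * (1 + Cmod v) * Cmod h) * Cmod h)%R by ring.
      apply Rmult_le_compat_r; [assumption|].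
      unfold d5 in G5. apply Rlt_div_r in G5; [|nra]. lra. }
  lra.
Qed.

Lemma Cder_scal (k : C) (f : C -> C) (l v : C) :
  Cder f l v -> Cder (fun x => k * f x) l (k * v).
Proof.
  intros H. replace (k * v) with (0 * f l + k * v) by ring.
  apply (Cder_mult (fun _ => k) f); [apply Cder_const|exact H].
Qed.

Lemma Cder_inv (f : C -> C) (l u : C) :
  Cder f l u -> f l <> 0 -> Cder (fun x => / f x) l (- u / (f l * f l)).
Proof.
  intros Hf H0 e He.
  assert (P1 : (0 < Cmod (f l))) by now apply Cmod_gt_0.
  remember (Cmod (f l)) as a eqn:Ea.
  destruct (Cder_cont _ _ _ Hf (a / 2)%R) as [d1 [Hd1 H1]]; [lra|].
  destruct (Cder_loc_lip _ _ _ Hf) as [d3 [Hd3 H3]].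
  destruct (Hf (e / 4 * (a * a))%R) as [d2 [Hd2 H2]]; [repeat apply Rmult_lt_0_compat; lra|].
  assert (P4 := Cmod_ge_0 u).
  (* Chosen so that [u h (f (l + h) - f l)] is at most [e / 4 * a ^ 3 * |h|]. Since
     [|f (l + h)| >= a / 2], the denominator is at least [a ^ 3 / 2], which turns the total
     [e / 2 * a ^ 3 * |h|] into [e * |h|]. *)
  set (d5 := (e / 4 * (a * a * a) / ((1 + Cmod u) * (1 + Cmod u)))%R).
  assert (Hd5 : (0 < d5)).
  { unfold d5. apply Rdiv_lt_0_compat; [|clear - P4; nra].
    apply Rmult_lt_0_compat; [lra|]. repeat apply Rmult_lt_0_compat; assumption. }
  exists (Rmin (Rmin d1 d2) (Rmin d3 d5)).
  split; [min_pos|]. intros h Hh.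
  assert (G1 : (Cmod h < d1)) by (lt_min).
  assert (G2 : (Cmod h < d2)) by (lt_min).
  assert (G3 : (Cmod h < d3)) by (lt_min).
  assert (G5 : (Cmod h < d5)) by (lt_min).
  assert (H1' : (Cmod (f (l + h) - f l) < a / 2)).
  { apply H1. replace (l + h - l) with h by ring. exact G1. }
  specialize (H2 h G2). specialize (H3 h G3).
  assert (B1 : (a / 2 <= Cmod (f (l + h)))).
  { assert (T := Cmod_le_sub (f l) (f (l + h))). rewrite Cmod_sub_comm in T.
    rewrite <- Ea in T. lra. }
  assert (N1 : f (l + h) <> 0). { apply Cmod_gt_0. lra. }
  replace (/ f (l + h) - / f l - - u / (f l * f l) * h) with
    ((- ((f (l + h) - f l - u * h) * f l) + u * h * (f (l + h) - f l))
      * / (f (l + h) * (f l * f l))) by (field; auto).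
  assert (P0 := Cmod_ge_0 h).
  rewrite Cmod_mult, Cmod_inv.
  2: { repeat apply Cmult_neq_0; assumption. }
  apply Rle_div_l.
  { rewrite !Cmod_mult, <- Ea. clear - P1 B1. apply Rmult_gt_0_compat; [lra|nra]. }
  eapply Rle_trans; [apply Cmod_triangle|]. rewrite Cmod_opp, !Cmod_mult, <- Ea.
  unfold d5 in G5. apply Rlt_div_r in G5; [|clear - P4; nra].
  assert (Q1 : Cmod (f (l + h) - f l - u * h) * a <= e / 4 * (a * a) * Cmod h * a)
    by (apply Rmult_le_compat_r; [lra|exact H2]).
  assert (Q2 : Cmod u * Cmod h * Cmod (f (l + h) - f l)
     <= (1 + Cmod u) * Cmod h * ((1 + Cmod u) * Cmod h)).
  { apply Rmult_le_compat; [apply Rmult_le_pos; assumption|apply Cmod_ge_0| |exact H3].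
    apply Rmult_le_compat_r; lra. }
  assert (Q3 : (1 + Cmod u) * Cmod h * ((1 + Cmod u) * Cmod h) <= e / 4 * (a * a * a) * Cmod h).
  { apply Rle_trans with ((Cmod h * ((1 + Cmod u) * (1 + Cmod u))) * Cmod h)%R; [right; ring|].
    apply Rmult_le_compat_r; lra. }
  assert (Q4 : e * Cmod h * (a / 2 * (a * a)) <= e * Cmod h * (Cmod (f (l + h)) * (a * a))).
  { apply Rmult_le_compat_l; [clear - P0 He; nra|]. apply Rmult_le_compat_r; [clear - P1; nra|exact B1]. }
  eapply Rle_trans; [|exact Q4]. clear - Q1 Q2 Q3. lra.
Qed.

Lemma Cder_div (f g : C -> C) (l u v : C) :
  Cder f l u -> Cder g l v -> g l <> 0 ->
  Cder (fun x => f x / g x) l ((u * g l - f l * v) / (g l * g l)).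
Proof.
  intros Hf Hg H0.
  replace ((u * g l - f l * v) / (g l * g l)) with (u * / g l + f l * (- v / (g l * g l))).
  2: { field. assumption. }
  apply (Cder_mult f (fun x => / g x)); [assumption|]. now apply Cder_inv.
Qed.

(** * The complex exponential and its derivative *)

Lemma Cexp_plus (x y : C) : Cexp (x + y) = Cexp x * Cexp y.
Proof.
  destruct x as [x1 x2], y as [y1 y2]. unfold Cexp, Cmult. simpl.
  rewrite exp_plus, cos_plus, sin_plus. f_equal; ring.
Qed.

Lemma Cmod_Cexp (x : C) : Cmod (Cexp x) = exp (Re x).
Proof.
  unfold Cexp, Cmod. simpl.
  replace (exp (Re x) * cos (Im x) * (exp (Re x) * cos (Im x) * 1) +
     exp (Re x) * sin (Im x) * (exp (Re x) * sin (Im x) * 1))%R with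
    (Rsqr (exp (Re x)) * (Rsqr (sin (Im x)) + Rsqr (cos (Im x))))%R by (unfold Rsqr; ring).
  rewrite sin2_cos2, Rmult_1_r. apply sqrt_Rsqr. left; apply exp_pos.
Qed.

Lemma Cexp_neq_0 (x : C) : Cexp x <> 0.
Proof. apply Cmod_gt_0. rewrite Cmod_Cexp. apply exp_pos. Qed.

Lemma Cexp_0 : Cexp 0 = 1.
Proof. unfold Cexp. simpl. rewrite exp_0, cos_0, sin_0. unfold RtoC. f_equal; ring. Qed.

Lemma derivable_pt_lim_0_eps (f : R -> R) (v e : R) : derivable_pt_lim f 0 v -> 0 < e ->
  exists dl, 0 < dl /\ forall x, Rabs x < dl -> Rabs (f x - f 0 - v * x)%R <= e * Rabs x.
Proof.
  intros H He. destruct (H e He) as [[dl Hd] H1]. simpl in H1.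
  exists dl. split; [assumption|]. intros x Hx.
  destruct (Req_dec x 0) as [->|Hx0].
  - replace (f 0 - f 0 - v * 0)%R with 0%R by ring. rewrite Rabs_R0. lra.
  - specialize (H1 x Hx0 Hx). rewrite Rplus_0_l in H1.
    replace (f x - f 0 - v * x)%R with (((f x - f 0) / x - v) * x)%R by (field; assumption).
    rewrite Rabs_mult. apply Rmult_le_compat_r; [apply Rabs_pos|lra].
Qed.

Lemma Cder_Cexp_0 : Cder Cexp 0 1.
Proof.
  intros e He.
  assert (D1 : derivable_pt_lim exp 0 1) by
    (rewrite <- exp_0; apply derivable_pt_lim_exp).
  assert (D2 : derivable_pt_lim sin 0 1) by
    (rewrite <- cos_0; apply derivable_pt_lim_sin).
  assert (D3 : derivable_pt_lim cos 0 0).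
  { assert (T := derivable_pt_lim_cos 0). rewrite sin_0, Ropp_0 in T. exact T. }
  (* The five pieces of the real and imaginary errors add up to at most [7 k |h|]. *)
  set (k := Rmin 1 (e / 8)).
  assert (Hk : 0 < k) by (apply Rmin_pos; lra).
  assert (Hk1 : k <= 1) by apply Rmin_l.
  assert (Hk2 : k <= e / 8) by apply Rmin_r.
  clearbody k.
  destruct (derivable_pt_lim_0_eps _ _ k D1 Hk) as [d1 [P1 H1]].
  destruct (derivable_pt_lim_0_eps _ _ k D2 Hk) as [d2 [P2 H2]].
  destruct (derivable_pt_lim_0_eps _ _ k D3 Hk) as [d3 [P3 H3]].
  rewrite exp_0 in H1. rewrite sin_0 in H2. rewrite cos_0 in H3.
  exists (Rmin (Rmin d1 d2) (Rmin d3 k)). split; [min_pos|].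
  intros [x y] Hh. set (h := (x, y) : C) in *.
  assert (Hx := re_le_Cmod h). assert (Hy := Im_le_Cmod h). simpl in Hx, Hy.
  assert (L1 := Rmin_l (Rmin d1 d2) (Rmin d3 k)). assert (L2 := Rmin_r (Rmin d1 d2) (Rmin d3 k)).
  assert (L3 := Rmin_l d1 d2). assert (L4 := Rmin_r d1 d2).
  assert (L5 := Rmin_l d3 k). assert (L6 := Rmin_r d3 k).
  specialize (H1 x ltac:(lra)). specialize (H2 y ltac:(lra)). specialize (H3 y ltac:(lra)).
  replace (0 + h) with h by ring. rewrite Cexp_0.
  eapply Rle_trans; [apply Cmod_le_abs|].
  set (w := Cexp h - 1 - 1 * h).
  assert (W1 : Re w = ((exp x - 1 - 1 * x) * cos y + (1 + x) * (cos y - 1 - 0 * y))%R).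
  { unfold w, Cexp, h. simpl. ring. }
  assert (W2 : Im w = ((exp x - 1 - 1 * x) * sin y + x * sin y + (sin y - 0 - 1 * y))%R).
  { unfold w, Cexp, h. simpl. ring. }
  rewrite W1, W2.
  assert (C1 : Rabs (cos y) <= 1) by (apply Rabs_le; apply COS_bound).
  assert (S1 : Rabs (sin y) <= 1) by (apply Rabs_le; apply SIN_bound).
  assert (S2 : Rabs (sin y) <= 2 * Rabs y).
  { replace (sin y) with ((sin y - 0 - 1 * y) + y)%R by ring.
    eapply Rle_trans; [apply Rabs_triang|]. assert (T := Rabs_pos y). nra. }
  set (p := (exp x - 1 - 1 * x)%R) in *. set (q := (cos y - 1 - 0 * y)%R) in *.
  set (s := (sin y - 0 - 1 * y)%R) in *.
  assert (A1 : Rabs (p * cos y) <= k * Cmod h).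
  { rewrite Rabs_mult. assert (T := Rabs_pos p). assert (T2 := Rabs_pos (cos y)). nra. }
  assert (A2 : Rabs (p * sin y) <= k * Cmod h).
  { rewrite Rabs_mult. assert (T := Rabs_pos p). assert (T2 := Rabs_pos (sin y)). nra. }
  assert (A3 : Rabs ((1 + x) * q) <= 2 * (k * Cmod h)).
  { rewrite Rabs_mult. assert (T := Rabs_pos q).
    assert (T2 : Rabs (1 + x)%R <= 2).
    { eapply Rle_trans; [apply Rabs_triang|]. rewrite Rabs_R1. lra. }
    assert (T3 := Rabs_pos (1 + x)%R). nra. }
  assert (A4 : Rabs (x * sin y) <= 2 * (k * Cmod h)).
  { rewrite Rabs_mult. assert (T := Rabs_pos x). assert (T2 := Rabs_pos (sin y)).
    assert (Rabs x <= k) by lra. nra. }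
  assert (A5 : Rabs s <= k * Cmod h) by (assert (T := Rabs_pos y); nra).
  assert (B1 := Rabs_triang (p * cos y) ((1 + x) * q)).
  assert (B2 := Rabs_triang (p * sin y + x * sin y) s).
  assert (B3 := Rabs_triang (p * sin y) (x * sin y)).
  assert (B4 := Cmod_ge_0 h). nra.
Qed.

Lemma Cder_Cexp_lin (k l : C) : Cder (fun x => Cexp (k * x)) l (k * Cexp (k * l)).
Proof.
  intros e He.
  assert (P := Cmod_ge_0 (Cexp (k * l))). assert (Pk := Cmod_ge_0 k).
  set (D := ((1 + Cmod k) * (1 + Cmod (Cexp (k * l))))%R).
  assert (HD : 0 < D) by (unfold D; nra).
  destruct (Cder_Cexp_0 (e / D)%R) as [d1 [Hd1 H1]].
  { now apply Rdiv_lt_0_compat. }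
  exists (d1 / (1 + Cmod k))%R. split; [apply Rdiv_lt_0_compat; lra|].
  intros h Hh. apply Rlt_div_r in Hh; [|lra]. assert (Ph := Cmod_ge_0 h).
  assert (Hkh : Cmod (k * h) <= (1 + Cmod k) * Cmod h) by (rewrite Cmod_mult; nra).
  specialize (H1 (k * h) ltac:(lra)). rewrite Cexp_0, Cplus_0_l in H1.
  replace (k * (l + h)) with (k * l + k * h) by ring. rewrite Cexp_plus.
  replace (Cexp (k * l) * Cexp (k * h) - Cexp (k * l) - k * Cexp (k * l) * h)
    with (Cexp (k * l) * (Cexp (k * h) - 1 - 1 * (k * h))) by ring.
  rewrite Cmod_mult.
  apply Rle_trans with (Cmod (Cexp (k * l)) * (e / D * ((1 + Cmod k) * Cmod h)))%R.
  { apply Rmult_le_compat_l; [assumption|]. eapply Rle_trans; [exact H1|].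
    apply Rmult_le_compat_l; [left; now apply Rdiv_lt_0_compat|exact Hkh]. }
  replace (Cmod (Cexp (k * l)) * (e / D * ((1 + Cmod k) * Cmod h)))%R with
    (Cmod (Cexp (k * l)) / (1 + Cmod (Cexp (k * l))) * (e * Cmod h))%R
    by (unfold D; field; split; lra).
  rewrite <- (Rmult_1_l (e * Cmod h)) at 2. apply Rmult_le_compat_r.
  - apply Rmult_le_pos; lra.
  - apply Rle_div_l; lra.
Qed.

Lemma Cder_tpow (p l : C) : Cder (fun x => tpow x p) l (p * tpow l p).
Proof. apply Cder_Cexp_lin. Qed.

Lemma Cder_line (f : C -> C) (l v u : C) (s : R) :
  Cder f (l + s * v) u ->
  derivable_pt_lim (fun s' : R => Re (f (l + s' * v))) s (Re (u * v)).
Proof.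
  intros H e He. assert (Pv := Cmod_ge_0 v).
  destruct (H (e / 2 / (1 + Cmod v))%R) as [dl [Hd H1]].
  { repeat apply Rdiv_lt_0_compat; lra. }
  assert (Hd2 : 0 < dl / (1 + Cmod v)) by (apply Rdiv_lt_0_compat; lra).
  exists (mkposreal _ Hd2). intros h Hh0 Hh. change (Rabs h < dl / (1 + Cmod v)) in Hh.
  apply Rlt_div_r in Hh; [|lra].
  assert (Hp : 0 < Rabs h) by now apply Rabs_pos_lt.
  assert (Hc : Cmod (h * v) <= (1 + Cmod v) * Rabs h).
  { rewrite Cmod_mult, Cmod_R. nra. }
  specialize (H1 (h * v) ltac:(lra)).
  replace (l + s * v + h * v) with (l + (s + h)%R * v) in H1
    by (rewrite RtoC_plus; ring).
  set (x1 := f (l + (s + h)%R * v)) in *. set (x0 := f (l + s * v)) in *.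
  set (w := x1 - x0 - u * (h * v)) in *.
  assert (E : (Re x1 - Re x0 = Re w + h * Re (u * v))%R).
  { unfold w. destruct x1, x0, u, v. simpl. ring. }
  rewrite E. replace ((Re w + h * Re (u * v)) / h - Re (u * v))%R with (Re w / h)%R
    by (field; assumption).
  unfold Rdiv. rewrite Rabs_mult, Rabs_inv. apply Rlt_div_l; [assumption|].
  eapply Rle_lt_trans; [apply re_le_Cmod|]. eapply Rle_lt_trans; [exact H1|].
  apply Rle_lt_trans with (e / 2 / (1 + Cmod v) * ((1 + Cmod v) * Rabs h))%R.
  { apply Rmult_le_compat_l; [|assumption]. left; repeat apply Rdiv_lt_0_compat; lra. }
  replace (e / 2 / (1 + Cmod v) * ((1 + Cmod v) * Rabs h))%R with (e / 2 * Rabs h)%R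
    by (field; lra). nra.
Qed.

(* The scalar mean value theorem is applied to the projection of [f] on the direction of its
   increment. *)
Lemma segment_increment_le (f : C -> C) (g : R -> C) (phi dphi : R -> R) (l v : C) (s0 s1 : R) :
  s0 <= s1 ->
  (forall s, s0 <= s <= s1 -> Cder f (l + s * v) (g s)) ->
  (forall s, s0 <= s <= s1 -> derivable_pt_lim phi s (dphi s)) ->
  (forall s, s0 <= s <= s1 -> Cmod (g s * v) <= dphi s) ->
  Cmod (f (l + s1 * v) - f (l + s0 * v)) <= (phi s1 - phi s0)%R.
Proof.
  intros H01 Hf Hphi Hle.
  set (w := f (l + s1 * v) - f (l + s0 * v)).
  destruct H01 as [H01|<-].
  2: { unfold w. replace (f (l + s0 * v) - f (l + s0 * v)) with (RtoC 0) by ring.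
       rewrite Cmod_0. lra. }
  (* The derivative of [|w| phi - Re (conj w * f)] is nonnegative by hypothesis, and the increment
     of [Re (conj w * f)] is [|w| ^ 2]; dividing by [|w|] gives the claim. *)
  destruct (MVT_cor2
    (fun s => (Cmod w * phi s - Re (Cconj w * f (l + s * v)%C))%R)
    (fun s => (Cmod w * dphi s - Re ((Cconj w * g s) * v))%R) s0 s1 H01) as [x [Hx Hx2]].
  { intros s Hs. apply derivable_pt_lim_minus.
    - apply derivable_pt_lim_scal. now apply Hphi.
    - apply (Cder_line (fun m => Cconj w * f m)). apply Cder_scal. now apply Hf. }
  assert (Hpos : 0 <= Cmod w * dphi x - Re (Cconj w * g x * v)).
  { assert (T := re_le_Cmod (Cconj w * g x * v)).
    assert (T2 := Rle_abs (Re (Cconj w * g x * v))).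
    replace (Cconj w * g x * v) with (Cconj w * (g x * v)) in * by ring.
    rewrite Cmod_mult, Cmod_conj in T.
    assert (T3 := Hle x ltac:(lra)). assert (T4 := Cmod_ge_0 w).
    assert (Cmod w * Cmod (g x * v) <= Cmod w * dphi x) by (now apply Rmult_le_compat_l).
    lra. }
  assert (E : (Re (Cconj w * f (l + s1 * v)%C) - Re (Cconj w * f (l + s0 * v)%C) = Cmod w * Cmod w)%R).
  { replace (Cmod w * Cmod w)%R with (Cmod w ^ 2)%R by ring. rewrite Cmod2_alt.
    assert (E1 : f (l + s1 * v) = f (l + s0 * v) + w) by (unfold w; ring).
    rewrite E1. destruct w, (f (l + s0 * v)). simpl. ring. }
  assert (P := Cmod_ge_0 w).
  assert (0 <= (Cmod w * dphi x - Re (Cconj w * g x * v)) * (s1 - s0)) by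
    (apply Rmult_le_pos; lra).
  destruct P as [P|P]; [|rewrite <- P in *].
  - apply Rmult_le_reg_l with (Cmod w); [assumption|]. nra.
  (* When [w = 0] there is no direction to project on; it remains that [phi] does not decrease, its
     derivative being bounded below by a modulus. *)
  - assert (Hd : 0 <= phi s1 - phi s0).
    { destruct (MVT_cor2 phi dphi s0 s1 H01 Hphi) as [x2 [Hy Hy2]]. rewrite Hy.
      apply Rmult_le_pos; [|lra]. eapply Rle_trans; [apply Cmod_ge_0|apply (Hle x2); lra]. }
    exact Hd.
Qed.

Lemma segment_lip (f g : C -> C) (l v : C) (K : R) :
  (forall s, 0 <= s <= 1 -> Cder f (l + s * v) (g (l + s * v))) ->
  (forall s, 0 <= s <= 1 -> Cmod (g (l + s * v)) <= K) ->
  Cmod (f (l + v) - f l) <= K * Cmod v.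
Proof.
  intros Hf Hg.
  assert (H := segment_increment_le f (fun s => g (l + s * v)) (fun s => (s * (K * Cmod v))%R)
    (fun _ => (1 * (K * Cmod v))%R) l v 0 1 ltac:(lra) Hf).
  replace (l + 1%R * v) with (l + v) in H by ring.
  replace (l + 0%R * v) with l in H by ring.
  eapply Rle_trans; [apply H|lra].
  - intros s _. apply derivable_pt_lim_scal_right, derivable_pt_lim_id.
  - intros s Hs. rewrite Cmod_mult, Rmult_1_l. apply Rmult_le_compat_r; [apply Cmod_ge_0|auto].
Qed.

(** Limit 0 along the horizontal ray to the left of [l], that is, radially as [t -> 0] with fixed
    argument. It fixes the constant of integration in all estimates that integrate from [t = 0]. *)
Definition vanishing (f : C -> C) (l : C) : Prop :=
  forall e, 0 < e -> exists s0, s0 <= 0 /\ forall s : R, s <= s0 -> Cmod (f (l + s)) <= e.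

Lemma vanishing_shift (f : C -> C) (l : C) (s1 : R) :
  vanishing f l -> vanishing f (l + s1).
Proof.
  intros H e He. destruct (H e He) as [s0 [H0 H1]].
  exists (Rmin 0 (s0 - s1)). split; [apply Rmin_l|]. intros s Hs.
  replace (l + s1 + s) with (l + (s1 + s)%R) by (rewrite RtoC_plus; ring).
  apply H1. assert (T := Rmin_r 0 (s0 - s1)). lra.
Qed.

Lemma vanishing_plus (f g : C -> C) (l : C) :
  vanishing f l -> vanishing g l -> vanishing (fun x => f x + g x) l.
Proof.
  intros Hf Hg e He. destruct (Hf (e / 2)%R) as [s0 [H0 H1]]; [lra|].
  destruct (Hg (e / 2)%R) as [s1 [H2 H3]]; [lra|].
  exists (Rmin s0 s1). split; [apply Rle_trans with s0; [apply Rmin_l|assumption]|].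
  intros s Hs. specialize (H1 s (Rle_trans _ _ _ Hs (Rmin_l _ _))).
  specialize (H3 s (Rle_trans _ _ _ Hs (Rmin_r _ _))).
  eapply Rle_trans; [apply Cmod_triangle|]. lra.
Qed.

Lemma ray_bound (f g : C -> C) (l : C) (phi dphi : R -> R) :
  (forall s : R, s <= 0 -> Cder f (l + s) (g (l + s))) ->
  (forall s, s <= 0 -> derivable_pt_lim phi s (dphi s)) ->
  (forall s, s <= 0 -> 0 <= phi s) ->
  (forall s : R, s <= 0 -> Cmod (g (l + s)) <= dphi s) ->
  vanishing f l -> Cmod (f l) <= phi 0.
Proof.
  intros Hf Hphi Hpos Hg Hv. apply le_epsilon. intros e He.
  destruct (Hv e He) as [s0 [H0 H1]]. specialize (H1 s0 (Rle_refl _)).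
  assert (H := segment_increment_le f (fun s => g (l + s)) phi dphi l 1 s0 0 H0).
  assert (E : forall s : R, l + s * 1 = l + s) by (intros; ring).
  rewrite (E 0%R) in H. rewrite E in H. replace (l + 0%R) with l in H by ring.
  assert (H2 : Cmod (f l - f (l + s0)) <= (phi 0 - phi s0)%R).
  { apply H; intros s Hs.
    - rewrite E. apply Hf. lra.
    - apply Hphi; lra.
    - replace (g (l + s) * 1) with (g (l + s)) by ring. apply Hg; lra. }
  assert (T := Cmod_le_sub (f l) (f (l + s0))). assert (T2 := Hpos s0 H0). lra.
Qed.

Lemma derivable_pt_lim_exp_affine (k x s : R) :
  (derivable_pt_lim (fun s => exp (k * (x + s))) s (k * exp (k * (x + s))))%R.
Proof.
  replace (k * exp (k * (x + s)))%R with (exp (k * (x + s)) * (k * 1))%R by ring.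
  apply (derivable_pt_lim_comp (fun s => k * (x + s))%R exp); [|apply derivable_pt_lim_exp].
  apply derivable_pt_lim_scal. replace 1%R with (0 + 1)%R by ring.
  apply (derivable_pt_lim_plus (fun _ => x) (fun s => s));
    [apply derivable_pt_lim_const|apply derivable_pt_lim_id].
Qed.

(** The comparison function is the exact primitive of the exponential bound on [g]. Integration from
    [t = 0] thus costs a factor [/ b] and keeps the exponent. *)
Lemma ray_exp_bound (f g : C -> C) (l : C) (K b : R) :
  0 < b -> 0 <= K ->
  (forall s : R, s <= 0 -> Cder f (l + s) (g (l + s))) ->
  (forall s : R, s <= 0 -> Cmod (g (l + s)) <= K * exp (b * (Re l + s))) ->
  vanishing f l -> Cmod (f l) <= K / b * exp (b * Re l).
Proof.
  intros Hb HK Hf Hg Hv.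
  assert (H := ray_bound f g l (fun s => (K / b * exp (b * (Re l + s)))%R)
    (fun s => (K / b * (b * exp (b * (Re l + s))))%R)).
  simpl in H. rewrite Rplus_0_r in H. apply H; try assumption; clear H; intros s Hs.
  - apply derivable_pt_lim_scal, derivable_pt_lim_exp_affine.
  - apply Rmult_le_pos; [|left; apply exp_pos].
    apply Rmult_le_pos; [assumption|left; now apply Rinv_0_lt_compat].
  - eapply Rle_trans; [now apply Hg|]. right. field. lra.
Qed.

(** Termwise differentiation. The mean value inequality applied to [f m - f n] makes the increments
    of all late terms close to those of one term, uniformly in [h] relative to [|h|]; this survives
    the limit in [m]. *)
Lemma Cder_limit (f g : nat -> C -> C) (F G : C -> C) (l : C) (rad : R) (eta : nat -> R) :
  0 < rad ->
  (forall n m, Cmod (m - l) < rad -> Cder (f n) m (g n m)) ->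
  (forall n m, Cmod (m - l) < rad -> Cmod (g n m - G m) <= eta n) ->
  (forall m, Cmod (m - l) < rad -> forall e, 0 < e -> exists n0, forall n, (n0 <= n)%nat ->
     Cmod (f n m - F m) <= e) ->
  (forall e, 0 < e -> exists n0, forall n, (n0 <= n)%nat -> eta n <= e) ->
  Cder F l (G l).
Proof.
  intros Hr Hf Hg HF Heta e He.
  assert (Hl : Cmod (l - l) < rad).
  { replace (l - l) with (RtoC 0) by ring. now rewrite Cmod_0. }
  destruct (Heta (e / 4)%R) as [n Hn]; [lra|].
  destruct (Hf n l Hl (e / 4)%R) as [d1 [Hd1 H1]]; [lra|].
  exists (Rmin rad d1). split; [now apply Rmin_pos|]. intros h Hh.
  assert (G1 := Rlt_le_trans _ _ _ Hh (Rmin_l _ _)).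
  assert (G2 := Rlt_le_trans _ _ _ Hh (Rmin_r _ _)).
  specialize (H1 h G2). assert (Ph := Cmod_ge_0 h).
  assert (Hlh : Cmod (l + h - l) < rad) by (replace (l + h - l) with h by ring; assumption).
  assert (Hseg : forall s, 0 <= s <= 1 -> Cmod (l + s * h - l) < rad).
  { intros s Hs. replace (l + s * h - l) with (s * h) by ring.
    rewrite Cmod_mult, Cmod_R, Rabs_pos_eq by lra. nra. }
  assert (L : forall m, (n <= m)%nat ->
    Cmod ((f m (l + h) - f n (l + h)) - (f m l - f n l)) <= e / 2 * Cmod h).
  { intros m Hm. apply (segment_lip (fun x => f m x - f n x) (fun x => g m x - g n x)).
    - intros s Hs. apply Cder_minus; apply Hf; auto.
    - intros s Hs. specialize (Hseg s Hs).
      assert (A1 := Hg m _ Hseg). assert (A2 := Hg n _ Hseg).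
      assert (A3 := Hn n (Nat.le_refl n)). assert (A4 := Hn m Hm).
      replace (g m (l + s * h) - g n (l + s * h)) with
        ((g m (l + s * h) - G (l + s * h)) - (g n (l + s * h) - G (l + s * h))) by ring.
      eapply Rle_trans; [apply Cmod_triangle_sub|]. lra. }
  assert (L2 : Cmod ((F (l + h) - f n (l + h)) - (F l - f n l)) <= e / 2 * Cmod h).
  { apply le_epsilon. intros e2 He2.
    destruct (HF _ Hlh (e2 / 2)%R) as [n1 N1]; [lra|].
    destruct (HF _ Hl (e2 / 2)%R) as [n2 N2]; [lra|].
    set (m := Nat.max n (Nat.max n1 n2)).
    specialize (N1 m ltac:(lia)). specialize (N2 m ltac:(lia)). specialize (L m ltac:(lia)).
    replace (F (l + h) - f n (l + h) - (F l - f n l)) with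
      ((f m (l + h) - f n (l + h) - (f m l - f n l))
        + ((f m l - F l) - (f m (l + h) - F (l + h)))) by ring.
    eapply Rle_trans; [apply Cmod_triangle|].
    assert (T := Cmod_triangle_sub (f m l - F l) (f m (l + h) - F (l + h))). lra. }
  assert (A3 := Hn n (Nat.le_refl n)). assert (A2 := Hg n l Hl).
  replace (F (l + h) - F l - G l * h) with
    ((F (l + h) - f n (l + h) - (F l - f n l)) + ((f n (l + h) - f n l - g n l * h)
      + (g n l - G l) * h)) by ring.
  eapply Rle_trans; [apply Cmod_triangle|].
  assert (T := Cmod_triangle (f n (l + h) - f n l - g n l * h) ((g n l - G l) * h)).
  rewrite (Cmod_mult (g n l - G l)) in T.
  assert (Cmod (g n l - G l) * Cmod h <= e / 4 * Cmod h).
  { apply Rmult_le_compat_r; [assumption|lra]. }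
  lra.
Qed.

Lemma half_pow_small (K e : R) : 0 < e -> exists n0, forall n, (n0 <= n)%nat -> K * (/ 2) ^ n <= e.
Proof.
  intros He. destruct (Rle_dec K 0) as [HK|HK].
  - exists 0%nat. intros n _. assert (0 < (/ 2) ^ n) by (apply pow_lt; lra). nra.
  - destruct (pow_lt_1_zero (/ 2) ltac:(rewrite Rabs_pos_eq; lra) (e / K)%R) as [n0 H].
    { apply Rdiv_lt_0_compat; lra. }
    exists n0. intros n Hn. specialize (H n Hn).
    rewrite Rabs_pos_eq in H by (left; apply pow_lt; lra).
    apply Rlt_div_r in H; lra.
Qed.

(** The subtracted term, the part of the geometric series not yet consumed, makes the induction on
    [k] close: the next increment is half of it. *)
Lemma geom_tail (u : nat -> R) (K : R) :
  (forall n, Rabs (u (S n) - u n) <= K * (/ 2) ^ n) ->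
  forall n k, Rabs (u (n + k)%nat - u n) <= (2 * K * (/ 2) ^ n - 2 * K * (/ 2) ^ (n + k))%R.
Proof.
  intros H n k. induction k as [|k IH].
  - rewrite Nat.add_0_r. unfold Rminus. rewrite !Rplus_opp_r, Rabs_R0. lra.
  - rewrite Nat.add_succ_r. specialize (H (n + k)%nat).
    replace (u (S (n + k)) - u n)%R with ((u (S (n + k)) - u (n + k)%nat) + (u (n + k)%nat - u n))%R
      by ring.
    eapply Rle_trans; [apply Rabs_triang|]. simpl pow in *. lra.
Qed.

Lemma geom_cauchy_R (u : nat -> R) (K : R) :
  (forall n, Rabs (u (S n) - u n) <= K * (/ 2) ^ n) ->
  exists v, forall n, Rabs (u n - v) <= 2 * K * (/ 2) ^ n.
Proof.
  intros H. assert (HK : 0 <= K).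
  { specialize (H 0%nat). simpl in H. assert (T := Rabs_pos (u 1%nat - u 0%nat)). lra. }
  assert (Hp : forall n, 0 < (/ 2) ^ n) by (intros; apply pow_lt; lra).
  assert (T := geom_tail u K H).
  assert (HC : Cauchy_crit u).
  { intros e He. destruct (half_pow_small (4 * K) (e / 2)%R) as [n0 H0]; [lra|].
    exists n0. intros n m Hn Hm. unfold Rdist.
    assert (Tn := T n0 (n - n0)%nat). assert (Tm := T n0 (m - n0)%nat).
    replace (n0 + (n - n0))%nat with n in Tn by lia.
    replace (n0 + (m - n0))%nat with m in Tm by lia.
    specialize (H0 n0 (Nat.le_refl _)).
    replace (u n - u m)%R with ((u n - u n0) - (u m - u n0))%R by ring.
    eapply Rle_lt_trans; [apply Rabs_triang|]. rewrite Rabs_Ropp.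
    assert (Pn := Hp n). assert (Pm := Hp m). nra. }
  destruct (Rcomplete.R_complete u HC) as [v Hv]. exists v. intros n. apply le_epsilon. intros e He.
  destruct (Hv e He) as [n0 H0]. specialize (H0 (n + n0)%nat ltac:(lia)). unfold Rdist in H0.
  specialize (T n n0).
  replace (u n - v)%R with (- (u (n + n0)%nat - u n) + (u (n + n0)%nat - v))%R by ring.
  eapply Rle_trans; [apply Rabs_triang|]. rewrite Rabs_Ropp.
  assert (P := Hp (n + n0)%nat). nra.
Qed.

Lemma geom_cauchy (u : nat -> C) (K : R) :
  (forall n, Cmod (u (S n) - u n) <= K * (/ 2) ^ n) ->
  exists v, forall n, Cmod (u n - v) <= 4 * K * (/ 2) ^ n.
Proof.
  intros H.
  destruct (geom_cauchy_R (fun n => Re (u n)) K) as [v1 H1].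
  { intros n. eapply Rle_trans; [|apply (H n)].
    replace (Re (u (S n)) - Re (u n))%R with (Re (u (S n) - u n)) by reflexivity.
    apply re_le_Cmod. }
  destruct (geom_cauchy_R (fun n => Im (u n)) K) as [v2 H2].
  { intros n. eapply Rle_trans; [|apply (H n)].
    replace (Im (u (S n)) - Im (u n))%R with (Im (u (S n) - u n)) by reflexivity.
    apply Im_le_Cmod. }
  exists (v1, v2). intros n. eapply Rle_trans; [apply Cmod_le_abs|].
  specialize (H1 n). specialize (H2 n).
  replace (Re (u n - (v1, v2))) with (Re (u n) - v1)%R by reflexivity.
  replace (Im (u n - (v1, v2))) with (Im (u n) - v2)%R by reflexivity. lra.
Qed.

(** * Systems driven by exponentials *)

Definition csum (L : list C) : C := fold_right Cplus 0 L.
Definition rsum (L : list R) : R := fold_right Rplus 0%R L.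

Lemma csum_app (L1 L2 : list C) : csum (L1 ++ L2) = csum L1 + csum L2.
Proof. induction L1 as [|x L1 IH]; simpl; [ring|]. rewrite IH. ring. Qed.

Lemma csum_map_sub {A : Type} (f g : A -> C) (L : list A) :
  csum (map f L) - csum (map g L) = csum (map (fun x => f x - g x) L).
Proof. induction L as [|x L IH]; simpl; [ring|]. rewrite <- IH. ring. Qed.

Lemma csum_bound {A : Type} (f : A -> C) (h : A -> R) (K : R) (L : list A) :
  (forall x, In x L -> Cmod (f x) <= h x * K) ->
  Cmod (csum (map f L)) <= rsum (map h L) * K.
Proof.
  induction L as [|x L IH]; intros H; simpl.
  - rewrite Cmod_0. lra.
  - eapply Rle_trans; [apply Cmod_triangle|].
    assert (H1 := H x (or_introl eq_refl)).
    assert (H2 : Cmod (csum (map f L)) <= rsum (map h L) * K) by (apply IH; intros; apply H; now right).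
    lra.
Qed.

(* An exponential sum [sum_i c_i exp (p_i l)] is represented by the list of the [(c_i, p_i)]. *)
Definition expo (L : list (C * C)) (l : C) : C :=
  csum (map (fun cp => fst cp * Cexp (snd cp * l)) L).

Definition expo_ge (a : R) (L : list (C * C)) : Prop :=
  forall cp, In cp L -> a <= Re (snd cp).

(** The primitive without constant term: it is the one that vanishes as [Re l] tends to [- oo] when
    all exponents have positive real part. *)
Definition expo_prim (L : list (C * C)) : list (C * C) :=
  map (fun cp => (fst cp / snd cp, snd cp)) L.

Definition expo_mul (k p : C) (L1 L2 : list (C * C)) : list (C * C) :=
  flat_map (fun x => map (fun y => (k * fst x * fst y, p + snd x + snd y)) L2) L1.

Lemma expo_app (L1 L2 : list (C * C)) (l : C) : expo (L1 ++ L2) l = expo L1 l + expo L2 l.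
Proof. unfold expo. now rewrite map_app, csum_app. Qed.

Lemma expo_cons (x : C * C) (L : list (C * C)) (l : C) :
  expo (x :: L) l = fst x * Cexp (snd x * l) + expo L l.
Proof. reflexivity. Qed.

Lemma expo_mul_eval (k p : C) (L1 L2 : list (C * C)) (l : C) :
  expo (expo_mul k p L1 L2) l = k * Cexp (p * l) * expo L1 l * expo L2 l.
Proof.
  unfold expo_mul. induction L1 as [|x L1 IH]; simpl.
  - unfold expo at 1 2. simpl. ring.
  - rewrite expo_app, IH, expo_cons.
    assert (E : expo (map (fun y => (k * fst x * fst y, p + snd x + snd y)) L2) l
      = k * fst x * Cexp (p * l) * Cexp (snd x * l) * expo L2 l).
    { clear IH. induction L2 as [|y L2 IH]; simpl.
      - unfold expo. simpl. ring.
      - rewrite !expo_cons, IH. simpl.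
        replace ((p + snd x + snd y) * l) with (p * l + snd x * l + snd y * l) by ring.
        rewrite !Cexp_plus. ring. }
    rewrite E. ring.
Qed.

Lemma expo_mul_ge (k p : C) (L1 L2 : list (C * C)) (a1 a2 : R) :
  expo_ge a1 L1 -> expo_ge a2 L2 -> expo_ge (Re p + a1 + a2) (expo_mul k p L1 L2).
Proof.
  intros H1 H2 cp H. unfold expo_mul in H. apply in_flat_map in H as [x [Hx H]].
  apply in_map_iff in H as [y [<- Hy]]. simpl.
  specialize (H1 x Hx). specialize (H2 y Hy). unfold Re in *. lra.
Qed.

Lemma Cder_expo_prim (L : list (C * C)) (l : C) (a : R) : 0 < a -> expo_ge a L ->
  Cder (expo (expo_prim L)) l (expo L l).
Proof.
  intros Ha. induction L as [|[k p] L IH]; intros HL.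
  - exact (Cder_const 0 l).
  - apply (Cder_ext (fun x => k / p * Cexp (p * x) + expo (expo_prim L) x) _ _ _ 1);
      [lra|reflexivity|].
    rewrite expo_cons. simpl.
    assert (Hp : p <> 0).
    { intros ->. specialize (HL _ (or_introl eq_refl)). simpl in HL. lra. }
    apply Cder_plus.
    + replace (k * Cexp (p * l)) with (k / p * (p * Cexp (p * l))) by (field; assumption).
      apply Cder_scal, Cder_Cexp_lin.
    + apply IH. intros cp H. apply HL. now right.
Qed.

Lemma exp_le_compat (x y : R) : x <= y -> exp x <= exp y.
Proof. intros [H| ->]; [left; now apply exp_increasing|apply Rle_refl]. Qed.

Lemma exp_bound_vanishing (f : C -> C) (l : C) (K a : R) : 0 < a ->
  (forall s : R, s <= 0 -> Cmod (f (l + s)) <= K * exp (a * (Re l + s))) -> vanishing f l.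
Proof.
  intros Ha H e He. assert (HK : 0 < 1 + Rabs K) by (assert (T := Rabs_pos K); lra).
  (* The point at which [(1 + |K|) exp (a (Re l + s))] equals [e]. *)
  set (s1 := (ln (e / (1 + Rabs K)) / a - Re l)%R).
  exists (Rmin 0 s1). split; [apply Rmin_l|]. intros s Hs.
  assert (S0 := Rle_trans _ _ _ Hs (Rmin_l _ _)). assert (S1 := Rle_trans _ _ _ Hs (Rmin_r _ _)).
  eapply Rle_trans; [now apply H|].
  assert (E : exp (a * (Re l + s)) <= e / (1 + Rabs K)).
  { rewrite <- (exp_ln (e / (1 + Rabs K))) by (now apply Rdiv_lt_0_compat).
    apply exp_le_compat. unfold s1 in S1.
    replace (ln (e / (1 + Rabs K))) with (a * (Re l + (ln (e / (1 + Rabs K)) / a - Re l)))%R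
      by (field; lra).
    apply Rmult_le_compat_l; lra. }
  assert (P := exp_pos (a * (Re l + s))). assert (T := Rle_abs K). assert (T2 := Rabs_pos K).
  apply Rle_trans with ((1 + Rabs K) * exp (a * (Re l + s)))%R.
  { apply Rmult_le_compat_r; lra. }
  apply Rle_trans with ((1 + Rabs K) * (e / (1 + Rabs K)))%R.
  { apply Rmult_le_compat_l; lra. }
  right. field. lra.
Qed.

Lemma expo_vanishing (L : list (C * C)) (l : C) (a : R) : 0 < a -> expo_ge a L ->
  vanishing (expo L) l.
Proof.
  intros Ha. induction L as [|[k p] L IH]; intros HL.
  - intros e He. exists 0%R. split; [lra|]. intros s _. unfold expo. simpl. rewrite Cmod_0. lra.
  - apply (vanishing_plus (fun x => k * Cexp (p * x)) (expo L)).
    + assert (Hp : a <= Re p) by apply (HL _ (or_introl eq_refl)).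
      apply (exp_bound_vanishing _ _ (Cmod k * exp (- Im p * Im l)) (Re p)); [lra|].
      intros s _. rewrite Cmod_mult, Cmod_Cexp, Rmult_assoc, <- exp_plus.
      right. f_equal. f_equal. destruct p, l. simpl. ring.
    + apply IH. intros cp H. apply HL. now right.
Qed.

Section System.

(* The system [V_i' = sum k exp (p l) V_j V_l], the sum over the [(k, p, j, l)] in [tm i],
   in which [V_i] has size [exp (w_i Re l)] and every term gains a factor [exp (g Re l)]. *)
Variable I : Type.
Variable tm : I -> list (C * C * I * I).
Variables (w : I -> R) (g M S : R).
Hypothesis (Hw : forall i, 0 <= w i) (Hg : 0 < g) (HS : 0 < S).
Hypothesis Hgap : forall i k p j j', In (k, p, j, j') (tm i) -> w i + g <= Re p + w j + w j'.
Hypothesis Hcoef : forall i,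
  rsum (map (fun q => let '(k, p, j, j') := q in Cmod k * exp (Rabs (Im p) * M))%R (tm i)) <= S.

Definition rhs (V : I -> C -> C) (i : I) (l : C) : C :=
  csum (map (fun q => let '(k, p, j, j') := q in k * Cexp (p * l) * V j l * V j' l) (tm i)).

Definition bdd (V : I -> C -> C) (B : R) (l : C) : Prop :=
  forall i, Cmod (V i l) <= B * exp (w i * Re l).

(** On the strip [|Im l| <= M] the factor [exp (|Im p| M)] absorbs the rotation in [exp (p l)],
    leaving real exponentials in [Re l]. Since [Re l <= 0], [Hgap] then replaces the sum of the
    three rates by [w i + g]. *)
Lemma monomial_bound (i : I) (k p x y : C) (j j' : I) (X Y : R) (l : C) :
  In (k, p, j, j') (tm i) -> Re l <= 0 -> Rabs (Im l) <= M -> 0 <= X -> 0 <= Y ->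
  Cmod x <= X * exp (w j * Re l) -> Cmod y <= Y * exp (w j' * Re l) ->
  Cmod (k * Cexp (p * l) * x * y)
    <= Cmod k * exp (Rabs (Im p) * M) * (X * Y * exp ((w i + g) * Re l)).
Proof.
  intros Hin Hl HM HX HY Hx Hy. rewrite !Cmod_mult, Cmod_Cexp.
  assert (E1 : exp (Re (p * l)) <= exp (Rabs (Im p) * M) * exp (Re p * Re l)).
  { rewrite <- exp_plus. apply exp_le_compat.
    replace (Re (p * l)) with (Re p * Re l - Im p * Im l)%R by (destruct p, l; simpl; ring).
    assert (T : - (Im p * Im l) <= Rabs (Im p) * M).
    { eapply Rle_trans; [apply Rle_abs|]. rewrite Rabs_Ropp, Rabs_mult.
      apply Rmult_le_compat_l; [apply Rabs_pos|assumption]. }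
    lra. }
  assert (E2 : exp (Re p * Re l) * exp (w j * Re l) * exp (w j' * Re l) <= exp ((w i + g) * Re l)).
  { rewrite <- !exp_plus. apply exp_le_compat. specialize (Hgap _ _ _ _ _ Hin). nra. }
  assert (P1 := Cmod_ge_0 k). assert (P2 := Cmod_ge_0 x). assert (P3 := Cmod_ge_0 y).
  assert (Q1 := exp_pos (Re (p * l))). assert (Q2 := exp_pos (Rabs (Im p) * M)).
  assert (Q3 := exp_pos (Re p * Re l)). assert (Q4 := exp_pos (w j * Re l)).
  assert (Q5 := exp_pos (w j' * Re l)).
  rewrite !Rmult_assoc. apply Rmult_le_compat_l; [assumption|].
  apply Rle_trans with (exp (Rabs (Im p) * M) * exp (Re p * Re l)
    * ((X * exp (w j * Re l)) * (Y * exp (w j' * Re l))))%R.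
  { apply Rmult_le_compat; [lra| |assumption|].
    - now apply Rmult_le_pos.
    - now apply Rmult_le_compat. }
  apply Rle_trans with (exp (Rabs (Im p) * M) * (X * Y *
     (exp (Re p * Re l) * exp (w j * Re l) * exp (w j' * Re l))))%R; [right; ring|].
  apply Rmult_le_compat_l; [lra|]. rewrite <- (Rmult_assoc X). apply Rmult_le_compat_l.
  { now apply Rmult_le_pos. }
  assumption.
Qed.

Lemma rhs_bound (V : I -> C -> C) (B : R) (l : C) (i : I) :
  0 <= B -> Re l <= 0 -> Rabs (Im l) <= M -> bdd V B l ->
  Cmod (rhs V i l) <= S * (B * B * exp ((w i + g) * Re l)).
Proof.
  intros HB Hl HM HV. unfold rhs. eapply Rle_trans.
  - apply csum_bound with
      (h := fun q => (let '(k, p, j, j') := q in Cmod k * exp (Rabs (Im p) * M))%R)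
      (K := (B * B * exp ((w i + g) * Re l))%R).
    intros [[[k p] j] j'] Hin. now apply (monomial_bound i k p _ _ j j').
  - apply Rmult_le_compat_r; [|apply Hcoef].
    apply Rmult_le_pos; [nra|left; apply exp_pos].
Qed.

Lemma rhs_diff (V W : I -> C -> C) (B D : R) (l : C) (i : I) :
  0 <= B -> 0 <= D -> Re l <= 0 -> Rabs (Im l) <= M -> bdd V B l -> bdd W B l ->
  (forall j, Cmod (V j l - W j l) <= D * exp (w j * Re l)) ->
  Cmod (rhs V i l - rhs W i l) <= S * (2 * B * D * exp ((w i + g) * Re l)).
Proof.
  intros HB HD Hl HM HV HW HVW. unfold rhs. rewrite csum_map_sub. eapply Rle_trans.
  - apply csum_bound with
      (h := fun q => (let '(k, p, j, j') := q in Cmod k * exp (Rabs (Im p) * M))%R)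
      (K := (2 * B * D * exp ((w i + g) * Re l))%R).
    intros [[[k p] j] j'] Hin.
    replace (k * Cexp (p * l) * V j l * V j' l - k * Cexp (p * l) * W j l * W j' l)
      with (k * Cexp (p * l) * (V j l - W j l) * V j' l
        + k * Cexp (p * l) * W j l * (V j' l - W j' l)) by ring.
    eapply Rle_trans; [apply Cmod_triangle|].
    assert (T1 := monomial_bound i k p (V j l - W j l) (V j' l) j j' D B l Hin Hl HM HD HB
      (HVW j) (HV j')).
    assert (T2 := monomial_bound i k p (W j l) (V j' l - W j' l) j j' B D l Hin Hl HM HB HD
      (HW j) (HVW j')).
    lra.
  - apply Rmult_le_compat_r; [|apply Hcoef].
    apply Rmult_le_pos; [|left; apply exp_pos]. apply Rmult_le_pos; lra.
Qed.

(** After integration the rate is [w i + g]: the part [w i] is kept as the weight of the unknown,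
    and the part [g] becomes a small constant on the half plane [Re l <= N]. *)
Lemma gain (N x K : R) (i : I) : N <= 0 -> x <= N -> 0 <= K ->
  K / (w i + g) * exp ((w i + g) * x) <= K / g * exp (g * N) * exp (w i * x).
Proof.
  intros HN Hx HK. assert (Hi := Hw i).
  rewrite Rmult_plus_distr_r, exp_plus.
  assert (E : exp (g * x) <= exp (g * N)) by (apply exp_le_compat; nra).
  assert (P1 := exp_pos (w i * x)). assert (P2 := exp_pos (g * x)).
  assert (E2 : K / (w i + g) <= K / g).
  { unfold Rdiv. apply Rmult_le_compat_l; [assumption|]. apply Rinv_le_contravar; lra. }
  assert (P3 : 0 <= K / (w i + g)).
  { apply Rmult_le_pos; [assumption|]. left. apply Rinv_0_lt_compat. lra. }
  apply Rle_trans with (K / (w i + g) * exp (g * x) * exp (w i * x))%R; [right; ring|].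
  apply Rmult_le_compat_r; [lra|]. apply Rmult_le_compat; lra.
Qed.

(** On the weighted ball of radius [B] the quadratic right-hand side has Lipschitz constant [2 S B];
    integration divides by at least [g] and gains [exp (g N)]. The condition makes the Picard map
    halve distances. *)
Definition contracts (B N : R) : Prop := N <= 0 /\ 2 * S * B / g * exp (g * N) <= / 2.

Lemma contracts_exists (B N1 : R) : 0 <= B -> exists N, N <= N1 /\ contracts B N.
Proof.
  intros HB. set (q := (2 * S * B / g)%R).
  assert (Hq : 0 <= q).
  { unfold q. apply Rmult_le_pos; [nra|]. left. now apply Rinv_0_lt_compat. }
  (* This makes [exp (g N)] at most [/ (2 (1 + q))], hence [q exp (g N)] at most [/ 2]; with [1 + q]
     the inverse also makes sense for [B = 0]. *)
  exists (Rmin N1 (Rmin 0 (ln (/ (2 * (1 + q))) / g)))%R. split; [apply Rmin_l|].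
  set (N := Rmin N1 _). assert (H0 : N <= Rmin 0 (ln (/ (2 * (1 + q))) / g)) by apply Rmin_r.
  clearbody N. split; [eapply Rle_trans; [exact H0|apply Rmin_l]|].
  assert (H1 := Rle_trans _ _ _ H0 (Rmin_r _ _)). fold q.
  assert (E : exp (g * N) <= / (2 * (1 + q))).
  { rewrite <- (exp_ln (/ (2 * (1 + q)))) by (apply Rinv_0_lt_compat; lra).
    apply exp_le_compat. apply Rmult_le_compat_l with (r := g) in H1; [|lra].
    replace (g * (ln (/ (2 * (1 + q))) / g))%R with (ln (/ (2 * (1 + q)))) in H1 by (field; lra).
    exact H1. }
  apply Rle_trans with (q * / (2 * (1 + q)))%R; [now apply Rmult_le_compat_l|].
  rewrite Rinv_mult. apply Rle_trans with (/ 2 * (q / (1 + q)))%R; [right; field; lra|].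
  assert (q / (1 + q) <= 1) by (apply Rle_div_l; lra). lra.
Qed.

(** The difference vanishes at the left end, hence is recovered by integrating the difference of the
    right-hand sides. Starting from the trivial bound [2 B], each such integration halves the bound,
    on the whole ray at once. *)
Lemma system_unique (V W : I -> C -> C) (B N : R) (l : C) :
  0 <= B -> contracts B N -> Re l <= N -> Rabs (Im l) <= M ->
  (forall i (s : R), s <= 0 -> Cder (V i) (l + s) (rhs V i (l + s))) ->
  (forall i (s : R), s <= 0 -> Cder (W i) (l + s) (rhs W i (l + s))) ->
  (forall s : R, s <= 0 -> bdd V B (l + s)) ->
  (forall s : R, s <= 0 -> bdd W B (l + s)) ->
  (forall i, vanishing (fun x => V i x - W i x) l) ->
  forall i, V i l = W i l.
Proof.
  intros HB [HN0 HN] Hl HM HV HW BV BW Hvan.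
  assert (H : forall n (s : R), s <= 0 -> forall i,
    Cmod (V i (l + s) - W i (l + s)) <= 2 * B * (/ 2) ^ n * exp (w i * (Re l + s))).
  { induction n as [|n IH]; intros s Hs i.
    - simpl. eapply Rle_trans; [apply Cmod_triangle_sub|].
      specialize (BV s Hs i). specialize (BW s Hs i). simpl in BV, BW. unfold Re. lra.
    - set (D := (2 * B * (/ 2) ^ n)%R) in *.
      assert (HD : 0 <= D). { apply Rmult_le_pos; [lra|]. apply pow_le. lra. }
      assert (T := ray_exp_bound (fun x => V i x - W i x) (fun x => rhs V i x - rhs W i x) (l + s)
        (S * (2 * B * D)) (w i + g)). simpl (Re (l + s)) in T. change (fst l) with (Re l) in T.
      eapply Rle_trans; [apply T; clear T|].
      + specialize (Hw i). lra.
      + apply Rmult_le_pos; [lra|]. apply Rmult_le_pos; lra.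
      + intros s' Hs'. replace (l + s + s') with (l + (s + s')%R) by (rewrite RtoC_plus; ring).
        apply Cder_minus; [apply HV|apply HW]; lra.
      + intros s' Hs'. replace (l + s + s') with (l + (s + s')%R) by (rewrite RtoC_plus; ring).
        rewrite Rmult_assoc.
        replace (Re l + s + s')%R with (Re (l + (s + s')%R)) by (simpl; unfold Re; ring).
        apply rhs_diff; try assumption.
        * simpl. unfold Re in *. lra.
        * simpl. rewrite Rplus_0_r. exact HM.
        * apply BV; lra.
        * apply BW; lra.
        * intros j. simpl (Re (l + _)). change (fst l) with (Re l).
          apply IH. lra.
      + apply (vanishing_shift (fun x => V i x - W i x)). apply Hvan.
      + eapply Rle_trans; [apply (gain N)|].
        * assumption.
        * lra.
        * apply Rmult_le_pos; [lra|]. apply Rmult_le_pos; lra.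
        * apply Rmult_le_compat_r; [left; apply exp_pos|].
          replace (S * (2 * B * D) / g * exp (g * N))%R with (2 * S * B / g * exp (g * N) * D)%R
            by (field; lra).
          apply Rle_trans with (/ 2 * D)%R; [now apply Rmult_le_compat_r|].
          right. unfold D. simpl. ring. }
  intros i. assert (Z : Cmod (V i l - W i l) <= 0).
  { apply le_epsilon. intros e He.
    destruct (half_pow_small (2 * B * exp (w i * Re l)) e He) as [n Hn].
    specialize (Hn n (Nat.le_refl _)). specialize (H n 0%R (Rle_refl _) i).
    replace (l + 0%R) with l in H by ring. rewrite Rplus_0_r in H. lra. }
  assert (Z2 : V i l - W i l = 0).
  { apply Cmod_eq_0. apply Rle_antisym; [assumption|apply Cmod_ge_0]. }
  replace (V i l) with (V i l - W i l + W i l) by ring. rewrite Z2. ring.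
Qed.

Variable v0 : I -> C.
Hypothesis Hv0 : forall i, 0 < w i -> v0 i = 0.

(** The iterates are explicit exponential sums, so their primitives are formal. The constant [v0 i]
    is stored with exponent [w i] rather than 0, so that all exponents in the list have real part at
    least [w i]; its value is the same because [v0 i = 0] whenever [w i > 0]. *)
Fixpoint picard (n : nat) (i : I) : list (C * C) :=
  match n with
  | O => (v0 i, RtoC (w i)) :: nil
  | Datatypes.S n => (v0 i, RtoC (w i)) :: expo_prim
      (flat_map (fun q => let '(k, p, j, j') := q in expo_mul k p (picard n j) (picard n j')) (tm i))
  end.

Definition pic (n : nat) (i : I) (l : C) : C := expo (picard n i) l.

Lemma v0_eval (i : I) (l : C) : v0 i * Cexp (RtoC (w i) * l) = v0 i.
Proof.
  destruct (Rle_lt_or_eq_dec 0 (w i) (Hw i)) as [H|H].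
  - rewrite Hv0 by assumption. ring.
  - rewrite <- H. rewrite Cmult_0_l, Cexp_0. ring.
Qed.

Lemma flat_ge (VL : I -> list (C * C)) (i : I) : (forall j, expo_ge (w j) (VL j)) ->
  expo_ge (w i + g)
    (flat_map (fun q => let '(k, p, j, j') := q in expo_mul k p (VL j) (VL j')) (tm i)).
Proof.
  intros H cp Hin. apply in_flat_map in Hin as [[[[k p] j] j'] [Hq Hin]].
  eapply Rle_trans; [now apply (Hgap i k p j j')|].
  now apply (expo_mul_ge k p (VL j) (VL j')).
Qed.

Lemma flat_eval (VL : I -> list (C * C)) (i : I) (l : C) :
  expo (flat_map (fun q => let '(k, p, j, j') := q in expo_mul k p (VL j) (VL j')) (tm i)) l
  = rhs (fun i => expo (VL i)) i l.
Proof.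
  unfold rhs. induction (tm i) as [|[[[k p] j] j'] L IH]; simpl; [reflexivity|].
  rewrite expo_app, IH, expo_mul_eval. reflexivity.
Qed.

Lemma picard_ge (n : nat) (i : I) : expo_ge (w i) (picard n i).
Proof.
  revert i. induction n as [|n IH]; intros i cp Hin.
  - destruct Hin as [<-|[]]. simpl. lra.
  - destruct Hin as [<-|Hin]; [simpl; lra|].
    apply in_map_iff in Hin as [cp' [<- Hin]]. simpl.
    assert (T := flat_ge (picard n) i IH cp' Hin). lra.
Qed.

Lemma pic_succ (n : nat) (i : I) (l : C) :
  Cder (pic (Datatypes.S n) i) l (rhs (pic n) i l) /\
  Cder (fun x => pic (Datatypes.S n) i x - v0 i) l (rhs (pic n) i l) /\
  vanishing (fun x => pic (Datatypes.S n) i x - v0 i) l.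
Proof.
  assert (Hi := Hw i).
  set (L := flat_map (fun q => let '(k, p, j, j') := q in
       expo_mul k p (picard n j) (picard n j')) (tm i)).
  assert (HL : expo_ge (w i + g) L) by (apply flat_ge, picard_ge).
  assert (E : forall x, pic (Datatypes.S n) i x = v0 i + expo (expo_prim L) x).
  { intros x. unfold pic. simpl picard. rewrite expo_cons. simpl fst. simpl snd.
    rewrite v0_eval. reflexivity. }
  assert (D : Cder (expo (expo_prim L)) l (rhs (pic n) i l)).
  { assert (T := Cder_expo_prim L l (w i + g) ltac:(lra) HL).
    unfold L in T at 2. rewrite flat_eval in T. exact T. }
  repeat split.
  - apply (Cder_ext (fun x => v0 i + expo (expo_prim L) x) _ _ _ 1); [lra|now intros|].
    replace (rhs (pic n) i l) with (0 + rhs (pic n) i l) by ring.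
    apply Cder_plus; [apply Cder_const|assumption].
  - apply (Cder_ext (expo (expo_prim L)) _ _ _ 1); [lra| |assumption].
    intros. rewrite E. ring.
  - assert (T : vanishing (expo (expo_prim L)) l).
    { apply (expo_vanishing _ _ (w i + g)); [lra|]. intros cp Hin.
      apply in_map_iff in Hin as [cp' [<- Hin]]. simpl. now apply HL. }
    intros e He. destruct (T e He) as [s0 [H0 H1]]. exists s0. split; [assumption|].
    intros s Hs. rewrite E. replace (v0 i + expo (expo_prim L) (l + s) - v0 i)
      with (expo (expo_prim L) (l + s)) by ring. now apply H1.
Qed.

Lemma ray_dom (l : C) (s N : R) : Re l <= N -> Rabs (Im l) <= M -> s <= 0 ->
  Re (l + s) <= N /\ Rabs (Im (l + s)) <= M /\ (Re (l + s) = Re l + s)%R.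
Proof.
  intros H1 H2 Hs. repeat split.
  - simpl. unfold Re in *. lra.
  - simpl. rewrite Rplus_0_r. exact H2.
Qed.

Lemma pic_bound (B N : R) : 0 <= B -> contracts B N -> (forall i, Cmod (v0 i) <= B / 2) ->
  forall n l, Re l <= N -> Rabs (Im l) <= M ->
  bdd (pic n) B l /\
  (forall i, Cmod (pic (Datatypes.S n) i l - v0 i) <= S * (B * B) / (w i + g) * exp ((w i + g) * Re l)) /\
  (forall i, Cmod (pic (Datatypes.S n) i l - pic n i l) <= B * (/ 2) ^ n * exp (w i * Re l)).
Proof.
  intros HB [HN0 HN] Hv.
  assert (Hv' : forall i (l : C), Cmod (v0 i) <= B / 2 * exp (w i * Re l)).
  { intros i l. destruct (Rle_lt_or_eq_dec 0 (w i) (Hw i)) as [H|H].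
    - rewrite Hv0, Cmod_0 by assumption. apply Rmult_le_pos; [lra|left; apply exp_pos].
    - rewrite <- H, Rmult_0_l, exp_0, Rmult_1_r. apply Hv. }
  assert (STEP : forall n, (forall l, Re l <= N -> Rabs (Im l) <= M -> bdd (pic n) B l) ->
    forall l i, Re l <= N -> Rabs (Im l) <= M ->
    Cmod (pic (Datatypes.S n) i l - v0 i)
      <= S * (B * B) / (w i + g) * exp ((w i + g) * Re l)).
  { intros n Hn l i Hl HM. assert (Hi := Hw i).
    apply (ray_exp_bound (fun x => pic (Datatypes.S n) i x - v0 i) (rhs (pic n) i)).
    - lra.
    - apply Rmult_le_pos; nra.
    - intros s Hs. apply pic_succ.
    - intros s Hs. destruct (ray_dom l s N Hl HM Hs) as [R1 [R2 R3]]. rewrite <- R3, Rmult_assoc.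
      apply rhs_bound; try assumption; [lra|now apply Hn].
    - apply pic_succ. }
  (* [S * (B * B)] is [B / 2] times [2 * S * B], so the contraction condition bounds the integrated
     term by [B / 4]. Together with [|v0 i| <= B / 2] this keeps the iterates in the ball of radius
     [B]. *)
  assert (SMALL : forall i (l : C), Re l <= N ->
    S * (B * B) / (w i + g) * exp ((w i + g) * Re l) <= B / 4 * exp (w i * Re l)).
  { intros i l Hl. eapply Rle_trans; [apply (gain N); try assumption; apply Rmult_le_pos; nra|].
    apply Rmult_le_compat_r; [left; apply exp_pos|].
    replace (S * (B * B) / g * exp (g * N))%R with (B / 2 * (2 * S * B / g * exp (g * N)))%R
      by (field; lra). nra. }
  assert (ALL : forall n l, Re l <= N -> Rabs (Im l) <= M -> bdd (pic n) B l).
  { induction n as [|n IH]; intros l Hl HM i.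
    - unfold pic, expo. simpl. rewrite v0_eval, Cplus_0_r.
      eapply Rle_trans; [apply Hv'|]. apply Rmult_le_compat_r; [left; apply exp_pos|lra].
    - eapply Rle_trans; [apply (Cmod_le_sub _ (v0 i))|].
      assert (T := STEP n IH l i Hl HM). assert (T2 := SMALL i l Hl). assert (T3 := Hv' i l).
      assert (P := exp_pos (w i * Re l)). nra. }
  assert (DIFF : forall n l, Re l <= N -> Rabs (Im l) <= M -> forall i,
     Cmod (pic (Datatypes.S n) i l - pic n i l) <= B * (/ 2) ^ n * exp (w i * Re l)).
  { induction n as [|n IH]; intros l Hl HM i.
    - assert (T := STEP 0%nat (ALL 0%nat) l i Hl HM). assert (T2 := SMALL i l Hl).
      unfold pic at 2, expo. simpl map. simpl csum. simpl fst. simpl snd.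
      rewrite v0_eval, Cplus_0_r. simpl pow.
      assert (P := exp_pos (w i * Re l)). eapply Rle_trans; [exact T|]. nra.
    - set (D := (B * (/ 2) ^ n)%R) in *.
      assert (HD : 0 <= D). { apply Rmult_le_pos; [lra|]. apply pow_le. lra. }
      assert (Hi := Hw i).
      assert (T := ray_exp_bound
        (fun x => (pic (Datatypes.S (Datatypes.S n)) i x - v0 i) - (pic (Datatypes.S n) i x - v0 i))
        (fun x => rhs (pic (Datatypes.S n)) i x - rhs (pic n) i x) l
        (S * (2 * B * D)) (w i + g)).
      replace (pic (Datatypes.S (Datatypes.S n)) i l - pic (Datatypes.S n) i l)
        with ((pic (Datatypes.S (Datatypes.S n)) i l - v0 i) - (pic (Datatypes.S n) i l - v0 i))
        by ring.
      eapply Rle_trans; [apply T; clear T|].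
      + lra.
      + apply Rmult_le_pos; [lra|]. apply Rmult_le_pos; lra.
      + intros s Hs. apply Cder_minus; apply pic_succ.
      + intros s Hs. destruct (ray_dom l s N Hl HM Hs) as [R1 [R2 R3]]. rewrite <- R3, Rmult_assoc.
        apply rhs_diff; try assumption; [lra|now apply ALL|now apply ALL|].
        intros j. now apply IH.
      + intros e He.
        destruct (pic_succ (Datatypes.S n) i l) as [_ [_ V1]].
        destruct (pic_succ n i l) as [_ [_ V2]].
        destruct (V1 (e / 2)%R) as [s1 [S1 Q1]]; [lra|].
        destruct (V2 (e / 2)%R) as [s2 [S2 Q2]]; [lra|].
        exists (Rmin s1 s2). split; [eapply Rle_trans; [apply Rmin_l|assumption]|].
        intros s Hs. eapply Rle_trans; [apply Cmod_triangle_sub|].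
        specialize (Q1 s (Rle_trans _ _ _ Hs (Rmin_l _ _))).
        specialize (Q2 s (Rle_trans _ _ _ Hs (Rmin_r _ _))). lra.
      + eapply Rle_trans; [apply (gain N); try assumption|].
        * apply Rmult_le_pos; [lra|]. apply Rmult_le_pos; lra.
        * apply Rmult_le_compat_r; [left; apply exp_pos|].
          replace (S * (2 * B * D) / g * exp (g * N))%R with (2 * S * B / g * exp (g * N) * D)%R
            by (field; lra).
          apply Rle_trans with (/ 2 * D)%R; [now apply Rmult_le_compat_r|].
          right. unfold D. simpl. ring. }
  intros n l Hl HM. repeat split; [now apply ALL| |].
  - intros i. now apply STEP; [apply ALL| |].
  - intros i. now apply DIFF.
Qed.

Lemma system_exists (B N : R) : 0 <= B -> contracts B N -> (forall i, Cmod (v0 i) <= B / 2) ->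
  exists V : I -> C -> C, forall l, sector M N l ->
    bdd V B l /\
    (forall i, Cder (V i) l (rhs V i l)) /\
    (forall i, Cmod (V i l - v0 i) <= S * (B * B) / (w i + g) * exp ((w i + g) * Re l)).
Proof.
  intros HB HN Hv. assert (HP := pic_bound B N HB HN Hv). destruct HN as [HN0 HN].
  (* The limit is chosen pointwise in the pair of index and argument; outside the half strip its
     value is 0 by default. *)
  assert (EX : forall (il : I * C), exists v, Re (snd il) <= N -> Rabs (Im (snd il)) <= M ->
    forall n, Cmod (pic n (fst il) (snd il) - v)
      <= 4 * (B * exp (w (fst il) * Re (snd il))) * (/ 2) ^ n).
  { intros [i l]. simpl.
    destruct (classic (Re l <= N /\ Rabs (Im l) <= M)) as [[H1 H2]|H].
    - destruct (geom_cauchy (fun n => pic n i l) (B * exp (w i * Re l))) as [v Hl].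
      + intros n. destruct (HP n l H1 H2) as [_ [_ T]]. specialize (T i). lra.
      + exists v. intros _ _. exact Hl.
    - exists 0. intros H1 H2. exfalso. apply H. now split. }
  apply choice in EX. destruct EX as [V0 HV0].
  set (V := fun i l => V0 (i, l)).
  assert (HV : forall i l, Re l <= N -> Rabs (Im l) <= M -> forall n,
    Cmod (pic n i l - V i l) <= 4 * B * (/ 2) ^ n * exp (w i * Re l)).
  { intros i l H1 H2 n. specialize (HV0 (i, l) H1 H2 n). simpl in HV0. unfold V. lra. }
  assert (POW : forall n, 0 < (/ 2) ^ n) by (intros; apply pow_lt; lra).
  assert (HVB : forall l, Re l <= N -> Rabs (Im l) <= M -> bdd V B l).
  { intros l H1 H2 i. apply le_epsilon. intros e He.
    destruct (half_pow_small (4 * B * exp (w i * Re l)) e He) as [n Hn].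
    specialize (Hn n (Nat.le_refl _)). specialize (HV i l H1 H2 n).
    rewrite Cmod_sub_comm in HV. assert (T := Cmod_le_sub (V i l) (pic n i l)).
    destruct (HP n l H1 H2) as [T2 _]. specialize (T2 i). lra. }
  exists V. intros l [H2 H1].
  assert (H1' : Re l <= N) by lra. assert (H2' : Rabs (Im l) <= M) by lra.
  split; [now apply HVB|]. split.
  - intros i. set (rad := Rmin (N - Re l) (M - Rabs (Im l))).
    assert (Hrad : 0 < rad) by (apply Rmin_pos; lra).
    assert (DOM : forall m, Cmod (m - l) < rad -> Re m <= N /\ Rabs (Im m) <= M).
    { intros m Hm. assert (R1 := Rlt_le_trans _ _ _ Hm (Rmin_l _ _)).
      assert (R2 := Rlt_le_trans _ _ _ Hm (Rmin_r _ _)).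
      assert (T1 := re_le_Cmod (m - l)). assert (T2 := Im_le_Cmod (m - l)).
      replace (Re (m - l)) with (Re m - Re l)%R in T1 by reflexivity.
      replace (Im (m - l)) with (Im m - Im l)%R in T2 by reflexivity.
      assert (T3 := Rle_abs (Re m - Re l)).
      assert (T4 := Rabs_triang (Im m - Im l) (Im l)).
      replace (Im m - Im l + Im l)%R with (Im m) in T4 by ring. split; lra. }
    (* The shift by one is the Picard recursion: [pic (n + 1)] has derivative [rhs (pic n)], which
       converges geometrically to [rhs V]. *)
    apply (Cder_limit (fun n => pic (Datatypes.S n) i) (fun n => rhs (pic n) i)
      (V i) (rhs V i) l rad (fun n => (S * (2 * B * (4 * B)) * (/ 2) ^ n)%R) Hrad).
    + intros n m _. apply pic_succ.
    + intros n m Hm. destruct (DOM m Hm) as [D1 D2].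
      eapply Rle_trans.
      * apply (rhs_diff _ _ B (4 * B * (/ 2) ^ n)); try assumption; try lra.
        -- apply Rmult_le_pos; [lra|]. left. apply POW.
        -- destruct (HP n m D1 D2) as [T _]. exact T.
        -- now apply HVB.
        -- intros j. now apply HV.
      * assert (E : exp ((w i + g) * Re m) <= 1).
        { rewrite <- exp_0. apply exp_le_compat. assert (T := Hw i). nra. }
        assert (P := POW n).
        assert (Q : 0 <= S * (2 * B * (4 * B)) * (/ 2) ^ n).
        { apply Rmult_le_pos; [|lra]. apply Rmult_le_pos; nra. }
        rewrite <- (Rmult_1_r (S * (2 * B * (4 * B)) * (/ 2) ^ n)).
        apply Rle_trans with (S * (2 * B * (4 * B)) * (/ 2) ^ n * exp ((w i + g) * Re m))%R;
          [right; ring|]. now apply Rmult_le_compat_l.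
    + intros m Hm e He. destruct (DOM m Hm) as [D1 D2].
      destruct (half_pow_small (4 * B * exp (w i * Re m)) e He) as [n0 Hn0].
      exists n0. intros n Hn. eapply Rle_trans; [now apply HV|].
      specialize (Hn0 (Datatypes.S n) ltac:(lia)). lra.
    + intros e He. apply half_pow_small. assumption.
  - intros i. apply le_epsilon. intros e He.
    destruct (half_pow_small (4 * B * exp (w i * Re l)) e He) as [n Hn].
    specialize (Hn (Datatypes.S n) ltac:(lia)). specialize (HV i l H1' H2' (Datatypes.S n)).
    destruct (HP n l H1' H2') as [_ [T _]]. specialize (T i).
    replace (V i l - v0 i) with ((pic (Datatypes.S n) i l - v0 i) - (pic (Datatypes.S n) i l - V i l))
      by ring.
    eapply Rle_trans; [apply Cmod_triangle_sub|]. lra.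
Qed.

End System.

(** * The linearised Schlesinger system *)

Lemma C2_neq_0 : RtoC 2 <> 0.
Proof. intros H. apply RtoC_inj in H. lra. Qed.

Lemma tpow_neq_0 (l p : C) : tpow l p <> 0.
Proof. apply Cexp_neq_0. Qed.

Lemma tpow_plus (l p q : C) : tpow l (p + q) = tpow l p * tpow l q.
Proof. unfold tpow. rewrite <- Cexp_plus. f_equal. ring. Qed.

Lemma tpow_opp (l p : C) : tpow l (- p) = / tpow l p.
Proof.
  assert (H : tpow l (- p) * tpow l p = 1).
  { rewrite <- tpow_plus. unfold tpow. replace ((- p + p) * l) with (RtoC 0) by ring.
    apply Cexp_0. }
  rewrite <- (Cmult_1_r (tpow l (- p))), <- (Cinv_r (tpow l p)) by apply tpow_neq_0.
  rewrite Cmult_assoc, H. ring.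
Qed.

(* The hat variables, besides the constant [One]: the entries of the residue matrix [A1] and of
   [A0 + A1] in the eigenbasis of the limit of [A0 + A1], with the powers of [t ^ sigma] removed, and
   the components of eigenvectors [(Q0, P0)] of [A0] and [(Q1, P1)] of [A1]. *)
Inductive unknown : Set := One | Al | Be | Ga | Et | Mm | Q0 | P0 | Q1 | P1.

Section Hats.

Variables Thi sigma : C.

(** Entries of [G^-1 s3 G], where [G] is the matrix of eigenvectors of the limit of [A0 + A1] and
    [s3 = diag (1, -1)]; the lower right entry is [- S11], and [r] cancels. *)
Definition S11 : C := - Thi / sigma.
Definition S12 : C := - (2) / sigma.
Definition S21 : C := 2 * d Thi sigma * d Thi (- sigma) / sigma.

(** The Schlesinger equations with [nu] replaced by [T (- Thi Et + dd Mm)], the relation expressing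
    that the diagonal of [A0 + A1] is constant in the original basis. Linear terms are written as
    products with [One]. The vectors follow the linear equation attached to their matrix; the matrix
    form is [hat_rhs_eqs]. *)
Definition hat_terms (i : unknown) : list (C * C * unknown * unknown) :=
  let dd := d Thi sigma * d Thi (- sigma) in
  match i with
  | One => nil
  | Et => (S12 / 2, 1 - sigma, Ga, One) :: (- S21 / 2, 1 + sigma, Be, One) :: nil
  | Mm => (S11, 1 + sigma, Be, One) :: (- S12, RtoC 1, Al, One) :: nil
  | Al => (RtoC 1, - sigma, Mm, Ga) :: (S12 / 2, 1 - sigma, Ga, One) ::
          (Thi, sigma, Et, Be) :: (- dd, sigma, Mm, Be) ::
          (- S21 / 2, 1 + sigma, Be, One) :: nil
  | Be => (RtoC 2, RtoC 0, Et, Be) :: (S11, RtoC 1, Be, One) ::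
          (- (2), - sigma, Mm, Al) :: (- S12, 1 - sigma, Al, One) :: nil
  | Ga => (- (2) * Thi, sigma, Et, Al) :: (2 * dd, sigma, Mm, Al) ::
          (S21, 1 + sigma, Al, One) :: (- (2), RtoC 0, Et, Ga) :: (- S11, RtoC 1, Ga, One) :: nil
  | Q0 => (RtoC 1, RtoC 0, Et, Q0) :: (RtoC 1, - sigma, Mm, P0) :: nil
  | P0 => (- Thi, sigma, Et, Q0) :: (dd, sigma, Mm, Q0) :: (- (1), RtoC 0, Et, P0) :: nil
  | Q1 => (RtoC 1, RtoC 0, Et, Q1) :: (S11 / 2, RtoC 1, Q1, One) ::
          (RtoC 1, - sigma, Mm, P1) :: (S12 / 2, 1 - sigma, P1, One) :: nil
  | P1 => (- Thi, sigma, Et, Q1) :: (dd, sigma, Mm, Q1) :: (S21 / 2, 1 + sigma, Q1, One) ::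
          (- (1), RtoC 0, Et, P1) :: (- S11 / 2, RtoC 1, P1, One) :: nil
  end.

(** Half of the available decay. [Et] is driven by [t ^ (1 - sigma)]: one half becomes its weight,
    the other the gain. [Mm] is driven by [t] and gets weight [1 - hat_gap], so that
    [t ^ (- sigma) Mm] in the equation of [Al] still gains exactly [hat_gap]. *)
Definition hat_gap : R := ((1 - Re sigma) / 2)%R.

Definition hat_weight (i : unknown) : R :=
  match i with Et => hat_gap | Mm => (1 - hat_gap)%R | _ => 0%R end.

(** One crude constant for all unknowns; the summand 1 makes it strictly positive even if all
    coefficients vanish. *)
Definition hat_coef_sum (M : R) : R :=
  let s i := rsum (map (fun q : C * C * unknown * unknown =>
     let '(k, p, j, j') := q in Cmod k * exp (Rabs (Im p) * M))%R (hat_terms i)) in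
  (1 + (s One + s Al + s Be + s Ga + s Et + s Mm + s Q0 + s P0 + s Q1 + s P1))%R.

Lemma rsum_nonneg {A : Type} (f : A -> R) (L : list A) :
  (forall x, 0 <= f x) -> 0 <= rsum (map f L).
Proof. intros H. induction L as [|x L IH]; simpl; [lra|]. specialize (H x). lra. Qed.

Lemma hat_coef_sum_spec (M : R) : 0 < hat_coef_sum M /\ forall i,
  rsum (map (fun q : C * C * unknown * unknown =>
     let '(k, p, j, j') := q in Cmod k * exp (Rabs (Im p) * M))%R (hat_terms i)) <= hat_coef_sum M.
Proof.
  assert (H : forall i, 0 <= rsum (map (fun q : C * C * unknown * unknown =>
     let '(k, p, j, j') := q in Cmod k * exp (Rabs (Im p) * M))%R (hat_terms i))).
  { intros i. apply rsum_nonneg. intros [[[k p] j] j'].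
    apply Rmult_le_pos; [apply Cmod_ge_0|left; apply exp_pos]. }
  assert (H1 := H One). assert (H2 := H Al). assert (H3 := H Be). assert (H4 := H Ga).
  assert (H5 := H Et). assert (H6 := H Mm). assert (H7 := H Q0). assert (H8 := H P0).
  assert (H9 := H Q1). assert (H10 := H P1).
  unfold hat_coef_sum. split; [lra|]. intros []; lra.
Qed.

Hypothesis hRe : 0 <= Re sigma < 1.

Lemma hat_gap_pos : 0 < hat_gap.
Proof. unfold hat_gap. lra. Qed.

Lemma hat_weight_nonneg (i : unknown) : 0 <= hat_weight i.
Proof. destruct i; simpl; unfold hat_gap; lra. Qed.

Lemma hat_terms_gap (i : unknown) (k p : C) (j j' : unknown) :
  In (k, p, j, j') (hat_terms i) -> hat_weight i + hat_gap <= Re p + hat_weight j + hat_weight j'.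
Proof.
  unfold hat_gap, Re in *.
  destruct i; intros H; unfold hat_terms in H; simpl In in H;
    repeat (destruct H as [H|H]; [injection H; intros; subst; simpl; unfold hat_gap, Re; simpl; lra|]);
    contradiction.
Qed.

Definition hat_rhs := rhs unknown hat_terms.

Definition hats (V : unknown -> C -> C) (l : C) : Prop :=
  V One l = 1 /\ forall i, Cder (V i) l (hat_rhs V i l).

Section Point.
Variables (V : unknown -> C -> C) (l : C).
Hypothesis H1 : V One l = 1.

Let T := tpow l sigma.
Let t := tt l.
Let al := V Al l. Let be := V Be l. Let ga := V Ga l.
Let eta := V Et l. Let mm := V Mm l.
Let mu := mm / T.
Let nu := T * (- Thi * eta + d Thi sigma * d Thi (- sigma) * mm).

Lemma exps : Cexp ((1 - sigma) * l) = t / T /\ Cexp ((1 + sigma) * l) = t * T /\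
  Cexp (- sigma * l) = / T /\ Cexp (sigma * l) = T /\ Cexp (1 * l) = t /\ Cexp (0 * l) = 1.
Proof.
  change (Cexp ((1 - sigma) * l)) with (tpow l (1 + - sigma)).
  change (Cexp ((1 + sigma) * l)) with (tpow l (1 + sigma)).
  change (Cexp (- sigma * l)) with (tpow l (- sigma)).
  rewrite !tpow_plus, tpow_opp. repeat split.
  rewrite Cmult_0_l. apply Cexp_0.
Qed.

(** With [L = ((eta, mu), (nu, - eta)) + (t / 2) S], where [S] is rescaled by powers of [T], the
    equations of [Al], [Be], [Ga] are the commutator [[L, A1]], and [(Q1, P1)] solves [X' = L X].
    For [(Q0, P0)] the part with [t S / 2] is absent. *)
Lemma hat_rhs_eqs :
  hat_rhs V One l = 0 /\
  hat_rhs V Et l = t / 2 * (S12 * ga / T - S21 * be * T) /\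
  hat_rhs V Mm l = t * (S11 * be * T - S12 * al) /\
  hat_rhs V Al l = (mu + t * S12 / (2 * T)) * ga - (nu + t * T * S21 / 2) * be /\
  hat_rhs V Be l = 2 * ((eta + t * S11 / 2) * be - (mu + t * S12 / (2 * T)) * al) /\
  hat_rhs V Ga l = 2 * ((nu + t * T * S21 / 2) * al - (eta + t * S11 / 2) * ga) /\
  hat_rhs V Q0 l = eta * V Q0 l + mu * V P0 l /\
  hat_rhs V P0 l = nu * V Q0 l - eta * V P0 l /\
  hat_rhs V Q1 l = (eta + t * S11 / 2) * V Q1 l + (mu + t * S12 / (2 * T)) * V P1 l /\
  hat_rhs V P1 l = (nu + t * T * S21 / 2) * V Q1 l - (eta + t * S11 / 2) * V P1 l.
Proof.
  destruct exps as [E1 [E2 [E3 [E4 [E5 E6]]]]].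
  assert (HT : T <> 0) by apply tpow_neq_0. assert (H2 := C2_neq_0).
  unfold hat_rhs, rhs, hat_terms, csum, map, fold_right.
  rewrite H1, E1, E2, E3, E4, E5, E6.
  unfold mu, nu, al, be, ga, eta, mm. clearbody T t.
  repeat split; field; repeat split; assumption.
Qed.

End Point.

End Hats.

(** * Asymptotic orders *)

Definition bigO (D : C -> Prop) (x : R) (f : C -> C) : Prop :=
  exists K N : R, forall l, D l -> Re l < N -> Cmod (f l) <= K * exp (x * Re l).

Definition bounded_below (D : C -> Prop) (f : C -> C) : Prop :=
  exists k N : R, 0 < k /\ forall l, D l -> Re l < N -> k <= Cmod (f l).

(** Domains that allow integration along rays to the left and on which powers of [t] are controlled
    by [Re l] alone. The two instances are the strip, for existence, and a single horizontal line,
    for uniqueness. *)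
Definition left_strip (M : R) (D : C -> Prop) : Prop :=
  (forall l, D l -> Rabs (Im l) <= M) /\ (forall l (s : R), D l -> s <= 0 -> D (l + s)).

Lemma bigO_pos (D : C -> Prop) (x : R) (f : C -> C) : bigO D x f ->
  exists K N : R, 0 <= K /\ N <= 0 /\
    forall l, D l -> Re l < N -> Cmod (f l) <= K * exp (x * Re l).
Proof.
  intros [K [N H]]. exists (Rabs K), (Rmin N 0).
  split; [apply Rabs_pos|]. split; [apply Rmin_r|]. intros l Hl HN.
  eapply Rle_trans; [apply H; [assumption|lt_min]|].
  apply Rmult_le_compat_r; [left; apply exp_pos|apply Rle_abs].
Qed.

Lemma bigO_ext (D : C -> Prop) (x N : R) (f g : C -> C) :
  (forall l, D l -> Re l < N -> f l = g l) -> bigO D x f -> bigO D x g.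
Proof.
  intros E [K [N1 H]]. exists K, (Rmin N N1). intros l Hl HN. rewrite <- E.
  - apply H; [assumption|lt_min].
  - assumption.
  - lt_min.
Qed.

Lemma bigO_eq (D : C -> Prop) (x : R) (f g : C -> C) :
  (forall l, f l = g l) -> bigO D x f -> bigO D x g.
Proof. intros E. apply (bigO_ext D x 0). intros. apply E. Qed.

Lemma bigO_le (D : C -> Prop) (x N : R) (f g : C -> C) :
  (forall l, D l -> Re l < N -> Cmod (g l) <= Cmod (f l)) -> bigO D x f -> bigO D x g.
Proof.
  intros E [K [N1 H]]. exists K, (Rmin N N1). intros l Hl HN.
  eapply Rle_trans.
  - apply E; [assumption|lt_min].
  - apply H; [assumption|lt_min].
Qed.

Lemma bigO_weaken (D : C -> Prop) (x x' : R) (f : C -> C) : x' <= x -> bigO D x f -> bigO D x' f.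
Proof.
  intros Hx H. destruct (bigO_pos _ _ _ H) as [K [N [HK [HN H1]]]]. exists K, N.
  intros l Hl HlN. eapply Rle_trans; [now apply H1|]. apply Rmult_le_compat_l; [assumption|].
  apply exp_le_compat. nra.
Qed.

Lemma bigO_sub (D D' : C -> Prop) (x : R) (f : C -> C) :
  (forall l, D' l -> D l) -> bigO D x f -> bigO D' x f.
Proof. intros HD [K [N H]]. exists K, N. auto. Qed.

Lemma bigO_plus (D : C -> Prop) (x : R) (f g : C -> C) :
  bigO D x f -> bigO D x g -> bigO D x (fun l => f l + g l).
Proof.
  intros [K1 [N1 H1]] [K2 [N2 H2]]. exists (K1 + K2)%R, (Rmin N1 N2). intros l Hl HN.
  specialize (H1 l Hl ltac:(lt_min)).
  specialize (H2 l Hl ltac:(lt_min)).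
  eapply Rle_trans; [apply Cmod_triangle|]. lra.
Qed.

Lemma bigO_opp (D : C -> Prop) (x : R) (f : C -> C) : bigO D x f -> bigO D x (fun l => - f l).
Proof. apply (bigO_le D x 0). intros. rewrite Cmod_opp. lra. Qed.

Lemma bigO_minus (D : C -> Prop) (x : R) (f g : C -> C) :
  bigO D x f -> bigO D x g -> bigO D x (fun l => f l - g l).
Proof. intros Hf Hg. apply bigO_plus; [assumption|now apply bigO_opp]. Qed.

Lemma bigO_mult (D : C -> Prop) (x1 x2 : R) (f g : C -> C) :
  bigO D x1 f -> bigO D x2 g -> bigO D (x1 + x2) (fun l => f l * g l).
Proof.
  intros Hf Hg. destruct (bigO_pos _ _ _ Hf) as [K1 [N1 [P1 [_ H1]]]].
  destruct (bigO_pos _ _ _ Hg) as [K2 [N2 [P2 [_ H2]]]].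
  exists (K1 * K2)%R, (Rmin N1 N2). intros l Hl HN.
  specialize (H1 l Hl ltac:(lt_min)).
  specialize (H2 l Hl ltac:(lt_min)).
  rewrite Cmod_mult, Rmult_plus_distr_r, exp_plus.
  eapply Rle_trans; [apply Rmult_le_compat; [apply Cmod_ge_0|apply Cmod_ge_0|exact H1|exact H2]|].
  right. ring.
Qed.

Lemma bigO_mult' (D : C -> Prop) (x1 x2 x : R) (f g : C -> C) :
  x <= (x1 + x2)%R -> bigO D x1 f -> bigO D x2 g -> bigO D x (fun l => f l * g l).
Proof. intros Hx Hf Hg. apply (bigO_weaken D (x1 + x2)); [assumption|now apply bigO_mult]. Qed.

Lemma bigO_const (D : C -> Prop) (k : C) : bigO D 0 (fun _ => k).
Proof.
  exists (Cmod k), 0%R. intros l _ _. rewrite Rmult_0_l, exp_0. lra.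
Qed.

Lemma bigO_zero (D : C -> Prop) (x : R) (f : C -> C) : (forall l, f l = 0) -> bigO D x f.
Proof.
  intros H. exists 0%R, 0%R. intros l _ _. rewrite H, Cmod_0. lra.
Qed.

Lemma bigO_scal (D : C -> Prop) (x : R) (k : C) (f : C -> C) :
  bigO D x f -> bigO D x (fun l => k * f l).
Proof. intros H. apply (bigO_mult' D 0 x); [lra|apply bigO_const|assumption]. Qed.

Lemma bigO_tpow (M : R) (D : C -> Prop) (p : C) : left_strip M D ->
  bigO D (Re p) (fun l => tpow l p).
Proof.
  intros [HD _]. exists (exp (Rabs (Im p) * M)), 0%R. intros l Hl _.
  unfold tpow. rewrite Cmod_Cexp, <- exp_plus. apply exp_le_compat.
  replace (Re (p * l)) with (Re p * Re l - Im p * Im l)%R by (destruct p, l; simpl; ring).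
  assert (T : - (Im p * Im l) <= Rabs (Im p) * M).
  { eapply Rle_trans; [apply Rle_abs|]. rewrite Rabs_Ropp, Rabs_mult.
    apply Rmult_le_compat_l; [apply Rabs_pos|now apply HD]. }
  lra.
Qed.

Lemma bigO_tt (M : R) (D : C -> Prop) : left_strip M D -> bigO D 1 tt.
Proof. intros H. exact (bigO_tpow M D 1 H). Qed.

Lemma bigO_tpow_inv (M : R) (D : C -> Prop) (p : C) : left_strip M D ->
  bigO D (- Re p) (fun l => / tpow l p).
Proof.
  intros H. apply (bigO_eq D _ (fun l => tpow l (- p))); [intros; apply tpow_opp|].
  exact (bigO_tpow M D (- p) H).
Qed.

Lemma bigO_inv (D : C -> Prop) (f : C -> C) : bounded_below D f -> bigO D 0 (fun l => / f l).
Proof.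
  intros [k [N [Hk H]]]. exists (/ k)%R, N. intros l Hl HN. specialize (H l Hl HN).
  rewrite Rmult_0_l, exp_0, Rmult_1_r, Cmod_inv by (apply Cmod_gt_0; lra).
  now apply Rinv_le_contravar.
Qed.

Lemma bounded_below_neq_0 (D : C -> Prop) (f : C -> C) : bounded_below D f ->
  exists N, forall l, D l -> Re l < N -> f l <> 0.
Proof.
  intros [k [N [Hk H]]]. exists N. intros l Hl HN. apply Cmod_gt_0.
  specialize (H l Hl HN). lra.
Qed.

Lemma exp_small (x e : R) : 0 < x -> 0 < e -> exists N, forall y, y < N -> exp (x * y) <= e.
Proof.
  intros Hx He. exists (ln e / x)%R. intros y Hy.
  rewrite <- (exp_ln e) by assumption. apply exp_le_compat.
  apply Rlt_div_r in Hy; lra.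
Qed.

Lemma bigO_small (D : C -> Prop) (x e : R) (f : C -> C) : 0 < x -> 0 < e -> bigO D x f ->
  exists N, forall l, D l -> Re l < N -> Cmod (f l) <= e.
Proof.
  intros Hx He Hf. destruct (bigO_pos _ _ _ Hf) as [K [N [HK [_ H]]]].
  destruct (exp_small x (e / (1 + K)) Hx) as [N2 H2]; [apply Rdiv_lt_0_compat; lra|].
  exists (Rmin N N2). intros l Hl HN.
  specialize (H l Hl ltac:(lt_min)).
  specialize (H2 (Re l) ltac:(lt_min)).
  apply Rle_div_r in H2; [|lra]. assert (P := exp_pos (x * Re l)). nra.
Qed.

Lemma bounded_below_perturb (D : C -> Prop) (x : R) (f g : C -> C) : 0 < x ->
  bounded_below D f -> bigO D x (fun l => g l - f l) -> bounded_below D g.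
Proof.
  intros Hx [k [N [Hk H]]] Hfg.
  destruct (bigO_small D x (k / 2) _ Hx ltac:(lra) Hfg) as [N2 H2].
  exists (k / 2)%R, (Rmin N N2). split; [lra|]. intros l Hl HN.
  specialize (H l Hl ltac:(lt_min)).
  specialize (H2 l Hl ltac:(lt_min)).
  rewrite Cmod_sub_comm in H2. assert (T := Cmod_le_sub (f l) (g l)). lra.
Qed.

Lemma bounded_below_const (D : C -> Prop) (k : C) : k <> 0 -> bounded_below D (fun _ => k).
Proof.
  intros H. exists (Cmod k), 0%R. split; [now apply Cmod_gt_0|]. intros. lra.
Qed.

Lemma bounded_below_mult (D : C -> Prop) (f g : C -> C) : bounded_below D f -> bounded_below D g -> bounded_below D (fun l => f l * g l).
Proof.
  intros [k1 [N1 [Hk1 H1]]] [k2 [N2 [Hk2 H2]]].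
  exists (k1 * k2)%R, (Rmin N1 N2). split; [nra|]. intros l Hl HN.
  specialize (H1 l Hl ltac:(lt_min)).
  specialize (H2 l Hl ltac:(lt_min)).
  rewrite Cmod_mult. nra.
Qed.

Lemma bigO_diff_mult (D : C -> Prop) (x : R) (f f' g g' : C -> C) :
  0 <= x -> bigO D 0 f -> bigO D 0 g' ->
  bigO D x (fun l => f l - f' l) -> bigO D x (fun l => g l - g' l) ->
  bigO D x (fun l => f l * g l - f' l * g' l).
Proof.
  intros Hx Hf Hg' Hff Hgg.
  apply (bigO_eq D x (fun l => f l * (g l - g' l) + (f l - f' l) * g' l)); [intros; ring|].
  apply bigO_plus; [apply (bigO_mult' D 0 x)|apply (bigO_mult' D x 0)]; try assumption; lra.
Qed.

Lemma bigO_diff_inv (D : C -> Prop) (x : R) (f f' : C -> C) :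
  0 < x -> bounded_below D f' -> bigO D x (fun l => f l - f' l) ->
  bigO D x (fun l => / f l - / f' l).
Proof.
  intros Hx Hf' Hff. assert (Hf := bounded_below_perturb D x _ _ Hx Hf' Hff).
  destruct (bounded_below_neq_0 _ _ Hf) as [N1 H1]. destruct (bounded_below_neq_0 _ _ Hf') as [N2 H2].
  apply (bigO_ext D x (Rmin N1 N2) (fun l => - ((f l - f' l) * (/ f l * / f' l)))).
  - intros l Hl HN. field. split.
    + apply H2; [assumption|lt_min].
    + apply H1; [assumption|lt_min].
  - apply bigO_opp. apply (bigO_mult' D x 0); [lra|assumption|].
    apply (bigO_mult' D 0 0); [lra|now apply bigO_inv|now apply bigO_inv].
Qed.

Lemma bigO_of_diff (D : C -> Prop) (x x' : R) (f f' : C -> C) : x <= x' ->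
  bigO D x f' -> bigO D x' (fun l => f l - f' l) -> bigO D x f.
Proof.
  intros Hx H1 H2. apply (bigO_eq D x (fun l => (f l - f' l) + f' l)); [intros; ring|].
  apply bigO_plus; [now apply (bigO_weaken D x')|assumption].
Qed.

Lemma bigO_vanishing (M : R) (D : C -> Prop) (x : R) (f : C -> C) (l : C) :
  left_strip M D -> D l -> 0 < x -> bigO D x f -> vanishing f l.
Proof.
  intros [_ HD] Hl Hx Hf e He. destruct (bigO_small D x e f Hx He Hf) as [N H].
  exists (Rmin 0 (N - Re l - 1)). split; [apply Rmin_l|]. intros s Hs.
  assert (S0 := Rle_trans _ _ _ Hs (Rmin_l _ _)). assert (S1 := Rle_trans _ _ _ Hs (Rmin_r _ _)).
  apply H; [now apply HD|]. simpl. unfold Re in *. lra.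
Qed.

(** A bootstrap: any positive order [x'], however small, pins down the constant of integration,
    after which [f] inherits the order of its derivative. *)
Lemma bigO_integrate (M N x x' : R) (D : C -> Prop) (f g : C -> C) :
  left_strip M D -> 0 < x -> 0 < x' ->
  (forall l, D l -> Re l < N -> Cder f l (g l)) -> bigO D x g -> bigO D x' f -> bigO D x f.
Proof.
  intros HD Hx Hx' Hf Hg Hv. destruct (bigO_pos _ _ _ Hg) as [K [N1 [HK [_ H]]]].
  exists (K / x)%R, (Rmin N N1). intros l Hl HN.
  assert (L1 := Rlt_le_trans _ _ _ HN (Rmin_l _ _)). assert (L2 := Rlt_le_trans _ _ _ HN (Rmin_r _ _)).
  destruct HD as [HD1 HD2].
  apply (ray_exp_bound f g l K x Hx HK).
  - intros s Hs. apply Hf; [now apply HD2|]. simpl. unfold Re in *. lra.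
  - intros s Hs. replace (Re l + s)%R with (Re (l + s)) by reflexivity.
    apply H; [now apply HD2|]. simpl. unfold Re in *. lra.
  - apply (bigO_vanishing M D x'); try assumption. now split.
Qed.

Lemma Cder_val (f : C -> C) (l u v : C) : Cder f l u -> u = v -> Cder f l v.
Proof. now intros H <-. Qed.

Section HatsStrip.

Variables (Thi sigma : C) (M : R) (D : C -> Prop).
Hypothesis hRe : 0 <= Re sigma < 1.
Hypothesis HD : left_strip M D.

Lemma bdd_uniform (V : unknown -> C -> C) :
  (forall i, bigO D (hat_weight sigma i) (V i)) ->
  exists B N : R, 0 <= B /\ forall l, D l -> Re l < N -> bdd unknown (hat_weight sigma) V B l.
Proof.
  intros H.
  assert (H' : forall L : list unknown, exists B N : R, 0 <= B /\ forall l, D l -> Re l < N ->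
     forall i, In i L -> Cmod (V i l) <= B * exp (hat_weight sigma i * Re l)).
  { induction L as [|i L [B [N [HB IH]]]].
    - exists 0%R, 0%R. split; [lra|]. intros l _ _ i [].
    - destruct (bigO_pos _ _ _ (H i)) as [K [N1 [HK [_ H1]]]].
      exists (B + K)%R, (Rmin N N1). split; [lra|]. intros l Hl HN j Hj.
      assert (P := exp_pos (hat_weight sigma j * Re l)).
      destruct Hj as [<-|Hj].
      + specialize (H1 l Hl ltac:(lt_min)). nra.
      + specialize (IH l Hl ltac:(lt_min) j Hj). nra. }
  destruct (H' (One :: Al :: Be :: Ga :: Et :: Mm :: Q0 :: P0 :: Q1 :: P1 :: nil))
    as [B [N [HB HN]]].
  exists B, N. split; [assumption|]. intros l Hl HlN i. apply HN; try assumption.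
  destruct i; simpl; tauto.
Qed.

Lemma hats_unique (V W : unknown -> C -> C) (N : R) :
  (forall l, D l -> Re l < N -> hats Thi sigma V l /\ hats Thi sigma W l) ->
  (forall i, bigO D (hat_weight sigma i) (V i)) -> (forall i, bigO D (hat_weight sigma i) (W i)) ->
  (forall i, exists x, 0 < x /\ bigO D x (fun l => V i l - W i l)) ->
  exists N', forall l, D l -> Re l < N' -> forall i, V i l = W i l.
Proof.
  intros HVW BV BW Hd.
  destruct (bdd_uniform V BV) as [B1 [N1 [HB1 H1]]].
  destruct (bdd_uniform W BW) as [B2 [N2 [HB2 H2]]].
  destruct (hat_coef_sum_spec Thi sigma M) as [HS1 HS2].
  set (B := Rmax B1 B2).
  assert (HB : 0 <= B) by (eapply Rle_trans; [exact HB1|apply Rmax_l]).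
  destruct (contracts_exists (hat_gap sigma) (hat_coef_sum Thi sigma M) (hat_gap_pos sigma hRe) HS1 B
    (Rmin N (Rmin N1 N2)) HB) as [N' [HN1 HN2]].
  exists N'. intros l Hl HlN i.
  assert (R1 := Rle_trans _ _ _ HN1 (Rmin_l _ _)). assert (R2 := Rle_trans _ _ _ HN1 (Rmin_r _ _)).
  assert (R3 := Rle_trans _ _ _ R2 (Rmin_l _ _)). assert (R4 := Rle_trans _ _ _ R2 (Rmin_r _ _)).
  assert (RAY : forall s : R, s <= 0 -> D (l + s) /\ Re (l + s) < N').
  { intros s Hs. split; [now apply HD|]. simpl. unfold Re in *. lra. }
  assert (WK : forall (V : unknown -> C -> C) B' m, B' <= B ->
    bdd unknown (hat_weight sigma) V B' m -> bdd unknown (hat_weight sigma) V B m).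
  { intros V' B' m HB' Hm j. eapply Rle_trans; [apply Hm|].
    apply Rmult_le_compat_r; [left; apply exp_pos|assumption]. }
  apply (system_unique unknown (hat_terms Thi sigma) (hat_weight sigma) (hat_gap sigma) M (hat_coef_sum Thi sigma M)
    (hat_weight_nonneg sigma hRe) (hat_gap_pos sigma hRe) HS1 (hat_terms_gap Thi sigma hRe) HS2
    V W B N' l HB HN2); try lra.
  - now apply HD.
  - intros j s Hs. destruct (RAY s Hs) as [Q1 Q2]. apply (HVW (l + s)); [assumption|lra].
  - intros j s Hs. destruct (RAY s Hs) as [Q1 Q2]. apply (HVW (l + s)); [assumption|lra].
  - intros s Hs. destruct (RAY s Hs) as [Q1 Q2]. apply (WK V B1); [apply Rmax_l|].
    apply H1; [assumption|lra].
  - intros s Hs. destruct (RAY s Hs) as [Q1 Q2]. apply (WK W B2); [apply Rmax_r|].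
    apply H2; [assumption|lra].
  - intros j. destruct (Hd j) as [x [Hx Hb]]. now apply (bigO_vanishing M D x).
Qed.

End HatsStrip.

(** * Asymptotics of the hat variables *)

Lemma bigO_plus_min (D : C -> Prop) (x1 x2 : R) (f g : C -> C) :
  bigO D x1 f -> bigO D x2 g -> bigO D (Rmin x1 x2) (fun l => f l + g l).
Proof.
  intros Hf Hg. apply bigO_plus.
  - apply (bigO_weaken D x1); [apply Rmin_l|assumption].
  - apply (bigO_weaken D x2); [apply Rmin_r|assumption].
Qed.

Lemma bigO_minus_min (D : C -> Prop) (x1 x2 : R) (f g : C -> C) :
  bigO D x1 f -> bigO D x2 g -> bigO D (Rmin x1 x2) (fun l => f l - g l).
Proof. intros Hf Hg. apply bigO_plus_min; [assumption|now apply bigO_opp]. Qed.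

Lemma bigO_div_tpow (M : R) (D : C -> Prop) (x : R) (f : C -> C) (p : C) : left_strip M D ->
  bigO D x f -> bigO D (x + - Re p) (fun l => f l / tpow l p).
Proof. intros HD Hf. apply bigO_mult; [assumption|now apply (bigO_tpow_inv M)]. Qed.

Lemma bigO_div_const (D : C -> Prop) (x : R) (f : C -> C) (k : C) :
  bigO D x f -> bigO D x (fun l => f l / k).
Proof.
  intros Hf. apply (bigO_mult' D x 0); [lra|assumption|apply bigO_const].
Qed.

(** Synthesises an order by recursion on the expression, with [Rmin] at sums and addition at
    products; a hypothesis about a whole subexpression takes precedence. [bigO_tac] then compares
    the result with the order in the goal. *)
Ltac bigO_infer := lazymatch goal with
  | |- bigO _ _ (fun l => @?f l + @?g l) =>
      first [eassumption | eapply bigO_const | eapply (bigO_plus_min _ _ _ f g); bigO_infer]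
  | |- bigO _ _ (fun l => @?f l - @?g l) =>
      first [eassumption | eapply bigO_const | eapply (bigO_minus_min _ _ _ f g); bigO_infer]
  | |- bigO _ _ (fun l => - @?f l) =>
      first [eassumption | eapply bigO_const | eapply (bigO_opp _ _ f); bigO_infer]
  | |- bigO _ _ (fun l => @?f l * @?g l) =>
      first [eassumption | eapply bigO_const | eapply (bigO_mult _ _ _ f g); bigO_infer]
  | |- bigO _ _ (fun l => @?f l / tpow l ?p) =>
      first [eassumption | eapply bigO_const | eapply (bigO_div_tpow _ _ _ f p); [eassumption|bigO_infer]]
  | |- bigO _ _ (fun l => @?f l / ?k) =>
      first [eassumption | eapply bigO_const | eapply (bigO_div_const _ _ f k); bigO_infer]
  | |- bigO _ _ (fun l => tpow l ?p) => eapply bigO_tpow; eassumption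
  | |- bigO _ _ (fun l => / tpow l ?p) => eapply bigO_tpow_inv; eassumption
  | |- bigO _ _ (fun l => tt l) => eapply bigO_tt; eassumption
  | |- bigO _ _ tt => eapply bigO_tt; eassumption
  | |- _ => first [eassumption | eapply bigO_const]
  end.

Ltac rmin_lra := unfold Rmin; repeat destruct Rle_dec; simpl; lra.

Ltac bigO_tac := eapply bigO_weaken; [|bigO_infer]; [rmin_lra].

Ltac cfield := field; repeat split; auto using tpow_neq_0, C2_neq_0.

Definition strip (M : R) (l : C) : Prop := Rabs (Im l) < M.

Lemma strip_left (M : R) : left_strip M (strip M).
Proof.
  split; intros l; unfold strip; [lra|]. intros s Hl _. simpl. rewrite Rplus_0_r. exact Hl.
Qed.

(** The two components of [(A + Th / 2) (q, p)] for the traceless [A = ((al, be), (ga, - al))]; both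
    vanish when [(q, p)] is an eigenvector for [- Th / 2]. *)
Definition rel1 (al be Th q p : C) : C := (al + Th / 2) * q + be * p.
Definition rel2 (al ga Th q p : C) : C := ga * q + (Th / 2 - al) * p.

Section Params.

Variables (Th0 Th1 Thi sigma s2 : C).

Definition hmu (V : unknown -> C -> C) (l : C) : C := V Mm l / tpow l sigma.
Definition hnu (V : unknown -> C -> C) (l : C) : C :=
  tpow l sigma * (- Thi * V Et l + d Thi sigma * d Thi (- sigma) * V Mm l).

(** The limit of [A1] must have eigenvalues [Th1 / 2, - Th1 / 2], and
    [diag (sigma / 2, - sigma / 2)] minus it must have [Th0 / 2, - Th0 / 2]. This fixes [Al] and the
    product of [Be] and [Ga]; [s2] decides how the product is split. The last four values are
    eigenvectors of these two limits. *)
Definition hat_limit (i : unknown) : C :=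
  let bp := b Th0 Th1 sigma in let bm := b Th0 Th1 (- sigma) in
  let cp := c Th0 Th1 sigma in let cm := c Th0 Th1 (- sigma) in
  match i with
  | One => 1
  | Al => sigma / 2 + (bm * cp + bp * cm) / (2 * sigma)
  | Be => - (s2 * bm * cm / sigma)
  | Ga => bp * cp / (sigma * s2)
  | Et | Mm => 0
  | Q0 => s2 * bm
  | P0 => bp
  | Q1 => s2 * (bm * cm)
  | P1 => bp * cp
  end.

Hypothesis hRe : 0 <= Re sigma < 1.
Variable M : R.

Lemma hats_deriv (V : unknown -> C -> C) (l : C) : hats Thi sigma V l ->
  let T := tpow l sigma in let t := tt l in let mu := hmu V l in let nu := hnu V l in
  let s11 := S11 Thi sigma in let s12 := S12 sigma in let s21 := S21 Thi sigma in
  Cder (V Et) l (t / 2 * (s12 * V Ga l / T - s21 * V Be l * T)) /\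
  Cder (V Mm) l (t * (s11 * V Be l * T - s12 * V Al l)) /\
  Cder (V Al) l ((mu + t * s12 / (2 * T)) * V Ga l - (nu + t * T * s21 / 2) * V Be l) /\
  Cder (V Be) l (2 * ((V Et l + t * s11 / 2) * V Be l - (mu + t * s12 / (2 * T)) * V Al l)) /\
  Cder (V Ga) l (2 * ((nu + t * T * s21 / 2) * V Al l - (V Et l + t * s11 / 2) * V Ga l)) /\
  Cder (V Q0) l (V Et l * V Q0 l + mu * V P0 l) /\
  Cder (V P0) l (nu * V Q0 l - V Et l * V P0 l) /\
  Cder (V Q1) l ((V Et l + t * s11 / 2) * V Q1 l + (mu + t * s12 / (2 * T)) * V P1 l) /\
  Cder (V P1) l ((nu + t * T * s21 / 2) * V Q1 l - (V Et l + t * s11 / 2) * V P1 l).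
Proof.
  intros [H1 H]. simpl.
  destruct (hat_rhs_eqs Thi sigma V l H1) as [_ [E1 [E2 [E3 [E4 [E5 [E6 [E7 [E8 E9]]]]]]]]].
  repeat split; (eapply Cder_val; [apply H|assumption]).
Qed.

Lemma hats_exist (N0 : R) : exists (N : R) (V : unknown -> C -> C), N <= N0 /\
  (forall l, sector M N l -> hats Thi sigma V l) /\
  (forall i, bigO (strip M) (hat_weight sigma i + hat_gap sigma) (fun l => V i l - hat_limit i)).
Proof.
  destruct (hat_coef_sum_spec Thi sigma M) as [HS1 HS2].
  set (m := fun i => Cmod (hat_limit i)).
  set (B := (2 * (m One + m Al + m Be + m Ga + m Et + m Mm + m Q0 + m P0 + m Q1 + m P1))%R).
  assert (HB : 0 <= B /\ forall i, Cmod (hat_limit i) <= B / 2).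
  { assert (H1 := fun i => Cmod_ge_0 (hat_limit i) : 0 <= m i).
    assert (h1 := H1 One). assert (h2 := H1 Al). assert (h3 := H1 Be). assert (h4 := H1 Ga).
    assert (h5 := H1 Et). assert (h6 := H1 Mm). assert (h7 := H1 Q0). assert (h8 := H1 P0).
    assert (h9 := H1 Q1). assert (h10 := H1 P1). clear H1.
    unfold B. split; [lra|]. intros i. change (Cmod (hat_limit i)) with (m i). clearbody m.
    destruct i; lra. }
  destruct HB as [HB0 HB].
  assert (Hg := hat_gap_pos sigma hRe). assert (Hw := hat_weight_nonneg sigma hRe).
  destruct (contracts_exists (hat_gap sigma) (hat_coef_sum Thi sigma M) Hg HS1 B N0 HB0) as [N [HN0 HN]].
  destruct (system_exists unknown (hat_terms Thi sigma) (hat_weight sigma) (hat_gap sigma) M (hat_coef_sum Thi sigma M)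
    Hw Hg HS1 (hat_terms_gap Thi sigma hRe) HS2 hat_limit) with (B := B) (N := N) as [V HV]; try assumption.
  { intros [] H; simpl in H; try lra; reflexivity. }
  exists N, V. split; [assumption|].
  assert (BD : forall i, bigO (strip M) (hat_weight sigma i + hat_gap sigma) (fun l => V i l - hat_limit i)).
  { intros i. exists (hat_coef_sum Thi sigma M * (B * B) / (hat_weight sigma i + hat_gap sigma))%R, N.
    intros l Hl HlN. apply HV. split; assumption. }
  split; [|assumption].
  intros l Hl. destruct (HV l Hl) as [_ [HV1 _]]. split; [|exact HV1].
  (* [One] is an unknown of the system like the others: its derivative is 0 and its limit is 1,
     hence it is constant. *)
  assert (Z : Cmod (V One l - 1) <= 0 / 1 * exp (1 * Re l)).
  { apply (ray_exp_bound (fun x => V One x - 1) (fun _ => 0) l 0 1); try lra.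
    - intros s Hs. assert (Hs' : sector M N (l + s)).
      { destruct Hl as [L1 L2]. split; simpl; [rewrite Rplus_0_r; exact L1|]. unfold Re in *. lra. }
      destruct (HV _ Hs') as [_ [H _]]. specialize (H One).
      apply (Cder_val _ _ (0 - 0)); [|ring]. apply Cder_minus; [exact H|apply Cder_const].
    - intros s _. rewrite Cmod_0. lra.
    - apply (bigO_vanishing M (strip M) (hat_weight sigma One + hat_gap sigma)).
      + apply strip_left.
      + apply Hl.
      + specialize (Hw One). lra.
      + apply BD. }
  unfold Rdiv in Z. rewrite Rmult_0_l, Rmult_0_l in Z.
  assert (E : V One l - 1 = 0) by (apply Cmod_eq_0, Rle_antisym; [assumption|apply Cmod_ge_0]).
  replace (V One l) with (V One l - 1 + 1) by ring. rewrite E. ring.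
Qed.

(** Order of the remainder once the term in [t ^ (1 - sigma)] is split off: what is left is a
    product of two such terms or of order [t]. *)
Let om := Rmin (2 * (1 - Re sigma)) 1.
Let s11 := S11 Thi sigma.
Let s12 := S12 sigma.
Let s21 := S21 Thi sigma.

Variables (D : C -> Prop) (V : unknown -> C -> C) (N : R) (lim : unknown -> C).
Hypothesis HD : left_strip M D.
Hypothesis HV : forall l, D l -> Re l < N -> hats Thi sigma V l.
Hypothesis Hlim0 : lim Et = 0 /\ lim Mm = 0.
Hypothesis HB : forall i, bigO D (hat_weight sigma i + hat_gap sigma) (fun l => V i l - lim i).

Lemma om_bounds : 0 < om <= 1 /\ om <= 2 * (1 - Re sigma).
Proof. unfold om. repeat split; rmin_lra. Qed.

Lemma hats_bigO0 (i : unknown) : bigO D 0 (V i).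
Proof.
  assert (Hg := hat_gap_pos sigma hRe). assert (Hw := hat_weight_nonneg sigma hRe i).
  apply (bigO_of_diff D 0 (hat_weight sigma i + hat_gap sigma) _ (fun _ => lim i)); [lra|apply bigO_const|apply HB].
Qed.

(** The weights used for the contraction are weaker than the true orders. They serve to fix the
    constants of integration; the equations, with [Al], [Be], [Ga] bounded, then give the true
    ones. *)
Lemma hats_first :
  bigO D (1 - Re sigma) (V Et) /\ bigO D 1 (V Mm) /\
  bigO D (1 - Re sigma) (hmu V) /\ bigO D 1 (hnu V).
Proof.
  assert (B0 := hats_bigO0). assert (Hg := hat_gap_pos sigma hRe).
  assert (b1 := B0 Be). assert (b2 := B0 Ga). assert (b3 := B0 Al).
  destruct Hlim0 as [L1 L2].
  assert (E1 : bigO D (1 - Re sigma) (V Et)).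
  { apply (bigO_integrate M N (1 - Re sigma) (hat_weight sigma Et + hat_gap sigma) D (V Et)
      (fun l => tt l / 2 * (s12 * V Ga l / tpow l sigma - s21 * V Be l * tpow l sigma)));
      try assumption.
    - lra.
    - simpl. lra.
    - intros l Hl HN. apply (hats_deriv V l (HV l Hl HN)).
    - bigO_tac.
    - apply (bigO_eq D _ (fun l => V Et l - lim Et)); [intros; rewrite L1; ring|apply HB]. }
  assert (E2 : bigO D 1 (V Mm)).
  { apply (bigO_integrate M N 1 (hat_weight sigma Mm + hat_gap sigma) D (V Mm)
      (fun l => tt l * (s11 * V Be l * tpow l sigma - s12 * V Al l)));
      try assumption.
    - lra.
    - simpl. lra.
    - intros l Hl HN. apply (hats_deriv V l (HV l Hl HN)).
    - bigO_tac.
    - apply (bigO_eq D _ (fun l => V Mm l - lim Mm)); [intros; rewrite L2; ring|apply HB]. }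
  repeat split; try assumption.
  - unfold hmu. bigO_tac.
  - unfold hnu. bigO_tac.
Qed.

Lemma lim_const_deriv (i : unknown) (l v : C) : Cder (V i) l v -> Cder (fun x => V i x - lim i) l v.
Proof.
  intros H. apply (Cder_val _ _ (v - 0)); [|ring]. apply Cder_minus; [assumption|apply Cder_const].
Qed.

Lemma hats_delta (i : unknown) : hat_weight sigma i = 0%R -> i <> One ->
  bigO D (1 - Re sigma) (fun l => V i l - lim i).
Proof.
  intros Hi H1. assert (B0 := hats_bigO0). assert (Hg := hat_gap_pos sigma hRe).
  destruct hats_first as [F1 [F2 [F3 F4]]].
  assert (b1 := B0 Be). assert (b2 := B0 Ga). assert (b3 := B0 Al).
  assert (b4 := B0 Q0). assert (b5 := B0 P0). assert (b6 := B0 Q1). assert (b7 := B0 P1).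
  assert (HT : bigO D (1 - Re sigma) (fun l => tt l * s12 / (2 * tpow l sigma))).
  { apply (bigO_eq D _ (fun l => s12 / 2 * tt l / tpow l sigma)).
    - intros l. cfield.
    - bigO_tac. }
  assert (HI := hats_deriv V).
  assert (W : forall g, (forall l, hats Thi sigma V l -> Cder (V i) l (g l)) ->
    bigO D (1 - Re sigma) g -> bigO D (1 - Re sigma) (fun l => V i l - lim i)).
  { intros g Hg1 Hg2. apply (bigO_integrate M N _ (hat_weight sigma i + hat_gap sigma) D _ g); try assumption.
    - lra.
    - rewrite Hi. lra.
    - intros l Hl HN. apply lim_const_deriv, Hg1. now apply HV.
    - apply HB. }
  destruct i; try (now contradiction H1); simpl in Hi; try (exfalso; unfold hat_gap in Hi; lra);
    (eapply W; [intros l Hl; apply (HI l Hl)|]; cbv zeta; fold s11 s12 s21; bigO_tac).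
Qed.

(** The derivative of [t ^ (1 - sigma)] with respect to [log t] is [1 - sigma] times itself; the
    rest is [bigO_integrate]. *)
Lemma hats_second_aux (f g : C -> C) (k : C) (x : R) : 0 < x ->
  (forall l, D l -> Re l < N -> Cder f l (g l)) ->
  bigO D om (fun l => g l - k * (tt l / tpow l sigma)) ->
  bigO D x f ->
  bigO D om (fun l => f l - k / (1 - sigma) * (tt l / tpow l sigma)).
Proof.
  intros Hx Hf Hg Hfx. assert (Ho := om_bounds).
  assert (H1s : 1 - sigma <> 0).
  { intros H. assert (H' : Re (1 - sigma) = 0%R) by now rewrite H. unfold Re in *. simpl in H'. lra. }
  apply (bigO_integrate M N om (Rmin x (1 - Re sigma)) D _
    (fun l => g l - k * (tt l / tpow l sigma))); try assumption.
  - lra.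
  - rmin_lra.
  - intros l Hl HN. apply Cder_minus; [now apply Hf|].
    apply (Cder_val _ _ (k / (1 - sigma) * ((1 - sigma) * (tt l / tpow l sigma)))).
    2: { cfield. }
    apply Cder_scal.
    apply (Cder_val _ _ ((1 * tt l * tpow l sigma - tt l * (sigma * tpow l sigma))
      / (tpow l sigma * tpow l sigma))).
    2: { cfield. }
    apply (Cder_div tt (fun x => tpow x sigma)); [apply (Cder_tpow 1)|apply Cder_tpow|apply tpow_neq_0].
  - bigO_tac.
Qed.

(** [heta1] and [hmu1] are the coefficients of [t ^ (1 - sigma)] in [V Et] and [hmu V]. The first
    carries [/ (1 - sigma)] from integration; the second stems from [Mm], asymptotic to [hmu1 t],
    divided by [t ^ sigma]. *)
Definition heta1 : C := s12 * lim Ga / 2 / (1 - sigma).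
Definition hmu1 : C := - (s12 * lim Al).

(** A coefficient of [t ^ (1 - sigma)] in the derivative of the unknown; the unknown itself carries
    it divided by [1 - sigma]. *)
Definition hat_second (i : unknown) : C :=
  match i with
  | Ga => - (2) * heta1 * lim Ga
  | Q0 => heta1 * lim Q0 + hmu1 * lim P0
  | P0 => - heta1 * lim P0
  | Q1 => heta1 * lim Q1 + (hmu1 + s12 / 2) * lim P1
  | P1 => - heta1 * lim P1
  | _ => 0
  end.

(** The term of [Ga] produces the correction of order [t ^ (1 - 2 sigma)] in [z], and the terms of
    the eigenvector components produce the coefficient of [t] in [y]. *)
Lemma hats_second (i : unknown) : In i (Ga :: Q0 :: P0 :: Q1 :: P1 :: nil) ->
  bigO D om (fun l => V i l - lim i - hat_second i / (1 - sigma) * (tt l / tpow l sigma)).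
Proof.
  intros Hi. assert (B0 := hats_bigO0). assert (Hg := hat_gap_pos sigma hRe).
  destruct hats_first as [F1 [F2 [F3 F4]]].
  assert (b1 := B0 Be). assert (b2 := B0 Ga). assert (b3 := B0 Al).
  assert (b4 := B0 Q0). assert (b5 := B0 P0). assert (b6 := B0 Q1). assert (b7 := B0 P1).
  assert (Ho := om_bounds). destruct Hlim0 as [L1 L2].
  assert (HI := hats_deriv V).
  assert (dA : bigO D (1 - Re sigma) (fun l => V Al l - lim Al))
    by (apply hats_delta; [reflexivity|discriminate]).
  assert (dGa : bigO D (1 - Re sigma) (fun l => V Ga l - lim Ga))
    by (apply hats_delta; [reflexivity|discriminate]).
  assert (X0 : bigO D om (fun l => V Et l - heta1 * (tt l / tpow l sigma))).
  { apply (bigO_eq D om (fun l => V Et l - s12 * lim Ga / 2 / (1 - sigma) * (tt l / tpow l sigma)));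
      [reflexivity|].
    apply (hats_second_aux (V Et)
      (fun l => tt l / 2 * (s12 * V Ga l / tpow l sigma - s21 * V Be l * tpow l sigma)) _
      (1 - Re sigma)); try assumption; [lra| |].
    - intros l Hl HN. apply (HI l (HV l Hl HN)).
    - apply (bigO_eq D om (fun l => s12 / 2 * (tt l / tpow l sigma) * (V Ga l - lim Ga)
         - tt l * (s21 / 2 * V Be l * tpow l sigma))).
      + intros l. cfield.
      + bigO_tac. }
  assert (X1 : bigO D om (fun l => hmu V l - hmu1 * (tt l / tpow l sigma))).
  (* The extra [Re sigma] is what the division by [t ^ sigma] will consume. *)
  { assert (Y : bigO D (om + Re sigma) (fun l => V Mm l - hmu1 * tt l)).
    { apply (bigO_integrate M N _ 1 D _ (fun l => tt l * (s11 * V Be l * tpow l sigma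
         - s12 * (V Al l - lim Al)))); try assumption; try lra.
      - intros l Hl HN.
        apply (Cder_val _ _ (tt l * (s11 * V Be l * tpow l sigma - s12 * V Al l)
          - hmu1 * (1 * tt l))).
        + apply Cder_minus; [apply (HI l (HV l Hl HN))|]. apply Cder_scal. apply (Cder_tpow 1).
        + unfold hmu1. ring.
      - bigO_tac.
      - bigO_tac. }
    apply (bigO_eq D om (fun l => (V Mm l - hmu1 * tt l) / tpow l sigma)).
    - intros l. unfold hmu. cfield.
    - eapply bigO_weaken; [|eapply bigO_div_tpow; [exact HD|exact Y]]. lra. }
  assert (dq : forall j, hat_weight sigma j = 0%R -> j <> One -> bigO D (1 - Re sigma) (fun l => V j l - lim j))
    by apply hats_delta.
  assert (d1 := dq Q0 eq_refl ltac:(discriminate)). assert (d2 := dq P0 eq_refl ltac:(discriminate)).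
  assert (d3 := dq Q1 eq_refl ltac:(discriminate)). assert (d4 := dq P1 eq_refl ltac:(discriminate)).
  assert (HTT : bigO D (1 - Re sigma) (fun l => tt l / tpow l sigma)) by bigO_tac.
  assert (W : forall j g, hat_weight sigma j = 0%R -> j <> One ->
    (forall l, hats Thi sigma V l -> Cder (V j) l (g l)) ->
    bigO D om (fun l => g l - hat_second j * (tt l / tpow l sigma)) ->
    bigO D om (fun l => V j l - lim j - hat_second j / (1 - sigma) * (tt l / tpow l sigma))).
  { intros j g Hj1 Hj2 Hg1 Hg2.
    apply (hats_second_aux (fun l => V j l - lim j) g (hat_second j) (1 - Re sigma)); try assumption.
    - lra.
    - intros l Hl HN. apply lim_const_deriv, Hg1. now apply HV.
    - now apply dq. }
  simpl in Hi.
  assert (H20 := C2_neq_0).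
  destruct Hi as [<-|[<-|[<-|[<-|[<-|[]]]]]];
    (eapply W; [reflexivity|discriminate|intros l Hl; apply (HI l Hl)|]; cbv zeta; fold s11 s12 s21;
     unfold hat_second).
  - apply (bigO_eq D om (fun l => 2 * (hnu V l + tt l * tpow l sigma * s21 / 2) * V Al l
       - tt l * s11 * V Ga l - 2 * (V Et l - heta1 * (tt l / tpow l sigma)) * V Ga l
       - 2 * heta1 * (tt l / tpow l sigma) * (V Ga l - lim Ga))).
    + intros l. cfield.
    + bigO_tac.
  - apply (bigO_eq D om (fun l => (V Et l - heta1 * (tt l / tpow l sigma)) * V Q0 l
       + heta1 * (tt l / tpow l sigma) * (V Q0 l - lim Q0)
       + (hmu V l - hmu1 * (tt l / tpow l sigma)) * V P0 l
       + hmu1 * (tt l / tpow l sigma) * (V P0 l - lim P0))).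
    + intros l. cfield.
    + bigO_tac.
  - apply (bigO_eq D om (fun l => hnu V l * V Q0 l
       - (V Et l - heta1 * (tt l / tpow l sigma)) * V P0 l
       - heta1 * (tt l / tpow l sigma) * (V P0 l - lim P0))).
    + intros l. cfield.
    + bigO_tac.
  - apply (bigO_eq D om (fun l => (V Et l - heta1 * (tt l / tpow l sigma)) * V Q1 l
       + tt l * s11 / 2 * V Q1 l
       + heta1 * (tt l / tpow l sigma) * (V Q1 l - lim Q1)
       + (hmu V l - hmu1 * (tt l / tpow l sigma)) * V P1 l
       + (hmu1 + s12 / 2) * (tt l / tpow l sigma) * (V P1 l - lim P1))).
    + intros l. cfield.
    + bigO_tac.
  - apply (bigO_eq D om (fun l => (hnu V l + tt l * tpow l sigma * s21 / 2) * V Q1 l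
       - tt l * s11 / 2 * V P1 l
       - (V Et l - heta1 * (tt l / tpow l sigma)) * V P1 l
       - heta1 * (tt l / tpow l sigma) * (V P1 l - lim P1))).
    + intros l. cfield.
    + bigO_tac.
Qed.

End Params.

(** * From the hat variables to a solution *)

Section Relations.

Variables (Th0 Th1 Thi sigma s2 : C).
Hypothesis hsigma : sigma <> 0.
Hypothesis hs2 : s2 <> 0.
Hypothesis hRe : 0 <= Re sigma < 1.

(** The entries of [A0] in the hat basis, obtained as those of the sum minus those of [A1]. *)
Definition al0 (V : unknown -> C -> C) (l : C) : C := sigma / 2 + V Et l - V Al l.
Definition be0 (V : unknown -> C -> C) (l : C) : C := hmu sigma V l - V Be l.
Definition ga0 (V : unknown -> C -> C) (l : C) : C := hnu Thi sigma V l - V Ga l.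

(* The components of [(A + Th / 2) (q, p)] solve the same linear equation as [(q, p)]. *)
Definition eigen_defect (V : unknown -> C -> C) (i : unknown) (l : C) : C :=
  match i with
  | Q0 => rel1 (al0 V l) (be0 V l) Th0 (V Q0 l) (V P0 l)
  | P0 => rel2 (al0 V l) (ga0 V l) Th0 (V Q0 l) (V P0 l)
  | Q1 => rel1 (V Al l) (V Be l) Th1 (V Q1 l) (V P1 l)
  | P1 => rel2 (V Al l) (V Ga l) Th1 (V Q1 l) (V P1 l)
  | _ => V i l
  end.

(** The comparison solution for uniqueness: the same matrices with zero vectors, which solve the
    homogeneous linear equations. *)
Definition zero_vectors (V : unknown -> C -> C) (i : unknown) (l : C) : C :=
  match i with Q0 | P0 | Q1 | P1 => 0 | _ => V i l end.

Lemma hmu_deriv (V : unknown -> C -> C) (l : C) : hats Thi sigma V l ->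
  Cder (hmu sigma V) l (tt l * (S11 Thi sigma * V Be l - S12 sigma * V Al l / tpow l sigma)
    - sigma * hmu sigma V l).
Proof.
  intros H. destruct (hats_deriv Thi sigma V l H) as [_ [H2 _]].
  eapply Cder_val; [apply (Cder_div (V Mm) (fun x => tpow x sigma));
    [exact H2|apply Cder_tpow|apply tpow_neq_0]|].
  unfold hmu. cfield.
Qed.

Lemma hnu_deriv (V : unknown -> C -> C) (l : C) : hats Thi sigma V l ->
  Cder (hnu Thi sigma V) l (sigma * hnu Thi sigma V l
    + tt l * (S21 Thi sigma * V Al l * tpow l sigma - S11 Thi sigma * V Ga l)).
Proof.
  intros H. destruct (hats_deriv Thi sigma V l H) as [H1 [H2 _]].
  eapply Cder_val.
  - apply (Cder_mult (fun x => tpow x sigma)); [apply Cder_tpow|].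
    apply (Cder_plus (fun x => - Thi * V Et x)); apply Cder_scal; [exact H1|exact H2].
  - unfold hnu, S11, S12, S21, d. cfield.
Qed.

Lemma eigen_defect_hats (V : unknown -> C -> C) (l : C) : hats Thi sigma V l -> hats Thi sigma (eigen_defect V) l.
Proof.
  intros HV. assert (Hmu := hmu_deriv V l HV). assert (Hnu := hnu_deriv V l HV).
  destruct (hats_deriv Thi sigma V l HV) as [D1 [D2 [D3 [D4 [D5 [D6 [D7 [D8 D9]]]]]]]].
  destruct HV as [H1 HV]. split; [exact H1|].
  assert (A1 : Cder (al0 V) l (tt l / 2 * (S12 sigma * V Ga l / tpow l sigma
      - S21 Thi sigma * V Be l * tpow l sigma) -
     ((hmu sigma V l + tt l * S12 sigma / (2 * tpow l sigma)) * V Ga l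
      - (hnu Thi sigma V l + tt l * tpow l sigma * S21 Thi sigma / 2) * V Be l))).
  { apply Cder_minus; [|exact D3]. eapply Cder_val.
    - apply (Cder_plus (fun _ => sigma / 2)); [apply Cder_const|exact D1].
    - ring. }
  assert (A2 := Cder_minus _ _ _ _ _ Hmu D4). change (Cder (be0 V) l) with
    (Cder (fun x => hmu sigma V x - V Be x) l) in A2.
  assert (A3 := Cder_minus _ _ _ _ _ Hnu D5).
  destruct (hat_rhs_eqs Thi sigma (eigen_defect V) l H1) as [_ [_ [_ [_ [_ [_ [E6 [E7 [E8 E9]]]]]]]]].
  assert (H2 := C2_neq_0).
  intros i. destruct i; try (apply HV).
  - eapply Cder_val; [|symmetry; exact E6].
    eapply Cder_val.
    + apply (Cder_plus (fun x => (al0 V x + Th0 / 2) * V Q0 x)).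
      * apply (Cder_mult (fun x => al0 V x + Th0 / 2)); [|exact D6].
        apply Cder_plus; [exact A1|apply Cder_const].
      * apply (Cder_mult (be0 V)); [exact A2|exact D7].
    + unfold eigen_defect, rel1, rel2, al0, be0, ga0, hmu, hnu, S11, S12, S21, d. cfield.
  - eapply Cder_val; [|symmetry; exact E7].
    eapply Cder_val.
    + apply (Cder_plus (fun x => ga0 V x * V Q0 x)).
      * apply (Cder_mult (ga0 V)); [exact A3|exact D6].
      * apply (Cder_mult (fun x => Th0 / 2 - al0 V x)); [|exact D7].
        apply Cder_minus; [apply Cder_const|exact A1].
    + unfold eigen_defect, rel1, rel2, al0, be0, ga0, hmu, hnu, S11, S12, S21, d. cfield.
  - eapply Cder_val; [|symmetry; exact E8].
    eapply Cder_val.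
    + apply (Cder_plus (fun x => (V Al x + Th1 / 2) * V Q1 x)).
      * apply (Cder_mult (fun x => V Al x + Th1 / 2)); [|exact D8].
        apply Cder_plus; [exact D3|apply Cder_const].
      * apply (Cder_mult (V Be)); [exact D4|exact D9].
    + unfold eigen_defect, rel1, rel2, al0, be0, ga0, hmu, hnu, S11, S12, S21, d. cfield.
  - eapply Cder_val; [|symmetry; exact E9].
    eapply Cder_val.
    + apply (Cder_plus (fun x => V Ga x * V Q1 x)).
      * apply (Cder_mult (V Ga)); [exact D5|exact D8].
      * apply (Cder_mult (fun x => Th1 / 2 - V Al x)); [|exact D9].
        apply Cder_minus; [apply Cder_const|exact D3].
    + unfold eigen_defect, rel1, rel2, al0, be0, ga0, hmu, hnu, S11, S12, S21, d. cfield.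
Qed.

Variables (M N : R) (V : unknown -> C -> C).
Hypothesis HV : forall l, strip M l -> Re l < N -> hats Thi sigma V l.
Let lim := hat_limit Th0 Th1 sigma s2.
Hypothesis HB : forall i, bigO (strip M) (hat_weight sigma i + hat_gap sigma) (fun l => V i l - lim i).

(** [hat_limit] makes the eigenvector relations hold in the limit, so [eigen_defect V] and
    [zero_vectors V] solve the same system with the same limits and agree near [t = 0]. *)
Lemma eigen_defect_vanish : exists N', forall l, strip M l -> Re l < N' ->
  forall i, eigen_defect V i l = zero_vectors V i l.
Proof.
  assert (HD := strip_left M). assert (Hg := hat_gap_pos sigma hRe).
  assert (L0 : lim Et = 0 /\ lim Mm = 0) by (split; reflexivity).
  assert (B0 := hats_bigO0 sigma hRe (strip M) V lim HB).
  destruct (hats_first Thi sigma hRe M (strip M) V N lim HD HV L0 HB) as [F1 [F2 [F3 F4]]].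
  assert (dq : forall j, hat_weight sigma j = 0%R -> j <> One ->
      bigO (strip M) (1 - Re sigma) (fun l => V j l - lim j))
    by (intros j h1 h2; apply (hats_delta Thi sigma hRe M (strip M) V N lim); assumption).
  assert (b1 := B0 Be). assert (b2 := B0 Ga). assert (b3 := B0 Al).
  assert (b4 := B0 Q0). assert (b5 := B0 P0). assert (b6 := B0 Q1). assert (b7 := B0 P1).
  assert (d1 := dq Q0 eq_refl ltac:(discriminate)). assert (d2 := dq P0 eq_refl ltac:(discriminate)).
  assert (d3 := dq Q1 eq_refl ltac:(discriminate)). assert (d4 := dq P1 eq_refl ltac:(discriminate)).
  assert (d5 := dq Al eq_refl ltac:(discriminate)). assert (d6 := dq Be eq_refl ltac:(discriminate)).
  assert (d7 := dq Ga eq_refl ltac:(discriminate)).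
  (* Each defect is expanded around the limits. The constant left over is an eigenvector relation
     between the values of [hat_limit], verified by [cfield]. *)
  assert (W : forall i, exists x, 0 < x /\
     bigO (strip M) x (fun l => eigen_defect V i l - zero_vectors V i l)).
  { intros i. exists (1 - Re sigma)%R. split; [lra|].
    destruct i; try (apply bigO_zero; intros; simpl; ring).
    - apply (bigO_eq (strip M) _ (fun l => (V Et l - (V Al l - lim Al)) * V Q0 l
        + (sigma / 2 - lim Al + Th0 / 2) * (V Q0 l - lim Q0)
        + (hmu sigma V l - (V Be l - lim Be)) * V P0 l
        + (- lim Be) * (V P0 l - lim P0))).
      + intros l. unfold eigen_defect, zero_vectors, rel1, al0, be0. generalize (hmu sigma V l). intros mu.
        unfold lim, hat_limit, b, c. cbv zeta iota. cfield.
      + bigO_tac.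
    - apply (bigO_eq (strip M) _ (fun l => (hnu Thi sigma V l - (V Ga l - lim Ga)) * V Q0 l
        - lim Ga * (V Q0 l - lim Q0)
        - (V Et l - (V Al l - lim Al)) * V P0 l
        + (Th0 / 2 - sigma / 2 + lim Al) * (V P0 l - lim P0))).
      + intros l. unfold eigen_defect, zero_vectors, rel2, al0, ga0. generalize (hnu Thi sigma V l). intros nu.
        unfold lim, hat_limit, b, c. cbv zeta iota. cfield.
      + bigO_tac.
    - apply (bigO_eq (strip M) _ (fun l => (V Al l - lim Al) * V Q1 l
        + (lim Al + Th1 / 2) * (V Q1 l - lim Q1)
        + (V Be l - lim Be) * V P1 l + lim Be * (V P1 l - lim P1))).
      + intros l. unfold eigen_defect, zero_vectors, rel1, lim, hat_limit, b, c. cbv zeta iota. cfield.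
      + bigO_tac.
    - apply (bigO_eq (strip M) _ (fun l => (V Ga l - lim Ga) * V Q1 l
        + lim Ga * (V Q1 l - lim Q1)
        - (V Al l - lim Al) * V P1 l + (Th1 / 2 - lim Al) * (V P1 l - lim P1))).
      + intros l. unfold eigen_defect, zero_vectors, rel2, lim, hat_limit, b, c. cbv zeta iota. cfield.
      + bigO_tac. }
  assert (BZ : forall i, bigO (strip M) (hat_weight sigma i) (zero_vectors V i)).
  { intros i. destruct i; try apply B0;
      try (apply (bigO_eq (strip M) _ (fun _ => 0)); [reflexivity|apply bigO_const]);
      (eapply bigO_weaken; [|eassumption]); simpl; unfold hat_gap; lra. }
  apply (hats_unique Thi sigma M (strip M) hRe HD _ _ N).
  - intros l Hl HN. split; [now apply eigen_defect_hats, HV|].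
    destruct (HV l Hl HN) as [H1 H2]. split; [exact H1|].
    assert (H1' : zero_vectors V One l = 1) by exact H1.
    destruct (hat_rhs_eqs Thi sigma (zero_vectors V) l H1') as [_ [_ [_ [_ [_ [_ [E6 [E7 [E8 E9]]]]]]]]].
    intros i. destruct i; try (apply H2).
    + eapply Cder_val; [exact (Cder_const 0 l)|]. symmetry. etransitivity; [exact E6|]. simpl. ring.
    + eapply Cder_val; [exact (Cder_const 0 l)|]. symmetry. etransitivity; [exact E7|]. simpl. ring.
    + eapply Cder_val; [exact (Cder_const 0 l)|]. symmetry. etransitivity; [exact E8|]. simpl. ring.
    + eapply Cder_val; [exact (Cder_const 0 l)|]. symmetry. etransitivity; [exact E9|]. simpl. ring.
  - assert (W' : forall i, zero_vectors V i = (fun _ => 0) -> hat_weight sigma i = 0%R ->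
      bigO (strip M) (hat_weight sigma i) (eigen_defect V i)).
    { intros i Hi Hi0. destruct (W i) as [x [Hx Hw]]. rewrite Hi0.
      apply (bigO_eq (strip M) _ (fun l => eigen_defect V i l - zero_vectors V i l));
        [intros l; rewrite Hi; ring|]. apply (bigO_weaken _ x); [lra|exact Hw]. }
    intros i. destruct i; try exact (BZ _); try (exact (BZ One)); try (exact (BZ Al));
      apply W'; reflexivity.
  - exact BZ.
  - exact W.
Qed.

End Relations.

(** * Return to the original basis *)

Section Entries.

Variables (Thi sigma r : C).
Hypothesis hsigma : sigma <> 0.
Hypothesis hr : r <> 0.

(* Entries of [G A G^-1], where [A = ((al, bt), (gt, - al))] and [G] is the matrix of eigenvectors
   [((r d(-sigma), r), (- d(sigma), -1))] of the limit of the sum of the residue matrices. *)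
Definition ent11 (al bt gt : C) : C :=
  - (gt + al * Thi - d Thi sigma * d Thi (- sigma) * bt) / sigma.
Definition ent12 (al bt gt : C) : C :=
  r * (- gt - 2 * al * d Thi (- sigma) + d Thi (- sigma) ^ 2 * bt) / sigma.
Definition ent21 (al bt gt : C) : C :=
  (gt + 2 * al * d Thi sigma - d Thi sigma ^ 2 * bt) / (r * sigma).

(** Up to the factors [r], [-1] and a power of [T], [fnum] and [fden] are the components of the
    vector [(q, p)] in the original basis: its entries get their powers of [T] back and [G] is
    applied. [eigen_ratio] is their quotient. *)
Definition fnum (q p : C -> C) (l : C) : C := p l + d Thi (- sigma) * tpow l sigma * q l.
Definition fden (q p : C -> C) (l : C) : C := p l + d Thi sigma * tpow l sigma * q l.
Definition eigen_ratio (q p : C -> C) (l : C) : C := - r * (fnum q p l / fden q p l).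

(** Conjugation carries the eigenvector relation along: each left-hand side is a combination of
    [rel1] and [rel2] divided by [fden]. The two equations say that [(v, 1)] is an eigenvector for
    [- Th / 2] in the original basis, with [v] the [eigen_ratio]. *)
Lemma eigen_ratio_eigen (al be ga Th : C) (q p : C -> C) (l : C) :
  rel1 al be Th (q l) (p l) = 0 -> rel2 al ga Th (q l) (p l) = 0 -> fden q p l <> 0 ->
  let T := tpow l sigma in
  (ent11 al (be * T) (ga / T) + Th / 2) * eigen_ratio q p l + ent12 al (be * T) (ga / T) = 0 /\
  ent21 al (be * T) (ga / T) * eigen_ratio q p l + (Th / 2 - ent11 al (be * T) (ga / T)) = 0.
Proof.
  intros H1 H2 HF T. assert (HT : T <> 0) by apply tpow_neq_0.
  assert (HF' : p l * 2 + (Thi + sigma) * T * q l <> 0).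
  { intros E. apply HF. unfold fden, d. fold T.
    replace (p l + (Thi + sigma) / 2 * T * q l) with ((p l * 2 + (Thi + sigma) * T * q l) / 2)
      by cfield. rewrite E. cfield. }
  split.
  - transitivity (- r * (d Thi (- sigma) * T * rel1 al be Th (q l) (p l)
       + rel2 al ga Th (q l) (p l)) / fden q p l).
    + unfold ent11, ent12, eigen_ratio, fnum, fden, rel1, rel2, d. fold T. clearbody T. cfield.
    + rewrite H1, H2. field. exact HF.
  - transitivity ((d Thi sigma * T * rel1 al be Th (q l) (p l)
       + rel2 al ga Th (q l) (p l)) / fden q p l).
    + unfold ent11, ent21, eigen_ratio, fnum, fden, rel1, rel2, d. fold T. clearbody T. cfield.
    + rewrite H1, H2. field. exact HF.
Qed.

Lemma Cinv_neq_0 (x : C) : x <> 0 -> / x <> 0.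
Proof.
  intros H E. apply C1_nz. rewrite <- (Cinv_r x H), E. ring.
Qed.

Lemma fden_neq_0 (q p : C -> C) (l : C) : fden q p l <> 0 ->
  p l * 2 + (Thi + sigma) * tpow l sigma * q l <> 0.
Proof.
  intros HF E. apply HF. unfold fden, d.
  replace (p l + (Thi + sigma) / 2 * tpow l sigma * q l)
    with ((p l * 2 + (Thi + sigma) * tpow l sigma * q l) / 2) by cfield.
  rewrite E. cfield.
Qed.

Lemma f_deriv (k : C) (q p : C -> C) (l q' p' : C) : Cder q l q' -> Cder p l p' ->
  Cder (fun x => p x + k * tpow x sigma * q x) l
    (p' + (k * (sigma * tpow l sigma) * q l + k * tpow l sigma * q')).
Proof.
  intros Hq Hp. apply Cder_plus; [exact Hp|].
  apply (Cder_mult (fun x => k * tpow x sigma)); [|exact Hq]. apply Cder_scal, Cder_tpow.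
Qed.

(* A ratio of components of a solution of a linear system satisfies the Riccati equation. *)
Lemma eigen_ratio_deriv (q p : C -> C) (l e m n : C) :
  Cder q l (e * q l + m * p l) -> Cder p l (n * q l - e * p l) -> fden q p l <> 0 ->
  let T := tpow l sigma in
  Cder (eigen_ratio q p) l (2 * ent11 (sigma / 2 + e) (m * T) (n / T) * eigen_ratio q p l
    + ent12 (sigma / 2 + e) (m * T) (n / T)
    - ent21 (sigma / 2 + e) (m * T) (n / T) * eigen_ratio q p l ^ 2).
Proof.
  intros Hq Hp HF T. assert (HF' := fden_neq_0 q p l HF).
  assert (HT : T <> 0) by apply tpow_neq_0.
  eapply Cder_val.
  - apply (Cder_scal (- r) (fun x => fnum q p x / fden q p x)).
    apply (Cder_div (fnum q p) (fden q p)); [apply f_deriv|apply f_deriv|exact HF]; eassumption.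
  - unfold ent11, ent12, ent21, eigen_ratio, fnum, fden, d. fold T. fold T in HF'. clearbody T. cfield.
Qed.

End Entries.

Section Solution.

Variables (Th0 Th1 Thi sigma r : C).
Hypothesis hsigma : sigma <> 0.
Hypothesis hr : r <> 0.
Variable V : unknown -> C -> C.

(** The eigenvectors are [(v, 1)] for [A0] and [(y v, 1)] for [A1], so [sv0] is [v] and [sv1] is
    [y v]. The upper left entry of [A1] is [- z - (Th0 + Thi) / 2], which defines [sol_z]. *)
Definition sv0 : C -> C := eigen_ratio Thi sigma r (V Q0) (V P0).
Definition sv1 : C -> C := eigen_ratio Thi sigma r (V Q1) (V P1).
Definition sol_z (l : C) : C :=
  - ent11 Thi sigma (V Al l) (V Be l * tpow l sigma) (V Ga l / tpow l sigma) - (Th0 + Thi) / 2.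
Definition sol_y (l : C) : C := sv1 l / sv0 l.
Definition sol_u (l : C) : C := tpow l Thi * sv0 l.

Variable l : C.
Hypothesis HV : hats Thi sigma V l.
Hypothesis Hrel : forall i, eigen_defect Th0 Th1 Thi sigma V i l = zero_vectors V i l.
Hypothesis HF0 : fden Thi sigma (V Q0) (V P0) l <> 0.
Hypothesis HF1 : fden Thi sigma (V Q1) (V P1) l <> 0.
Hypothesis HN0 : fnum Thi sigma (V Q0) (V P0) l <> 0.
Hypothesis HN1 : fnum Thi sigma (V Q1) (V P1) l <> 0.

Let T := tpow l sigma.
(** [L12] and [L21] are the off-diagonal entries of [A0 + A1] in the original basis. *)
Let L12 := ent12 Thi sigma r (sigma / 2 + V Et l) (hmu sigma V l * T) (hnu Thi sigma V l / T).
Let L21 := ent21 Thi sigma r (sigma / 2 + V Et l) (hmu sigma V l * T) (hnu Thi sigma V l / T).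

Lemma sv_neq_0 : sv0 l <> 0 /\ sv1 l <> 0.
Proof.
  assert (Hr : - r <> 0).
  { intros E. apply hr. replace r with (- - r) by ring. rewrite E. ring. }
  split; (apply Cmult_neq_0; [assumption|]; apply Cmult_neq_0; [assumption|]; now apply Cinv_neq_0).
Qed.

(** The linear coefficient of the Riccati equation is twice the upper left entry of [A0 + A1]; the
    definition of [hnu] makes it the constant [- Thi]. *)
Lemma sv0_deriv : Cder sv0 l (- Thi * sv0 l + L12 - L21 * sv0 l ^ 2).
Proof.
  assert (HT : T <> 0) by apply tpow_neq_0.
  destruct (hats_deriv Thi sigma V l HV) as [_ [_ [_ [_ [_ [D6 [D7 _]]]]]]].
  eapply Cder_val; [apply (eigen_ratio_deriv Thi sigma r hsigma hr _ _ _ _ _ _ D6 D7 HF0)|].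
  fold T. fold L12 L21. fold sv0. generalize (sv0 l). intros v. generalize L12 L21. intros a1 a2.
  unfold ent11, hmu, hnu, d. fold T. clearbody T. cfield.
Qed.

Lemma sv1_deriv : Cder sv1 l ((tt l - Thi) * sv1 l + L12 - L21 * sv1 l ^ 2).
Proof.
  assert (HT : T <> 0) by apply tpow_neq_0.
  destruct (hats_deriv Thi sigma V l HV) as [_ [_ [_ [_ [_ [_ [_ [D8 D9]]]]]]]].
  eapply Cder_val; [apply (eigen_ratio_deriv Thi sigma r hsigma hr _ _ _ _ _ _ D8 D9 HF1)|].
  fold T. fold sv1. generalize (sv1 l). intros v. unfold L12, L21.
  unfold ent11, ent12, ent21, hmu, hnu, S11, S12, S21, d. fold T. clearbody T. cfield.
Qed.

Lemma sol_z_deriv :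
  Cder sol_z l
   (L21 * ent12 Thi sigma r (V Al l) (V Be l * T) (V Ga l / T)
    - L12 * ent21 Thi sigma r (V Al l) (V Be l * T) (V Ga l / T)).
Proof.
  assert (HT : T <> 0) by apply tpow_neq_0.
  destruct (hats_deriv Thi sigma V l HV) as [_ [_ [D3 [D4 [D5 _]]]]].
  apply (Cder_ext (fun x => (V Ga x / tpow x sigma + V Al x * Thi
     - d Thi sigma * d Thi (- sigma) * (V Be x * tpow x sigma)) / sigma - (Th0 + Thi) / 2) _ _ _ 1).
  { lra. }
  { intros m _. unfold sol_z, ent11. cfield. }
  eapply Cder_val.
  - apply Cder_minus; [|apply Cder_const].
    apply (Cder_mult (fun x => V Ga x / tpow x sigma + V Al x * Thi
     - d Thi sigma * d Thi (- sigma) * (V Be x * tpow x sigma)) (fun _ => / sigma));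
      [|apply Cder_const].
    apply (Cder_minus (fun x => V Ga x / tpow x sigma + V Al x * Thi)
      (fun x => d Thi sigma * d Thi (- sigma) * (V Be x * tpow x sigma))).
    + apply (Cder_plus (fun x => V Ga x / tpow x sigma) (fun x => V Al x * Thi)).
      * apply (Cder_div (V Ga) (fun x => tpow x sigma)); [exact D5|apply Cder_tpow|exact HT].
      * apply (Cder_mult (V Al) (fun _ => Thi)); [exact D3|apply Cder_const].
    + apply Cder_scal. apply (Cder_mult (V Be) (fun x => tpow x sigma)); [exact D4|apply Cder_tpow].
  - unfold L12, L21, ent12, ent21, hmu, hnu, S11, S12, S21, d. fold T. clearbody T. cfield.
Qed.

(** An eigenvector [(v, 1)] and the diagonal of a traceless matrix determine its off-diagonal
    entries. This is applied to [A1] with [sv1] and to [A0] with [sv0]; [L12] and [L21] are the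
    sums. *)
Lemma sol_relations :
  let z := sol_z l in
  let m1 := (Th0 - Th1 + Thi) / 2 in let m2 := (Th0 + Th1 + Thi) / 2 in
  ent12 Thi sigma r (V Al l) (V Be l * T) (V Ga l / T) = sv1 l * (z + m1) /\
  ent21 Thi sigma r (V Al l) (V Be l * T) (V Ga l / T) = - (z + m2) / sv1 l /\
  L12 = sv1 l * (z + m1) - sv0 l * (z + Th0) /\
  L21 = z / sv0 l - (z + m2) / sv1 l.
Proof.
  assert (HT : T <> 0) by apply tpow_neq_0.
  destruct sv_neq_0 as [N0 N1]. intros z m1 m2.
  assert (R1 := Hrel Q0). assert (R2 := Hrel P0). assert (R3 := Hrel Q1). assert (R4 := Hrel P1).
  destruct (eigen_ratio_eigen Thi sigma r hsigma hr _ _ _ _ _ _ _ R1 R2 HF0) as [E1 E2].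
  destruct (eigen_ratio_eigen Thi sigma r hsigma hr _ _ _ _ _ _ _ R3 R4 HF1) as [E3 E4].
  fold T in E1, E2, E3, E4. fold sv0 in E1, E2. fold sv1 in E3, E4.
  set (x12 := ent12 Thi sigma r (V Al l) (V Be l * T) (V Ga l / T)) in *.
  set (x21 := ent21 Thi sigma r (V Al l) (V Be l * T) (V Ga l / T)) in *.
  assert (Z1 : ent11 Thi sigma (V Al l) (V Be l * T) (V Ga l / T) = - z - (Th0 + Thi) / 2).
  { unfold z, sol_z. fold T. ring. }
  assert (Z0 : ent11 Thi sigma (al0 sigma V l) (be0 sigma V l * T) (ga0 Thi sigma V l / T)
     = z + Th0 / 2).
  { unfold z, sol_z, ent11, al0, be0, ga0, hmu, hnu, d. fold T. clearbody T. cfield. }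
  rewrite Z1 in E3, E4. rewrite Z0 in E1, E2.
  assert (Q12 : x12 = sv1 l * (z + m1)).
  { transitivity ((- z - (Th0 + Thi) / 2 + Th1 / 2) * sv1 l + x12 + sv1 l * (z + m1)).
    - unfold m1. cfield.
    - rewrite E3. ring. }
  assert (Q21 : x21 = - (z + m2) / sv1 l).
  { transitivity ((x21 * sv1 l + (Th1 / 2 - (- z - (Th0 + Thi) / 2)) - (z + m2)) / sv1 l).
    - unfold m2. cfield.
    - rewrite E4. cfield. }
  assert (P12 : L12 = x12 + ent12 Thi sigma r (al0 sigma V l) (be0 sigma V l * T)
     (ga0 Thi sigma V l / T)).
  { unfold L12, x12, ent12, al0, be0, ga0. cfield. }
  assert (P21 : L21 = x21 + ent21 Thi sigma r (al0 sigma V l) (be0 sigma V l * T)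
     (ga0 Thi sigma V l / T)).
  { unfold L21, x21, ent21, al0, be0, ga0. cfield. }
  set (y12 := ent12 Thi sigma r (al0 sigma V l) (be0 sigma V l * T) (ga0 Thi sigma V l / T)) in *.
  set (y21 := ent21 Thi sigma r (al0 sigma V l) (be0 sigma V l * T) (ga0 Thi sigma V l / T)) in *.
  repeat split; [exact Q12|exact Q21| |].
  - rewrite P12, Q12.
    replace y12 with ((z + Th0 / 2 + Th0 / 2) * sv0 l + y12 - sv0 l * (z + Th0)) by cfield.
    rewrite E1. ring.
  - rewrite P21, Q21.
    replace y21 with ((y21 * sv0 l + (Th0 / 2 - (z + Th0 / 2)) + z) / sv0 l) by cfield.
    rewrite E2. cfield.
Qed.

Lemma sol_equations :
  let y := sol_y l in let z := sol_z l in let u := sol_u l in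
  y <> 0 /\ u <> 0 /\
  Cder sol_y l (tt l * y - 2 * z * (y - 1) ^ 2
        - (y - 1) * ((Th0 - Th1 + Thi) / 2 * y - (3 * Th0 + Th1 + Thi) / 2)) /\
  Cder sol_z l (y * z * (z + (Th0 - Th1 + Thi) / 2)
        - 1 / y * (z + Th0) * (z + (Th0 + Th1 + Thi) / 2)) /\
  Cder sol_u l (u * (- 2 * z - Th0 + y * (z + (Th0 - Th1 + Thi) / 2)
               + 1 / y * (z + (Th0 + Th1 + Thi) / 2))).
Proof.
  assert (HT : T <> 0) by apply tpow_neq_0.
  destruct sv_neq_0 as [N0 N1].
  destruct sol_relations as [Q12 [Q21 [P12 P21]]].
  intros y z u. fold z in Q12, Q21, P12, P21.
  assert (D0 := sv0_deriv). assert (D1 := sv1_deriv). assert (Dz := sol_z_deriv).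
  rewrite P12, P21 in D0, D1, Dz. rewrite Q12, Q21 in Dz.
  assert (Ny : y <> 0).
  { unfold y, sol_y. apply Cmult_neq_0; [assumption|]. now apply Cinv_neq_0. }
  repeat split.
  - exact Ny.
  - apply Cmult_neq_0; [apply tpow_neq_0|assumption].
  - eapply Cder_val; [apply (Cder_div sv1 sv0); eassumption|].
    unfold y, sol_y. cfield.
  - eapply Cder_val; [exact Dz|]. unfold y, sol_y. cfield.
  - eapply Cder_val; [apply (Cder_mult (fun x => tpow x Thi) sv0); [apply Cder_tpow|exact D0]|].
    unfold u, sol_u, y, sol_y. cfield.
Qed.

End Solution.

(** * Meromorphy *)

Lemma holomorphic_Cder (f : C -> C) (l : C) : holomorphic_at f l <-> exists v, Cder f l v.
Proof. split; intros [v H]; exists v; now apply Cder_is_derive. Qed.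

Lemma Cpow_S (x : C) (n : nat) : x ^ S n = x * x ^ n.
Proof. reflexivity. Qed.

Lemma Cpow_add (x : C) (n m : nat) : x ^ (n + m) = x ^ n * x ^ m.
Proof.
  induction n as [|n IH]; [simpl; ring|].
  change (S n + m)%nat with (S (n + m)). rewrite !Cpow_S, IH. ring.
Qed.

Lemma Cmod_lt_l (l e : R) (m : C) : 0 < e -> Cmod (m - m) < e.
Proof. intros He. replace (m - m) with (RtoC 0) by ring. now rewrite Cmod_0. Qed.

Lemma mero_of_holo (f : C -> C) (l : C) (e : R) : 0 < e ->
  (forall m, Cmod (m - l) < e -> exists v, Cder f m v) -> meromorphic_at f l.
Proof.
  intros He H. exists 0%nat, e, f. repeat split; [assumption| |].
  - intros m Hm. apply holomorphic_Cder. now apply H.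
  - intros m _. simpl. ring.
Qed.

Lemma mero_mult (f g : C -> C) (l : C) :
  meromorphic_at f l -> meromorphic_at g l -> meromorphic_at (fun x => f x * g x) l.
Proof.
  intros [n1 [e1 [h1 [He1 [H1 E1]]]]] [n2 [e2 [h2 [He2 [H2 E2]]]]].
  exists (n1 + n2)%nat, (Rmin e1 e2), (fun x => h1 x * h2 x).
  repeat split; [now apply Rmin_pos| |].
  - intros m Hm.
    destruct (proj1 (holomorphic_Cder _ _) (H1 m ltac:(lt_min))) as [v1 D1].
    destruct (proj1 (holomorphic_Cder _ _) (H2 m ltac:(lt_min))) as [v2 D2].
    apply holomorphic_Cder. eexists. apply Cder_mult; eassumption.
  - intros m [Hm0 Hm]. rewrite Cpow_add.
    rewrite <- E1 by (split; [assumption|lt_min]).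
    rewrite <- E2 by (split; [assumption|lt_min]).
    ring.
Qed.

Lemma mero_ext (f g : C -> C) (l : C) (e : R) : 0 < e ->
  (forall m, 0 < Cmod (m - l) < e -> f m = g m) -> meromorphic_at f l -> meromorphic_at g l.
Proof.
  intros He E [n1 [e1 [h1 [He1 [H1 E1]]]]].
  exists n1, (Rmin e e1), h1. repeat split; [now apply Rmin_pos| |].
  - intros m Hm. apply H1. lt_min.
  - intros m [Hm0 Hm]. rewrite <- E, <- E1; [reflexivity| |];
      (split; [assumption|eapply Rlt_le_trans; [exact Hm|]]); [apply Rmin_r|apply Rmin_l].
Qed.

Lemma simple_zero_isolated (f f' : C -> C) (l : C) : Cder f l (f' l) ->
  f l <> 0 \/ f' l <> 0 ->
  exists e, 0 < e /\ forall m, 0 < Cmod (m - l) < e -> f m <> 0.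
Proof.
  intros Hf H. destruct (classic (f l = 0)) as [H0|H0].
  - assert (H1 : f' l <> 0) by (destruct H; [contradiction|assumption]).
    assert (P : 0 < Cmod (f' l)) by now apply Cmod_gt_0.
    destruct (Hf (Cmod (f' l) / 2)%R) as [e [He H2]]; [lra|].
    exists e. split; [assumption|]. intros m [Hm0 Hm] E.
    specialize (H2 (m - l) Hm). replace (l + (m - l)) with m in H2 by ring.
    rewrite E, H0 in H2. replace (0 - 0 - f' l * (m - l)) with (- (f' l * (m - l))) in H2 by ring.
    rewrite Cmod_opp, Cmod_mult in H2. nra.
  - destruct (Cder_cont f l _ Hf (Cmod (f l))) as [e [He H2]]; [now apply Cmod_gt_0|].
    exists e. split; [assumption|]. intros m [_ Hm] E. specialize (H2 m Hm).
    rewrite E in H2. replace (0 - f l) with (- f l) in H2 by ring. rewrite Cmod_opp in H2. lra.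
Qed.

Lemma mero_inv (f f' : C -> C) (l : C) (e : R) : 0 < e ->
  (forall m, Cmod (m - l) < e -> Cder f m (f' m)) ->
  f l <> 0 \/ f' l <> 0 -> meromorphic_at (fun x => / f x) l.
Proof.
  intros He Hf H.
  destruct (simple_zero_isolated f f' l (Hf l (Cmod_lt_l 0 e l He)) H) as [e1 [He1 H1]].
  destruct (classic (f l = 0)) as [H0|H0].
  (* Exponent 2 at a simple zero: the function [/ f x * (x - l) ^ 2] then takes the correct value 0
     at [l] whatever [/ 0] is, and its derivative there is [/ f' l]. *)
  - exists 2%nat, (Rmin e e1), (fun x => / f x * (x - l) ^ 2).
    repeat split; [now apply Rmin_pos|].
    intros m Hm. apply holomorphic_Cder.
    assert (Hm1 := Rlt_le_trans _ _ _ Hm (Rmin_l _ _)).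
    assert (Hm2 := Rlt_le_trans _ _ _ Hm (Rmin_r _ _)).
    destruct (Rle_lt_or_eq_dec 0 (Cmod (m - l)) (Cmod_ge_0 _)) as [Hp|Hp].
    + eexists. apply (Cder_mult (fun x => / f x) (fun x => (x - l) ^ 2)).
      * apply Cder_inv; [now apply Hf|]. now apply H1.
      * apply (Cder_mult (fun x => x - l) (fun x => (x - l) * 1));
          [|apply (Cder_mult (fun x => x - l) (fun _ => 1)); [|apply Cder_const]];
          apply Cder_minus; apply Cder_id || apply Cder_const.
    + assert (El : m = l).
      { symmetry in Hp. apply Cmod_eq_0 in Hp. replace m with (m - l + l) by ring. rewrite Hp. ring. }
      subst m. assert (Hd : f' l <> 0) by (destruct H; [contradiction|assumption]).
      exists (/ f' l). intros eps Heps.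
      assert (P : 0 < Cmod (f' l)) by now apply Cmod_gt_0.
      set (k := Cmod (f' l)) in *.
      set (q := Rmin (k / 2) (eps * (k * k) / 2)).
      assert (Hkk : 0 < k * k) by (apply Rmult_lt_0_compat; assumption).
      assert (Hq : 0 < q) by (apply Rmin_pos; [lra|apply Rdiv_lt_0_compat; [apply Rmult_lt_0_compat|]; lra]).
      destruct (Hf l Hm1 q Hq) as [e2 [He2 H2]].
      exists (Rmin e1 e2). split; [now apply Rmin_pos|]. intros h Hh.
      assert (G1 := Rlt_le_trans _ _ _ Hh (Rmin_l _ _)).
      assert (G2 := Rlt_le_trans _ _ _ Hh (Rmin_r _ _)).
      replace (l - l) with (RtoC 0) by ring. replace (0 ^ 2) with (RtoC 0) by (simpl; ring).
      rewrite Cmult_0_r. replace (l + h - l) with h by ring.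
      destruct (classic (h = 0)) as [->|Hh0].
      { replace (/ f (l + 0) * 0 ^ 2 - 0 - / f' l * 0) with (RtoC 0) by (simpl; ring).
        rewrite Cmod_0. lra. }
      assert (Ph : 0 < Cmod h) by now apply Cmod_gt_0.
      specialize (H2 h G2). rewrite H0 in H2.
      assert (Hn : f (l + h) <> 0).
      { apply H1. replace (l + h - l) with h by ring. now split. }
      assert (bounded_below1 : k / 2 * Cmod h <= Cmod (f (l + h))).
      { assert (T := Cmod_le_sub (f' l * h) (f (l + h))).
        replace (f' l * h - f (l + h)) with (- (f (l + h) - 0 - f' l * h)) in T by ring.
        rewrite Cmod_opp, Cmod_mult in T. fold k in T.
        assert (q <= k / 2) by apply Rmin_l. nra. }
      replace (/ f (l + h) * h ^ 2 - 0 - / f' l * h)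
        with (- ((f (l + h) - 0 - f' l * h) * h / (f (l + h) * f' l))) by (field; auto).
      rewrite Cmod_opp, Cmod_div, !Cmod_mult by now apply Cmult_neq_0.
      fold k. apply Rle_div_l; [apply Rmult_gt_0_compat; [|lra]; apply Cmod_gt_0; assumption|].
      assert (q <= eps * (k * k) / 2) by apply Rmin_r. clearbody q k.
      apply Rle_trans with (q * Cmod h * Cmod h)%R; [apply Rmult_le_compat_r; lra|].
      apply Rle_trans with (eps * (k * k) / 2 * Cmod h * Cmod h)%R.
      { repeat apply Rmult_le_compat_r; lra. }
      apply Rle_trans with (eps * Cmod h * ((k / 2 * Cmod h) * k))%R; [right; field|].
      apply Rmult_le_compat_l; [nra|]. apply Rmult_le_compat_r; lra.
  - apply (mero_of_holo _ _ (Rmin e e1)); [now apply Rmin_pos|]. intros m Hm.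
    eexists. apply Cder_inv; [apply Hf; lt_min|].
    destruct (Rle_lt_or_eq_dec 0 (Cmod (m - l)) (Cmod_ge_0 _)) as [Hp|Hp].
    + apply H1. split; [assumption|]. lt_min.
    + symmetry in Hp. apply Cmod_eq_0 in Hp. replace m with (m - l + l) by ring. rewrite Hp.
      now rewrite Cplus_0_l.
Qed.

(** A quantitative local inverse of [Cexp] at 1, given by [ln |x| + i atan (Im x / Re x)]. It is
    used to show that where [A0 + B0 t ^ sigma] is small there is a true zero nearby. *)
Lemma small_log (e : R) : 0 < e -> exists k, 0 < k <= 1 /\
  forall x : C, Cmod (x - 1) < k -> exists w, Cexp w = x /\ Cmod w < e.
Proof.
  intros He.
  assert (Dl : derivable_pt_lim ln 1 1).
  { assert (T := derivable_pt_lim_ln 1 ltac:(lra)). rewrite Rinv_1 in T. exact T. }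
  assert (Cl : exists dl, 0 < dl /\ forall y, Rabs (y - 1) < dl -> Rabs (ln y) < e / 2).
  { destruct (Dl 1%R ltac:(lra)) as [[dl Hd] H]. simpl in H.
    exists (Rmin dl (e / 5)). split; [apply Rmin_pos; lra|]. intros y Hy.
    assert (G1 := Rlt_le_trans _ _ _ Hy (Rmin_l _ _)).
    assert (G2 := Rlt_le_trans _ _ _ Hy (Rmin_r _ _)).
    destruct (Req_dec y 1) as [->|Hn]; [rewrite ln_1, Rabs_R0; lra|].
    assert (Hn' : (y - 1 <> 0)%R) by lra.
    specialize (H (y - 1)%R Hn' G1). rewrite ln_1 in H.
    replace (1 + (y - 1))%R with y in H by ring.
    replace (ln y) with ((((ln y - 0) / (y - 1) - 1) + 1) * (y - 1))%R by (field; assumption).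
    rewrite Rabs_mult.
    assert (T := Rabs_triang ((ln y - 0) / (y - 1) - 1) 1). rewrite Rabs_R1 in T.
    assert (T2 := Rabs_pos (y - 1)%R).
    apply Rle_lt_trans with (2 * Rabs (y - 1))%R; [|lra].
    apply Rmult_le_compat_r; lra. }
  destruct Cl as [dl [Hd Hln]].
  (* The bound [/ 2] keeps [Re x] above [/ 2], so that [|Im x| < e / 8] gives
     [|Im x / Re x| < e / 2]; [dl] controls the logarithm of the modulus. *)
  exists (Rmin (Rmin dl (/ 2)) (e / 8)).
  assert (Hk : 0 < Rmin (Rmin dl (/ 2)) (e / 8)) by (repeat apply Rmin_pos; lra).
  split.
  { split; [assumption|]. eapply Rle_trans; [apply Rmin_l|]. eapply Rle_trans; [apply Rmin_r|lra]. }
  intros x Hx.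
  assert (G0 := Rlt_le_trans _ _ _ Hx (Rmin_l _ _)).
  assert (G3 := Rlt_le_trans _ _ _ Hx (Rmin_r _ _)).
  assert (G1 := Rlt_le_trans _ _ _ G0 (Rmin_l _ _)).
  assert (G2 := Rlt_le_trans _ _ _ G0 (Rmin_r _ _)).
  assert (R1 := re_le_Cmod (x - 1)). assert (I1 := Im_le_Cmod (x - 1)).
  replace (Re (x - 1)) with (Re x - 1)%R in R1 by reflexivity.
  replace (Im (x - 1)) with (Im x)%R in I1 by (destruct x; simpl; ring).
  assert (Hre : / 2 < Re x).
  { assert (T := Rle_abs (- (Re x - 1))). rewrite Rabs_Ropp in T. lra. }
  set (a0 := Re x) in *. set (b0 := Im x) in *. set (v := (b0 / a0)%R).
  assert (Hs : 0 < 1 + v²) by (assert (T := Rle_0_sqr v); lra).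
  assert (Hsq := sqrt_lt_R0 _ Hs).
  assert (Hrho : Cmod x = (a0 * sqrt (1 + v²))%R).
  { unfold Cmod. destruct x as [x1 x2]. unfold v, a0, b0. simpl.
    replace (x1 * (x1 * 1) + x2 * (x2 * 1))%R with (x1² * (1 + (x2 / x1)²))%R.
    - rewrite sqrt_mult_alt by apply Rle_0_sqr. rewrite sqrt_Rsqr; [reflexivity|].
      unfold a0 in Hre. simpl in Hre. lra.
    - unfold Rsqr. field. unfold a0 in Hre. simpl in Hre. lra. }
  exists (ln (Cmod x), atan v). split.
  - unfold Cexp. simpl. rewrite exp_ln.
    2: { rewrite Hrho. apply Rmult_lt_0_compat; lra. }
    rewrite cos_atan, sin_atan, Hrho. rewrite (surjective_pairing x). f_equal.
    + change (fst x) with a0. field. lra.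
    + change (snd x) with b0. unfold v. field. unfold v in Hsq. split; lra.
  - eapply Rle_lt_trans; [apply Cmod_le_abs|]. simpl.
    assert (L1 : Rabs (ln (Cmod x)) < e / 2).
    { apply Hln. eapply Rle_lt_trans; [|exact G1]. 
      assert (T1 := Cmod_le_sub x 1). assert (T2 := Cmod_le_sub 1 x).
      rewrite Cmod_sub_comm in T2. rewrite Cmod_1 in *. apply Rabs_le. lra. }
    assert (L2 : Rabs (atan v) <= Rabs v).
    { assert (P : forall y, 0 <= y -> atan y <= y).
      { intros y [Hy|<-]; [|rewrite atan_0; lra].
        destruct (MVT_cor2 atan (fun z => / (1 + z ^ 2))%R 0 y Hy) as [z [Hz _]].
        - intros z _. apply derivable_pt_lim_atan.
        - rewrite atan_0 in Hz. assert (T : / (1 + z ^ 2) <= 1).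
          { rewrite <- Rinv_1. apply Rinv_le_contravar; [lra|]. assert (Q := pow2_ge_0 z). lra. }
          nra. }
      assert (Q : forall y, 0 <= y -> 0 <= atan y).
      { intros y [Hy|<-]; [|rewrite atan_0; lra]. left. rewrite <- atan_0. now apply atan_increasing. }
      destruct (Rle_dec 0 v) as [Hv|Hv].
      - rewrite !Rabs_pos_eq; auto.
      - rewrite <- (Rabs_Ropp (atan v)), <- (Rabs_Ropp v), <- atan_opp.
        rewrite !Rabs_pos_eq; try apply P; try apply Q; lra. }
    assert (L3 : Rabs v < e / 2).
    { unfold v, Rdiv. rewrite Rabs_mult, Rabs_inv, (Rabs_pos_eq a0) by lra.
      apply Rlt_div_l; [lra|]. nra. }
    lra.
Qed.

(** * Lower bounds for factors linear in [t ^ sigma] *)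

Lemma tpow_lower (M : R) (sigma l : C) : Re sigma = 0%R -> strip M l ->
  exp (- (Rabs (Im sigma) * M)) <= Cmod (tpow l sigma).
Proof.
  intros H0 Hl. unfold tpow. rewrite Cmod_Cexp. apply exp_le_compat.
  replace (Re (sigma * l)) with (Re sigma * Re l - Im sigma * Im l)%R
    by (destruct sigma, l; simpl; ring).
  rewrite H0. assert (T := Rle_abs (Im sigma * Im l)). rewrite Rabs_mult in T.
  assert (Rabs (Im sigma) * Rabs (Im l) <= Rabs (Im sigma) * M).
  { apply Rmult_le_compat_l; [apply Rabs_pos|]. unfold strip in Hl. lra. }
  lra.
Qed.

(** If [A0 + B0 T] is small at [l], then [- A0 / (B0 T)] is close to 1 because [|T|] is bounded
    below. Its small logarithm [w] gives an exact zero at [l + w / sigma], closer than [e]. *)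
Lemma away_lower (M e : R) (sigma A0 B0 : C) : 0 < e -> sigma <> 0 -> Re sigma = 0%R ->
  A0 <> 0 \/ B0 <> 0 -> exists k, 0 < k /\ forall l, strip M l ->
    away e (fun m => A0 + B0 * tpow m sigma) l -> k <= Cmod (A0 + B0 * tpow l sigma).
Proof.
  intros He Hs H0 HAB.
  assert (Ps : 0 < Cmod sigma) by now apply Cmod_gt_0.
  destruct (classic (B0 = 0)) as [->|HB].
  - exists (Cmod A0). split.
    + apply Cmod_gt_0. destruct HAB as [H|H]; [assumption|now contradiction H].
    + intros l _ _. replace (A0 + 0 * tpow l sigma) with A0 by ring. lra.
  - destruct (small_log (e * Cmod sigma)) as [k [[Hk _] H]]; [now apply Rmult_lt_0_compat|].
    assert (PB : 0 < Cmod B0) by now apply Cmod_gt_0.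
    set (tm := exp (- (Rabs (Im sigma) * M))).
    assert (Ptm : 0 < tm) by apply exp_pos.
    exists (k * (Cmod B0 * tm))%R. split; [repeat apply Rmult_lt_0_compat; assumption|].
    intros l Hl Haw. destruct (Rle_dec (k * (Cmod B0 * tm)) (Cmod (A0 + B0 * tpow l sigma)))
      as [L|L]; [assumption|exfalso]. apply Rnot_le_lt in L.
    assert (HT := tpow_lower M sigma l H0 Hl). fold tm in HT.
    assert (NT := tpow_neq_0 l sigma).
    destruct (H (- A0 / (B0 * tpow l sigma))) as [w [Hw1 Hw2]].
    { replace (- A0 / (B0 * tpow l sigma) - 1)
        with (- ((A0 + B0 * tpow l sigma) / (B0 * tpow l sigma))) by (field; auto).
      rewrite Cmod_opp, Cmod_div, (Cmod_mult B0) by now apply Cmult_neq_0.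
      apply Rlt_div_l; [apply Rmult_gt_0_compat; lra|].
      eapply Rlt_le_trans; [exact L|]. apply Rmult_le_compat_l; [lra|].
      apply Rmult_le_compat_l; lra. }
    specialize (Haw (l + w / sigma)).
    assert (E : A0 + B0 * tpow (l + w / sigma) sigma = 0).
    { unfold tpow. replace (sigma * (l + w / sigma)) with (sigma * l + w) by (field; auto).
      rewrite Cexp_plus, Hw1. fold (tpow l sigma). field. auto. }
    specialize (Haw E). replace (l - (l + w / sigma)) with (- (w / sigma)) in Haw by ring.
    rewrite Cmod_opp, Cmod_div in Haw by assumption.
    apply Rle_div_r in Haw; lra.
Qed.

Lemma bounded_below_tpow (M : R) (sigma : C) : Re sigma = 0%R -> bounded_below (strip M) (fun l => tpow l sigma).
Proof.
  intros H. exists (exp (- (Rabs (Im sigma) * M))), 0%R. split; [apply exp_pos|].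
  intros l Hl _. now apply tpow_lower.
Qed.

Lemma bounded_below_sub (D D' : C -> Prop) (f : C -> C) : (forall l, D' l -> D l) -> bounded_below D f -> bounded_below D' f.
Proof. intros HD [k [N [Hk H]]]. exists k, N. auto. Qed.

Lemma bounded_below_inv (D : C -> Prop) (f : C -> C) : bigO D 0 f -> bounded_below D f -> bounded_below D (fun l => / f l).
Proof.
  intros Hf Hl. destruct (bigO_pos _ _ _ Hf) as [K [N [HK [_ H]]]].
  destruct Hl as [k [N1 [Hk H1]]].
  exists (/ (K + 1))%R, (Rmin N N1). split; [apply Rinv_0_lt_compat; lra|]. intros l Hl HN.
  specialize (H l Hl ltac:(lt_min)).
  specialize (H1 l Hl ltac:(lt_min)).
  rewrite Rmult_0_l, exp_0 in H.
  rewrite Cmod_inv by (apply Cmod_gt_0; lra). apply Rinv_le_contravar; lra.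
Qed.

Lemma bigO2_of_bigO (M : R) (E : C -> Prop) (f : C -> C) (p q x : R) : Rmin p q <= x ->
  bigO (fun l => strip M l /\ E l) x f -> bigO2 M E f p q.
Proof.
  intros Hx Hf. apply (bigO_weaken _ _ _ _ Hx) in Hf.
  destruct (bigO_pos _ _ _ Hf) as [K [N [HK [_ H]]]].
  exists K, N. intros l [Hl HN] HE. eapply Rle_trans; [now apply H|].
  apply Rmult_le_compat_l; [assumption|]. unfold tpow. rewrite !Cmod_Cexp.
  assert (R1 : forall p : R, Re (p * l) = (p * Re l)%R) by (intros; destruct l; simpl; ring).
  rewrite !R1. assert (P1 := exp_pos (p * Re l)). assert (P2 := exp_pos (q * Re l)).
  unfold Rmin. destruct (Rle_dec p q); lra.
Qed.

Lemma bounded_below_linear_exp (M : R) (sigma A0 B0 : C) (D : C -> Prop) : left_strip M D ->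
  0 < Re sigma -> A0 <> 0 -> bounded_below D (fun l => A0 + B0 * tpow l sigma).
Proof.
  intros HD Hs HA. apply (bounded_below_perturb D (Re sigma) (fun _ => A0)); [assumption|now apply bounded_below_const|].
  apply (bigO_eq D _ (fun l => B0 * tpow l sigma)); [intros; ring|]. bigO_tac.
Qed.

Section Simple.

Variables (M : R) (sigma k A0 B1 : C).
Variables (q p q' p' : C -> C) (dlt : R).
Hypothesis hsigma : sigma <> 0.
Hypothesis hRe : 0 <= Re sigma.
Hypothesis Hd : 0 < dlt.
Hypothesis Hq : bigO (strip M) dlt (fun l => q l - B1).
Hypothesis Hp : bigO (strip M) dlt (fun l => p l - A0).
Hypothesis Hq' : bigO (strip M) dlt q'.
Hypothesis Hp' : bigO (strip M) dlt p'.
Hypothesis Hnd : A0 <> 0 \/ (Re sigma = 0%R /\ k * B1 <> 0).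

Definition fk (l : C) : C := p l + k * tpow l sigma * q l.
Definition fk' (l : C) : C := p' l + (k * (sigma * tpow l sigma) * q l + k * tpow l sigma * q' l).

(** [sigma fk - fk'] tends to [sigma A0], so for [A0 <> 0] the function and its derivative cannot
    vanish together near [t = 0]. For [A0 = 0] and imaginary [sigma], [fk] itself stays away from 0,
    since [k B1 T] dominates. *)
Lemma fk_simple : exists N', forall l, strip M l -> Re l < N' -> fk l <> 0 \/ fk' l <> 0.
Proof.
  assert (HD := strip_left M).
  destruct (classic (A0 = 0)) as [HA|HA].
  - destruct Hnd as [H|[H0 HB]]; [contradiction|].
    assert (L : bounded_below (strip M) fk).
    { apply (bounded_below_perturb _ dlt (fun l => k * B1 * tpow l sigma)); [assumption| |].
      - apply (bounded_below_mult _ (fun _ => k * B1)); [now apply bounded_below_const|now apply bounded_below_tpow].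
      - apply (bigO_eq _ _ (fun l => (p l - A0) + k * tpow l sigma * (q l - B1))).
        + intros l. unfold fk. rewrite HA. ring.
        + bigO_tac. }
    destruct (bounded_below_neq_0 _ _ L) as [N' HN]. exists N'. intros l Hl HlN. left. now apply HN.
  - assert (L : bounded_below (strip M) (fun l => sigma * fk l - fk' l)).
    { apply (bounded_below_perturb _ dlt (fun _ => sigma * A0)); [assumption| |].
      - apply bounded_below_const. now apply Cmult_neq_0.
      - apply (bigO_eq _ _ (fun l => sigma * (p l - A0) - p' l - k * tpow l sigma * q' l)).
        + intros l. unfold fk, fk'. ring.
        + bigO_tac. }
    destruct (bounded_below_neq_0 _ _ L) as [N' HN]. exists N'. intros l Hl HlN.
    specialize (HN l Hl HlN). destruct (classic (fk l = 0)) as [Z|Z]; [right|now left].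
    intros Z'. apply HN. rewrite Z, Z'. ring.
Qed.

End Simple.

(** * Existence *)

Lemma sector_open (M N : R) (l : C) : sector M N l ->
  exists e, 0 < e /\ forall m, Cmod (m - l) < e -> sector M N m.
Proof.
  intros [L1 L2]. exists (Rmin (N - Re l) (M - Rabs (Im l))). split; [apply Rmin_pos; lra|].
  intros m Hm. assert (R1 := Rlt_le_trans _ _ _ Hm (Rmin_l _ _)).
  assert (R2 := Rlt_le_trans _ _ _ Hm (Rmin_r _ _)).
  assert (T1 := re_le_Cmod (m - l)). assert (T2 := Im_le_Cmod (m - l)).
  replace (Re (m - l)) with (Re m - Re l)%R in T1 by reflexivity.
  replace (Im (m - l)) with (Im m - Im l)%R in T2 by reflexivity.
  assert (T3 := Rle_abs (Re m - Re l)).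
  assert (T4 := Rabs_triang (Im m - Im l) (Im l)).
  replace (Im m - Im l + Im l)%R with (Im m) in T4 by ring. split; lra.
Qed.

Definition simple_on (M N : R) (f : C -> C) : Prop :=
  exists f' : C -> C, forall l, sector M N l -> Cder f l (f' l) /\ (f l <> 0 \/ f' l <> 0).

Lemma simple_isolated (M N : R) (f : C -> C) (l : C) : simple_on M N f -> sector M N l ->
  exists e, 0 < e /\ forall m, 0 < Cmod (m - l) < e -> f m <> 0.
Proof.
  intros [f' H] Hl. destruct (H l Hl) as [H1 H2]. now apply (simple_zero_isolated f f').
Qed.

Lemma simple_mero (M N : R) (f : C -> C) (l : C) : simple_on M N f -> sector M N l ->
  meromorphic_at f l /\ meromorphic_at (fun x => / f x) l.
Proof.
  intros [f' H] Hl. destruct (sector_open M N l Hl) as [e [He HS]]. split.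
  - apply (mero_of_holo f l e He). intros m Hm. exists (f' m). now apply H, HS.
  - apply (mero_inv f f' l e He).
    + intros m Hm. now apply H, HS.
    + now apply H.
Qed.

Section Existence.

Variables (Th0 Th1 Thi sigma s2 r : C).
Hypothesis hTh1 : Th1 <> 0.
Hypothesis hsigma : sigma <> 0.
Hypothesis hs2 : s2 <> 0.
Hypothesis hr : r <> 0.
Hypothesis hRe : 0 <= Re sigma < 1.
Hypothesis hnd : nondegenerate Th0 Th1 Thi sigma.

Lemma Copp_neq_0 (x : C) : x <> 0 -> - x <> 0.
Proof. intros H E. apply H. replace x with (- - x) by ring. rewrite E. ring. Qed.

Let bp := b Th0 Th1 sigma.
Let bm := b Th0 Th1 (- sigma).
Let ap := a Th0 Th1 sigma.
Let am := a Th0 Th1 (- sigma).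
Let dp := d Thi sigma.
Let dm := d Thi (- sigma).

(** If [b sigma = 0] then [a sigma = 0], which leaves the imaginary case, and
    [b (- sigma) = - sigma] is nonzero. *)
Lemma nondegenerate_b : bp <> 0 \/
  (Re sigma = 0%R /\ dp * (s2 * bm) <> 0 /\ dm * (s2 * bm) <> 0).
Proof.
  destruct (classic (bp = 0)) as [Z|Z]; [right|now left].
  destruct hnd as [H|[H0 [H1 H2]]].
  - contradiction H. unfold a. fold bp. rewrite Z. ring.
  - assert (Hb : bm <> 0).
    { replace bm with (bp - sigma) by (unfold bp, bm, b; cfield). rewrite Z.
      replace (0 - sigma) with (- sigma) by ring. now apply Copp_neq_0. }
    split; [assumption|]. split; (apply Cmult_neq_0; [assumption|apply Cmult_neq_0; assumption]).
Qed.

(** If [b sigma = 0], then [b (- sigma) = - sigma] and [c (- sigma) = Th1]; if [c sigma = 0], then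
    [b (- sigma) = Th1] and [c (- sigma) = - sigma]. In both cases [a (- sigma)] is nonzero. *)
Lemma nondegenerate_a : ap <> 0 \/
  (Re sigma = 0%R /\ dp * (s2 * am) <> 0 /\ dm * (s2 * am) <> 0).
Proof.
  destruct (classic (ap = 0)) as [Z|Z]; [right|now left].
  destruct hnd as [H|[H0 [H1 H2]]]; [contradiction|].
  assert (Ha : am <> 0).
  { unfold ap, a in Z. fold bp in Z. unfold am, a. fold bm.
    destruct (classic (bp = 0)) as [Zb|Zb].
    - apply Cmult_neq_0.
      + replace bm with (bp - sigma) by (unfold bp, bm, b; cfield). rewrite Zb.
        replace (0 - sigma) with (- sigma) by ring. now apply Copp_neq_0.
      + replace (c Th0 Th1 (- sigma)) with (Th1 - bp) by (unfold bp, b, c; cfield). rewrite Zb.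
        replace (Th1 - 0) with Th1 by ring. assumption.
    - assert (Zc : c Th0 Th1 sigma = 0).
      { replace (c Th0 Th1 sigma) with (bp * c Th0 Th1 sigma / bp) by (field; assumption).
        rewrite Z. field. assumption. }
      apply Cmult_neq_0.
      + replace bm with (Th1 - c Th0 Th1 sigma) by (unfold bm, b, c; cfield). rewrite Zc.
        replace (Th1 - 0) with Th1 by ring. assumption.
      + replace (c Th0 Th1 (- sigma)) with (c Th0 Th1 sigma - sigma) by (unfold c; cfield).
        rewrite Zc. replace (0 - sigma) with (- sigma) by ring. now apply Copp_neq_0. }
  split; [assumption|]. split; (apply Cmult_neq_0; [assumption|apply Cmult_neq_0; assumption]).
Qed.

Variables (M N : R) (V : unknown -> C -> C).
Hypothesis HV : forall l, strip M l -> Re l < N -> hats Thi sigma V l.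
Let lim := hat_limit Th0 Th1 sigma s2.
Hypothesis HB : forall i, bigO (strip M) (hat_weight sigma i + hat_gap sigma) (fun l => V i l - lim i).
Hypothesis Hrel : forall l, strip M l -> Re l < N ->
  forall i, eigen_defect Th0 Th1 Thi sigma V i l = zero_vectors V i l.

Let n0 := fnum Thi sigma (V Q0) (V P0).
Let d0 := fden Thi sigma (V Q0) (V P0).
Let n1 := fnum Thi sigma (V Q1) (V P1).
Let d1 := fden Thi sigma (V Q1) (V P1).

Let HD := strip_left M.
Let L0 : lim Et = 0 /\ lim Mm = 0 := conj eq_refl eq_refl.
Let F := hats_first Thi sigma hRe M (strip M) V N lim HD HV L0 HB.
Let Dl := hats_delta Thi sigma hRe M (strip M) V N lim HD HV L0 HB.

Lemma factors_simple : exists N', N' <= N /\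
  simple_on M N' n0 /\ simple_on M N' d0 /\ simple_on M N' n1 /\ simple_on M N' d1.
Proof.
  assert (B0 := hats_bigO0 sigma hRe (strip M) V lim HB).
  destruct F as [F1 [F2 [F3 F4]]].
  assert (b4 := B0 Q0). assert (b5 := B0 P0). assert (b6 := B0 Q1). assert (b7 := B0 P1).
  assert (e1 := Dl Q0 eq_refl ltac:(discriminate)). assert (e2 := Dl P0 eq_refl ltac:(discriminate)).
  assert (e3 := Dl Q1 eq_refl ltac:(discriminate)). assert (e4 := Dl P1 eq_refl ltac:(discriminate)).
  assert (HT : bigO (strip M) (1 - Re sigma) (fun l => tt l * S12 sigma / (2 * tpow l sigma))).
  { apply (bigO_eq _ _ (fun l => S12 sigma / 2 * tt l / tpow l sigma)); [intros; cfield|bigO_tac]. }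
  set (q0' := fun l => V Et l * V Q0 l + hmu sigma V l * V P0 l).
  set (p0' := fun l => hnu Thi sigma V l * V Q0 l - V Et l * V P0 l).
  set (q1' := fun l => (V Et l + tt l * S11 Thi sigma / 2) * V Q1 l
     + (hmu sigma V l + tt l * S12 sigma / (2 * tpow l sigma)) * V P1 l).
  set (p1' := fun l => (hnu Thi sigma V l + tt l * tpow l sigma * S21 Thi sigma / 2) * V Q1 l
     - (V Et l + tt l * S11 Thi sigma / 2) * V P1 l).
  assert (Bq0 : bigO (strip M) (1 - Re sigma) q0') by (unfold q0'; bigO_tac).
  assert (Bp0 : bigO (strip M) (1 - Re sigma) p0') by (unfold p0'; bigO_tac).
  assert (Bq1 : bigO (strip M) (1 - Re sigma) q1') by (unfold q1'; bigO_tac).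
  assert (Bp1 : bigO (strip M) (1 - Re sigma) p1') by (unfold p1'; bigO_tac).
  assert (Hdl : 0 < 1 - Re sigma) by lra. assert (H0 : 0 <= Re sigma) by lra.
  assert (W : forall k A0 B1 q p q' p',
    bigO (strip M) (1 - Re sigma) (fun l => q l - B1) -> bigO (strip M) (1 - Re sigma) (fun l => p l - A0) ->
    bigO (strip M) (1 - Re sigma) q' -> bigO (strip M) (1 - Re sigma) p' ->
    A0 <> 0 \/ (Re sigma = 0%R /\ k * B1 <> 0) ->
    (forall l, strip M l -> Re l < N -> Cder q l (q' l) /\ Cder p l (p' l)) ->
    exists N', forall N'', N'' <= N' -> N'' <= N -> simple_on M N'' (fk sigma k q p)).
  { intros k A0 B1 q p q' p' h1 h2 h3 h4 h5 h6.
    destruct (fk_simple M sigma k A0 B1 q p q' p' (1 - Re sigma) hsigma H0 Hdl h1 h2 h3 h4 h5)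
      as [N' HN].
    exists N'. intros N'' G1 G2. exists (fk' sigma k q q' p'). intros l [S1 S2]. split.
    - destruct (h6 l S1 ltac:(lra)) as [C1 C2]. now apply f_deriv.
    - apply HN; [exact S1|lra]. }
  assert (C0 : forall l, strip M l -> Re l < N -> Cder (V Q0) l (q0' l) /\ Cder (V P0) l (p0' l)).
  { intros l S1 S2. destruct (hats_deriv Thi sigma V l (HV l S1 S2))
      as [_ [_ [_ [_ [_ [D6 [D7 _]]]]]]]. now split. }
  assert (C1 : forall l, strip M l -> Re l < N -> Cder (V Q1) l (q1' l) /\ Cder (V P1) l (p1' l)).
  { intros l S1 S2. destruct (hats_deriv Thi sigma V l (HV l S1 S2))
      as [_ [_ [_ [_ [_ [_ [_ [D8 D9]]]]]]]]. now split. }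
  destruct (W dm (lim P0) (lim Q0) _ _ _ _ e1 e2 Bq0 Bp0) as [N1 K1]; [|exact C0|].
  { destruct nondegenerate_b as [H|[H1 [H2 H3]]]; [now left|right; now split]. }
  destruct (W dp (lim P0) (lim Q0) _ _ _ _ e1 e2 Bq0 Bp0) as [N2 K2]; [|exact C0|].
  { destruct nondegenerate_b as [H|[H1 [H2 H3]]]; [now left|right; now split]. }
  destruct (W dm (lim P1) (lim Q1) _ _ _ _ e3 e4 Bq1 Bp1) as [N3 K3]; [|exact C1|].
  { destruct nondegenerate_a as [H|[H1 [H2 H3]]]; [now left|right; now split]. }
  destruct (W dp (lim P1) (lim Q1) _ _ _ _ e3 e4 Bq1 Bp1) as [N4 K4]; [|exact C1|].
  { destruct nondegenerate_a as [H|[H1 [H2 H3]]]; [now left|right; now split]. }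
  set (N' := Rmin N (Rmin (Rmin N1 N2) (Rmin N3 N4))).
  assert (G0 : N' <= N) by apply Rmin_l.
  assert (G : N' <= Rmin (Rmin N1 N2) (Rmin N3 N4)) by apply Rmin_r.
  assert (Ga := Rle_trans _ _ _ G (Rmin_l _ _)). assert (Gb := Rle_trans _ _ _ G (Rmin_r _ _)).
  assert (Gc := Rle_trans _ _ _ Ga (Rmin_l _ _)). assert (Gd := Rle_trans _ _ _ Ga (Rmin_r _ _)).
  assert (Ge := Rle_trans _ _ _ Gb (Rmin_l _ _)). assert (Gf := Rle_trans _ _ _ Gb (Rmin_r _ _)).
  exists N'. repeat split; [exact G0|now apply K1|now apply K2|now apply K3|now apply K4].
Qed.

(** [y] is [n1 d0 / (d1 n0)] and [u] is a nonvanishing multiple of [n0 / d0], so these points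
    contain all zeros and poles of [y] and [u]; [z] is holomorphic throughout. *)
Definition sol_P (l : C) : Prop := n0 l = 0 \/ d0 l = 0 \/ n1 l = 0 \/ d1 l = 0.

Let y := sol_y Thi sigma r V.
Let z := sol_z Th0 Thi sigma V.
Let u := sol_u Thi sigma r V.

Lemma sol_is_solution : exists N', N' <= N /\
  is_solution Th0 Th1 Thi (sector M N') sol_P y z u.
Proof.
  destruct factors_simple as [N' [HN' [K1 [K2 [K3 K4]]]]].
  exists N'. split; [assumption|].
  assert (ISO : forall l, sector M N' l -> exists e, 0 < e /\
     forall m, 0 < Cmod (m - l) < e -> ~ sol_P m).
  { intros l Hl.
    destruct (simple_isolated M N' n0 l K1 Hl) as [e1 [E1 I1]].
    destruct (simple_isolated M N' d0 l K2 Hl) as [e2 [E2 I2]].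
    destruct (simple_isolated M N' n1 l K3 Hl) as [e3 [E3 I3]].
    destruct (simple_isolated M N' d1 l K4 Hl) as [e4 [E4 I4]].
    exists (Rmin (Rmin e1 e2) (Rmin e3 e4)). split; [min_pos|].
    intros m [Hm0 Hm].
    assert (Ga := Rlt_le_trans _ _ _ Hm (Rmin_l _ _)). assert (Gb := Rlt_le_trans _ _ _ Hm (Rmin_r _ _)).
    assert (Gc := Rlt_le_trans _ _ _ Ga (Rmin_l _ _)). assert (Gd := Rlt_le_trans _ _ _ Ga (Rmin_r _ _)).
    assert (Ge := Rlt_le_trans _ _ _ Gb (Rmin_l _ _)). assert (Gf := Rlt_le_trans _ _ _ Gb (Rmin_r _ _)).
    intros [H|[H|[H|H]]]; revert H; [apply I1|apply I2|apply I3|apply I4]; now split. }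
  assert (EQ : forall l, sector M N' l -> ~ sol_P l ->
     y l <> 0 /\ u l <> 0 /\
     Cder y l (tt l * y l - 2 * z l * (y l - 1) ^ 2
        - (y l - 1) * ((Th0 - Th1 + Thi) / 2 * y l - (3 * Th0 + Th1 + Thi) / 2)) /\
     Cder z l (y l * z l * (z l + (Th0 - Th1 + Thi) / 2)
        - 1 / y l * (z l + Th0) * (z l + (Th0 + Th1 + Thi) / 2)) /\
     Cder u l (u l * (- 2 * z l - Th0 + y l * (z l + (Th0 - Th1 + Thi) / 2)
               + 1 / y l * (z l + (Th0 + Th1 + Thi) / 2)))).
  { intros l [S1 S2] HP. assert (S3 : Re l < N) by lra.
    apply (sol_equations Th0 Th1 Thi sigma r hsigma hr V l).
    - now apply HV.
    - now apply Hrel.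
    - intros H. apply HP. right; left. exact H.
    - intros H. apply HP. right; right; right. exact H.
    - intros H. apply HP. left. exact H.
    - intros H. apply HP. right; right; left. exact H. }
  split; [exact ISO|]. split.
  - intros l Hl.
    destruct (simple_mero M N' n0 l K1 Hl) as [A1 A2].
    destruct (simple_mero M N' d0 l K2 Hl) as [A3 A4].
    destruct (simple_mero M N' n1 l K3 Hl) as [A5 A6].
    destruct (simple_mero M N' d1 l K4 Hl) as [A7 A8].
    destruct (ISO l Hl) as [e [He I]]. destruct (sector_open M N' l Hl) as [e2 [He2 HS]].
    repeat split.
    + apply (mero_ext (fun x => (n1 x * / d1 x) * (d0 x * / n0 x)) y l e He).
      * intros m Hm. specialize (I m Hm). unfold y, sol_y, sv0, sv1, eigen_ratio. fold n0 d0 n1 d1.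
        assert (n0 m <> 0) by (intros H; apply I; now left).
        assert (d0 m <> 0) by (intros H'; apply I; right; now left).
        assert (d1 m <> 0) by (intros H'; apply I; right; right; now right).
        field. repeat split; assumption.
      * repeat apply mero_mult; assumption.
    + apply (mero_of_holo z l e2 He2). intros m Hm. eexists.
      apply (sol_z_deriv Th0 Thi sigma r hsigma hr V m). 
      destruct (HS m Hm) as [S1 S2]. apply HV; [exact S1|lra].
    + apply (mero_mult (fun x => tpow x Thi) (sv0 Thi sigma r V)).
      * apply (mero_of_holo _ l 1); [lra|]. intros m _. eexists. apply Cder_tpow.
      * apply (mero_mult (fun _ => - r) (fun x => n0 x * / d0 x)).
        -- apply (mero_of_holo _ l 1); [lra|]. intros m _. eexists. apply Cder_const.
        -- now apply mero_mult.
  - intros l Hl HP. destruct (EQ l Hl HP) as [E1 [E2 [E3 [E4 E5]]]].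
    rewrite Cder_is_derive in E3, E4, E5.
    exact (conj E1 (conj E2 (conj E3 (conj E4 E5)))).
Qed.

(** [z] is a linear expression in [Ga / T], [Al] and [Be T]. The limits produce the first term of
    [z_main] exactly, and the second-order term of [Ga], divided by [T], produces the second. *)
Lemma z_expansion (P : C -> Prop) : bigO2 M (fun l => ~ P l)
  (fun l => z l - z_main Th0 Th1 Thi sigma s2 l) (1 - Re sigma) (2 - 3 * Re sigma).
Proof.
  assert (H1s : 1 - sigma <> 0).
  { intros H. assert (H' : Re (1 - sigma) = 0%R) by now rewrite H. unfold Re in *. simpl in H'. lra. }
  apply (bigO2_of_bigO M _ _ _ _ (Rmin (1 - Re sigma) (2 - 3 * Re sigma)) (Rle_refl _)).
  apply (bigO_sub (strip M)); [now intros l [H _]|].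
  assert (e5 := Dl Al eq_refl ltac:(discriminate)). assert (e6 := Dl Be eq_refl ltac:(discriminate)).
  assert (e7 := hats_second Thi sigma hRe M (strip M) V N lim HD HV L0 HB Ga ltac:(simpl; tauto)).
  apply (bigO_eq _ _ (fun l => ((V Ga l - lim Ga - hat_second sigma lim Ga / (1 - sigma) * (tt l / tpow l sigma))
      / tpow l sigma + Thi * (V Al l - lim Al) - dp * dm * (V Be l - lim Be) * tpow l sigma) / sigma)).
  - intros l. unfold z, sol_z, ent11, z_main, hat_second, heta1, S12, dp, dm, lim, hat_limit, d, b, c.
    cbv zeta iota. cfield.
  - bigO_tac.
Qed.

(** As [k1 - k2 = sigma], numerator and denominator differ by a multiple of [T], and this factor
    survives in the difference of the ratios. It raises the order [t / T] of the errors in [p] and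
    [q] to [t]. *)
Lemma ratio_diff (k1 k2 x1 x2 p0 q0 p q T : C) : k1 - k2 = sigma ->
  p + k1 * T * q <> 0 -> p0 + x1 * T <> 0 -> x1 = k1 * q0 -> x2 = k2 * q0 ->
  (p + k2 * T * q) / (p + k1 * T * q) - (p0 + x2 * T) / (p0 + x1 * T)
  = sigma * T * (p * q0 - p0 * q) / ((p + k1 * T * q) * (p0 + x1 * T)).
Proof. intros <- h1 h2 -> ->. field. now split. Qed.

Let Y2 := y_num2 Th0 Th1 Thi sigma s2.
Let E2 := y_den2 Th0 Th1 Thi sigma s2.
Let Y1 := y_num1 Th0 Th1 Thi sigma s2.
Let E1 := y_den1 Th0 Th1 Thi sigma s2.

Lemma dpm : dp - dm = sigma.
Proof. unfold dp, dm, d. cfield. Qed.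

Section Subdomain.

Variable D : C -> Prop.
Hypothesis HDs : forall l, D l -> strip M l.

Lemma factors_close :
  bigO D (1 - Re sigma) (fun l => n0 l - E2 l) /\ bigO D (1 - Re sigma) (fun l => d0 l - Y2 l) /\
  bigO D (1 - Re sigma) (fun l => n1 l - Y1 l) /\ bigO D (1 - Re sigma) (fun l => d1 l - E1 l).
Proof.
  assert (e1 := Dl Q0 eq_refl ltac:(discriminate)). assert (e2 := Dl P0 eq_refl ltac:(discriminate)).
  assert (e3 := Dl Q1 eq_refl ltac:(discriminate)). assert (e4 := Dl P1 eq_refl ltac:(discriminate)).
  repeat split; apply (bigO_sub (strip M) D _ _ HDs).
  - apply (bigO_eq _ _ (fun l => (V P0 l - lim P0) + dm * tpow l sigma * (V Q0 l - lim Q0))).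
    + intros l. unfold n0, fnum, E2, y_den2, lim, hat_limit, dm. cbv zeta iota. ring.
    + bigO_tac.
  - apply (bigO_eq _ _ (fun l => (V P0 l - lim P0) + dp * tpow l sigma * (V Q0 l - lim Q0))).
    + intros l. unfold d0, fden, Y2, y_num2, lim, hat_limit, dp. cbv zeta iota. ring.
    + bigO_tac.
  - apply (bigO_eq _ _ (fun l => (V P1 l - lim P1) + dm * tpow l sigma * (V Q1 l - lim Q1))).
    + intros l. unfold n1, fnum, Y1, y_num1, lim, hat_limit, dm, a. cbv zeta iota. ring.
    + bigO_tac.
  - apply (bigO_eq _ _ (fun l => (V P1 l - lim P1) + dp * tpow l sigma * (V Q1 l - lim Q1))).
    + intros l. unfold d1, fden, E1, y_den1, lim, hat_limit, dp, a. cbv zeta iota. ring.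
    + bigO_tac.
Qed.

Lemma linear_bigO0 (A0 B0 : C) : bigO D 0 (fun l => A0 + B0 * tpow l sigma).
Proof. apply (bigO_sub (strip M) D _ _ HDs). bigO_tac. Qed.

Lemma u_expansion_on : bounded_below D Y2 -> bounded_below D E2 ->
  exists (h : C -> C) (K N' : R), forall l, D l -> Re l < N' ->
    u l = u_main Th0 Th1 Thi sigma s2 r l * (1 + h l) /\ Cmod (h l) <= K * Cmod (tt l).
Proof.
  intros LY LE.
  assert (e1 := Dl Q0 eq_refl ltac:(discriminate)). assert (e2 := Dl P0 eq_refl ltac:(discriminate)).
  destruct factors_close as [_ [c2 _]].
  assert (Ld : bounded_below D d0) by (apply (bounded_below_perturb D (1 - Re sigma) Y2); [lra|assumption|assumption]).
  destruct (bounded_below_neq_0 _ _ Ld) as [N1 H1]. destruct (bounded_below_neq_0 _ _ LY) as [N2 H2].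
  destruct (bounded_below_neq_0 _ _ LE) as [N3 H3].
  assert (B1 : bigO D 1 (fun l => (n0 l / d0 l - E2 l / Y2 l) * (Y2 l * / E2 l))).
  { apply (bigO_mult' D 1 0); [lra| |].
    - apply (bigO_ext D 1 (Rmin N1 N2) (fun l => (sigma * tpow l sigma *
        ((V P0 l - lim P0) * lim Q0 - lim P0 * (V Q0 l - lim Q0))) * (/ d0 l * / Y2 l))).
      + intros l Hl HN. symmetry.
        assert (G1 := H1 l Hl ltac:(lt_min)).
        assert (G2 := H2 l Hl ltac:(lt_min)).
        etransitivity; [apply (ratio_diff dp dm _ _ _ (lim Q0) _ _ _ dpm G1 G2)|].
        * unfold lim, hat_limit, dp. cbv zeta iota. ring.
        * unfold lim, hat_limit, dm. cbv zeta iota. ring.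
        * change (V P0 l + dp * tpow l sigma * V Q0 l) with (d0 l).
          change (b Th0 Th1 sigma + s2 * d Thi sigma * b Th0 Th1 (- sigma) * tpow l sigma)
            with (Y2 l).
          change (b Th0 Th1 sigma) with (lim P0). field. now split.
      + apply (bigO_mult' D 1 0); [lra| |].
        * apply (bigO_sub (strip M) D _ _ HDs). bigO_tac.
        * apply (bigO_mult' D 0 0); [lra|now apply bigO_inv|now apply bigO_inv].
    - apply (bigO_mult' D 0 0); [lra|apply linear_bigO0|now apply bigO_inv]. }
  destruct B1 as [K [N4 B1]].
  exists (fun l => (n0 l / d0 l - E2 l / Y2 l) * (Y2 l * / E2 l)), K,
    (Rmin (Rmin N1 N2) (Rmin N3 N4)).
  intros l Hl HN.
  assert (Ga := Rlt_le_trans _ _ _ HN (Rmin_l _ _)). assert (Gb := Rlt_le_trans _ _ _ HN (Rmin_r _ _)).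
  assert (G1 := H1 l Hl ltac:(lt_min)).
  assert (G2 := H2 l Hl ltac:(lt_min)).
  assert (G3 := H3 l Hl ltac:(lt_min)).
  split.
  - unfold u, sol_u, sv0, eigen_ratio, u_main. fold (n0 l) (d0 l).
    change (fnum Thi sigma (V Q0) (V P0) l) with (n0 l).
    change (fden Thi sigma (V Q0) (V P0) l) with (d0 l).
    change (y_den2 Th0 Th1 Thi sigma s2 l) with (E2 l).
    change (y_num2 Th0 Th1 Thi sigma s2 l) with (Y2 l).
    field. repeat split; assumption.
  - eapply Rle_trans; [apply B1; [assumption|lt_min]|].
    right. f_equal. unfold tt, tpow. rewrite Cmod_Cexp. f_equal. destruct l. simpl. ring.
Qed.

Lemma y_ratio (l : C) : n0 l <> 0 -> d0 l <> 0 -> d1 l <> 0 -> y l = (n1 l / d1 l) * (d0 l / n0 l).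
Proof.
  intros h1 h2 h3. unfold y, sol_y, sv0, sv1, eigen_ratio. fold n0 d0 n1 d1.
  field. repeat split; assumption.
Qed.

Lemma y_expansion_imaginary : Re sigma = 0%R -> (forall l, D l -> ~ sol_P l) ->
  bounded_below D E1 -> bounded_below D E2 -> bigO D 1 (fun l => y l - y_main Th0 Th1 Thi sigma s2 l).
Proof.
  intros H0 HP LE1 LE2. destruct factors_close as [c1 [c2 [c3 c4]]].
  rewrite H0, Rminus_0_r in c1, c2, c3, c4.
  assert (Ld1 : bounded_below D d1) by (apply (bounded_below_perturb D 1 E1); [lra|assumption|assumption]).
  assert (Ln0 : bounded_below D n0) by (apply (bounded_below_perturb D 1 E2); [lra|assumption|assumption]).
  assert (bY1 : bigO D 0 Y1) by apply linear_bigO0. assert (bY2 : bigO D 0 Y2) by apply linear_bigO0.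
  assert (bn1 : bigO D 0 n1) by (apply (bigO_of_diff D 0 1 _ Y1); [lra|assumption|assumption]).
  assert (bd0 : bigO D 0 d0) by (apply (bigO_of_diff D 0 1 _ Y2); [lra|assumption|assumption]).
  assert (X : bigO D 1 (fun l => n1 l * / d1 l - Y1 l * / E1 l)).
  { apply bigO_diff_mult; [lra|assumption|now apply bigO_inv|assumption|].
    apply bigO_diff_inv; [lra|assumption|assumption]. }
  assert (Z : bigO D 1 (fun l => d0 l * / n0 l - Y2 l * / E2 l)).
  { apply bigO_diff_mult; [lra|assumption|now apply bigO_inv|assumption|].
    apply bigO_diff_inv; [lra|assumption|assumption]. }
  assert (W : bigO D 1 (fun l => (n1 l * / d1 l) * (d0 l * / n0 l) - (Y1 l * / E1 l) * (Y2 l * / E2 l))).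
  { apply bigO_diff_mult; [lra| | |exact X|exact Z];
      (apply (bigO_mult' D 0 0); [lra|assumption|now apply bigO_inv]). }
  destruct (bounded_below_neq_0 _ _ LE1) as [N1 H1]. destruct (bounded_below_neq_0 _ _ LE2) as [N2 H2].
  apply (bigO_ext D 1 (Rmin N1 N2) (fun l => ((n1 l * / d1 l) * (d0 l * / n0 l)
     - (Y1 l * / E1 l) * (Y2 l * / E2 l)) - (1 - Th1 - Th0) / (1 - sigma) ^ 2 * tt l)).
  - intros l Hl HN. specialize (HP l Hl).
    assert (G1 := H1 l Hl ltac:(lt_min)).
    assert (G2 := H2 l Hl ltac:(lt_min)).
    rewrite y_ratio.
    + unfold y_main. fold Y1 Y2 E1 E2.
      assert (Q : Y1 l * Y2 l / (E1 l * E2 l) = (Y1 l * / E1 l) * (Y2 l * / E2 l))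
        by (field; now split).
      rewrite Q. unfold Cdiv. ring.
    + intros H. apply HP. now left.
    + intros H. apply HP. right. now left.
    + intros H. apply HP. right. right. now right.
  - apply bigO_minus; [exact W|].
    apply (bigO_sub (strip M) D _ _ HDs). bigO_tac.
Qed.

End Subdomain.

(** Now the denominators tend to nonzero constants. As in [ratio_diff], each of [n1 / d1] and
    [d0 / n0] differs from its leading quotient by [T] times an expression of order [t / T], whose
    coefficient [hats_second] provides; this yields the term in [t]. *)
Lemma y_expansion_positive : 0 < Re sigma ->
  bigO (strip M) (Rmin (1 + Re sigma) (2 - Re sigma)) (fun l => y l - y_main Th0 Th1 Thi sigma s2 l).
Proof.
  intros Hpos.
  assert (Ha : ap <> 0) by (destruct nondegenerate_a as [H|[H _]]; [assumption|lra]).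
  assert (Hb : bp <> 0) by (destruct nondegenerate_b as [H|[H _]]; [assumption|lra]).
  assert (H1s : 1 - sigma <> 0).
  { intros H. assert (H' : Re (1 - sigma) = 0%R) by now rewrite H. unfold Re in *. simpl in H'. lra. }
  assert (LE1 : bounded_below (strip M) E1) by (apply (bounded_below_linear_exp M); assumption).
  assert (LE2 : bounded_below (strip M) E2) by (apply (bounded_below_linear_exp M); assumption).
  assert (LY2 : bounded_below (strip M) Y2) by (apply (bounded_below_linear_exp M); assumption).
  destruct (factors_close (strip M) (fun l H => H)) as [c1 [c2 [c3 c4]]].
  assert (Ld1 : bounded_below (strip M) d1) by (apply (bounded_below_perturb _ (1 - Re sigma) E1); [lra|assumption|assumption]).
  assert (Ln0 : bounded_below (strip M) n0) by (apply (bounded_below_perturb _ (1 - Re sigma) E2); [lra|assumption|assumption]).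
  assert (Ld0 : bounded_below (strip M) d0) by (apply (bounded_below_perturb _ (1 - Re sigma) Y2); [lra|assumption|assumption]).
  assert (sQ0 := hats_second Thi sigma hRe M (strip M) V N lim HD HV L0 HB Q0 ltac:(simpl; tauto)).
  assert (sP0 := hats_second Thi sigma hRe M (strip M) V N lim HD HV L0 HB P0 ltac:(simpl; tauto)).
  assert (sQ1 := hats_second Thi sigma hRe M (strip M) V N lim HD HV L0 HB Q1 ltac:(simpl; tauto)).
  assert (sP1 := hats_second Thi sigma hRe M (strip M) V N lim HD HV L0 HB P1 ltac:(simpl; tauto)).
  assert (B0 := hats_bigO0 sigma hRe (strip M) V lim HB). assert (bq0 := B0 Q0). assert (bq1 := B0 Q1).
  set (w := Rmin (1 + Re sigma) (2 - Re sigma)).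
  destruct (bounded_below_neq_0 _ _ LE1) as [N1 H1]. destruct (bounded_below_neq_0 _ _ LE2) as [N2 H2].
  destruct (bounded_below_neq_0 _ _ Ld1) as [N3 H3]. destruct (bounded_below_neq_0 _ _ Ln0) as [N4 H4].
  destruct (bounded_below_neq_0 _ _ Ld0) as [N5 H5].
  (* [m0] and [m1] are the coefficients of [t / T] in the antisymmetric expressions [p q0 - p0 q] of
     [ratio_diff] for the two eigenvectors. *)
  set (m0 := (hat_second sigma lim P0 * lim Q0 - lim P0 * hat_second sigma lim Q0) / (1 - sigma)).
  set (m1 := (hat_second sigma lim P1 * lim Q1 - lim P1 * hat_second sigma lim Q1) / (1 - sigma)).
  assert (NUM0 : bigO (strip M) w (fun l => sigma * tpow l sigma * (V P0 l * lim Q0 - lim P0 * V Q0 l)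
      - sigma * m0 * tt l)).
  { apply (bigO_eq _ _ (fun l => sigma * tpow l sigma *
      ((V P0 l - lim P0 - hat_second sigma lim P0 / (1 - sigma) * (tt l / tpow l sigma)) * lim Q0
       - lim P0 * (V Q0 l - lim Q0 - hat_second sigma lim Q0 / (1 - sigma) * (tt l / tpow l sigma))))).
    - intros l. unfold m0. cfield.
    - unfold w. bigO_tac. }
  assert (NUM1 : bigO (strip M) w (fun l => sigma * tpow l sigma * (V P1 l * lim Q1 - lim P1 * V Q1 l)
      - sigma * m1 * tt l)).
  { apply (bigO_eq _ _ (fun l => sigma * tpow l sigma *
      ((V P1 l - lim P1 - hat_second sigma lim P1 / (1 - sigma) * (tt l / tpow l sigma)) * lim Q1
       - lim P1 * (V Q1 l - lim Q1 - hat_second sigma lim Q1 / (1 - sigma) * (tt l / tpow l sigma))))).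
    - intros l. unfold m1. cfield.
    - unfold w. bigO_tac. }
  set (v := Rmin (Re sigma) (1 - Re sigma)).
  assert (Hv : 0 < v) by (unfold v; rmin_lra).
  assert (E1a : bigO (strip M) v (fun l => E1 l - ap)).
  { apply (bigO_eq _ _ (fun l => s2 * dp * am * tpow l sigma)); [intros; unfold E1, y_den1, ap, dp, am; ring|].
    unfold v. bigO_tac. }
  assert (E2b : bigO (strip M) v (fun l => E2 l - bp)).
  { apply (bigO_eq _ _ (fun l => s2 * dm * bm * tpow l sigma)); [intros; unfold E2, y_den2, bp, dm, bm; ring|].
    unfold v. bigO_tac. }
  assert (d1a : bigO (strip M) v (fun l => d1 l - ap)).
  { apply (bigO_eq _ _ (fun l => (d1 l - E1 l) + (E1 l - ap))); [intros; ring|].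
    apply bigO_plus; [|assumption]. apply (bigO_weaken _ (1 - Re sigma)); [unfold v; rmin_lra|assumption]. }
  assert (n0b : bigO (strip M) v (fun l => n0 l - bp)).
  { apply (bigO_eq _ _ (fun l => (n0 l - E2 l) + (E2 l - bp))); [intros; ring|].
    apply bigO_plus; [|assumption]. apply (bigO_weaken _ (1 - Re sigma)); [unfold v; rmin_lra|assumption]. }
  assert (BINV : forall (f g : C -> C) (k : C), k <> 0 -> bounded_below (strip M) f -> bounded_below (strip M) g ->
     bigO (strip M) v (fun l => f l - k) -> bigO (strip M) v (fun l => g l - k) ->
     bigO (strip M) v (fun l => / f l * / g l - / k * / k)).
  { intros f g k Hk Lf Lg Df Dg.
    apply (bigO_diff_mult _ v (fun l => / f l) (fun _ => / k) (fun l => / g l) (fun _ => / k)).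
    - lra.
    - now apply bigO_inv.
    - apply bigO_const.
    - apply (bigO_diff_inv _ v f (fun _ => k)); [assumption|exact (bounded_below_const _ k Hk)|assumption].
    - apply (bigO_diff_inv _ v g (fun _ => k)); [assumption|exact (bounded_below_const _ k Hk)|assumption]. }
  assert (QUOT : forall (num f g : C -> C) (k m : C), k <> 0 -> bounded_below (strip M) f -> bounded_below (strip M) g ->
     bigO (strip M) v (fun l => f l - k) -> bigO (strip M) v (fun l => g l - k) ->
     bigO (strip M) w (fun l => num l - sigma * m * tt l) ->
     bigO (strip M) w (fun l => num l * (/ f l * / g l) - sigma * m * (/ k * / k) * tt l)).
  { intros num f g k m Hk Lf Lg Df Dg Hn.
    apply (bigO_eq _ _ (fun l => (num l - sigma * m * tt l) * (/ f l * / g l)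
      + sigma * m * tt l * (/ f l * / g l - / k * / k))); [intros; ring|].
    assert (I1 := BINV f g k Hk Lf Lg Df Dg).
    apply bigO_plus.
    - apply (bigO_mult' _ w 0); [lra|assumption|].
      apply (bigO_mult' _ 0 0); [lra|now apply bigO_inv|now apply bigO_inv].
    - apply (bigO_mult' _ 1 v); [unfold w, v; rmin_lra| |assumption]. bigO_tac. }
  assert (X := QUOT _ _ _ _ m1 Ha Ld1 LE1 d1a E1a NUM1).
  assert (Z := QUOT _ _ _ _ m0 Hb Ln0 LE2 n0b E2b NUM0).
  set (x1 := sigma * m1 * (/ ap * / ap)) in *. set (x0 := sigma * m0 * (/ bp * / bp)) in *.
  (* [x1] comes from [n1 / d1], and [- x0] from [d0 / n0]. Rewriting the identity in [b sigma],
     [c sigma] and [sigma] as independent variables leaves it to [cfield]. *)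
  assert (COEF : x1 - x0 = (1 - Th1 - Th0) / (1 - sigma) ^ 2).
  { assert (Hc : c Th0 Th1 sigma <> 0).
    { intros E. apply Ha. unfold ap, a. rewrite E. ring. }
    unfold x1, x0, m1, m0, hat_second, heta1, hmu1, S12, ap, a. fold bp.
    change (lim Ga) with (bp * c Th0 Th1 sigma / (sigma * s2)).
    change (lim Al) with (sigma / 2 + (bm * c Th0 Th1 sigma + bp * c Th0 Th1 (- sigma)) / (2 * sigma)).
    change (lim Q0) with (s2 * bm). change (lim P0) with bp.
    change (lim Q1) with (s2 * (bm * c Th0 Th1 (- sigma))).
    change (lim P1) with (bp * c Th0 Th1 sigma).
    replace bm with (bp - sigma) by (unfold bp, bm, b; cfield).
    replace (c Th0 Th1 (- sigma)) with (c Th0 Th1 sigma - sigma) by (unfold c; cfield).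
    replace (1 - Th1 - Th0) with (1 + sigma - 2 * bp) by (unfold bp, b; cfield).
    generalize dependent (c Th0 Th1 sigma). intros cc Hc. clearbody bp. cfield. }
  assert (Yone : bigO (strip M) (Re sigma) (fun l => d0 l / n0 l - 1)).
  { apply (bigO_ext _ _ N4 (fun l => (sigma * tpow l sigma * V Q0 l) * / n0 l)).
    - intros l Hl HN. specialize (H4 l Hl HN).
      transitivity ((d0 l - n0 l) / n0 l); [|field; assumption].
      unfold Cdiv. f_equal. transitivity ((dp - dm) * tpow l sigma * V Q0 l); [now rewrite dpm|].
      unfold d0, n0, fden, fnum, dp, dm. ring.
    - apply (bigO_mult' _ (Re sigma) 0); [lra| |now apply bigO_inv]. bigO_tac. }
  assert (Xone : bigO (strip M) (Re sigma) (fun l => Y1 l / E1 l - 1)).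
  { apply (bigO_ext _ _ N1 (fun l => (- sigma * s2 * am * tpow l sigma) * / E1 l)).
    - intros l Hl HN. specialize (H1 l Hl HN).
      transitivity ((Y1 l - E1 l) / E1 l); [|field; assumption].
      unfold Cdiv. f_equal. transitivity (- (dp - dm) * s2 * am * tpow l sigma); [now rewrite dpm|].
      unfold Y1, E1, y_num1, y_den1, dp, dm, am. ring.
    - apply (bigO_mult' _ (Re sigma) 0); [lra| |now apply bigO_inv]. bigO_tac. }
  set (N' := Rmin (Rmin N1 N2) (Rmin N3 (Rmin N4 N5))).
  (* The difference of two products is telescoped. The cofactors [d0 / n0] and [Y1 / E1] are
     [1 + O(t ^ sigma)], so they change the terms [x1 t] and [x0 t] only by [O(t ^ (1 + sigma))]. *)
  apply (bigO_ext _ _ N' (fun l =>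
    (sigma * tpow l sigma * (V P1 l * lim Q1 - lim P1 * V Q1 l) * (/ d1 l * / E1 l) - x1 * tt l)
      * (1 + (d0 l / n0 l - 1)) + x1 * (tt l * (d0 l / n0 l - 1))
    - (1 + (Y1 l / E1 l - 1)) * (sigma * tpow l sigma * (V P0 l * lim Q0 - lim P0 * V Q0 l)
        * (/ n0 l * / E2 l) - x0 * tt l) - x0 * (tt l * (Y1 l / E1 l - 1)))).
  - intros l Hl HN.
    assert (Ga := Rlt_le_trans _ _ _ HN (Rmin_l _ _)). assert (Gb := Rlt_le_trans _ _ _ HN (Rmin_r _ _)).
    assert (G1 := H1 l Hl ltac:(lt_min)).
    assert (G2 := H2 l Hl ltac:(lt_min)).
    assert (G3 := H3 l Hl ltac:(lt_min)).
    assert (Gc := Rlt_le_trans _ _ _ Gb (Rmin_r _ _)).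
    assert (G4 := H4 l Hl ltac:(lt_min)).
    assert (G5 := H5 l Hl ltac:(lt_min)).
    rewrite y_ratio by assumption. unfold y_main. rewrite <- COEF.
    fold Y1 Y2 E1 E2.
    assert (R1 : n1 l / d1 l - Y1 l / E1 l =
      sigma * tpow l sigma * (V P1 l * lim Q1 - lim P1 * V Q1 l) / (d1 l * E1 l)).
    { apply (ratio_diff dp dm _ _ _ (lim Q1) _ _ _ dpm G3 G1).
      - unfold lim, hat_limit, dp, a. cbv zeta iota. ring.
      - unfold lim, hat_limit, dm, a. cbv zeta iota. ring. }
    assert (R0 : d0 l / n0 l - Y2 l / E2 l =
      - sigma * tpow l sigma * (V P0 l * lim Q0 - lim P0 * V Q0 l) / (n0 l * E2 l)).
    { transitivity ((d0 l * E2 l - Y2 l * n0 l) / (n0 l * E2 l)); [field; now split|].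
      unfold Cdiv. f_equal.
      transitivity (- (dp - dm) * tpow l sigma * (V P0 l * lim Q0 - lim P0 * V Q0 l));
        [|now rewrite dpm].
      unfold d0, n0, fden, fnum, E2, Y2, y_den2, y_num2, lim, hat_limit, dp, dm. cbv zeta iota. ring. }
    set (p1 := sigma * tpow l sigma * (V P1 l * lim Q1 - lim P1 * V Q1 l)) in *.
    replace (- sigma * tpow l sigma * (V P0 l * lim Q0 - lim P0 * V Q0 l))
      with (- (sigma * tpow l sigma * (V P0 l * lim Q0 - lim P0 * V Q0 l))) in R0 by ring.
    set (p0 := sigma * tpow l sigma * (V P0 l * lim Q0 - lim P0 * V Q0 l)) in *.
    replace (/ d1 l * / E1 l) with (/ (d1 l * E1 l)) by (field; now split).
    replace (/ n0 l * / E2 l) with (/ (n0 l * E2 l)) by (field; now split).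
    change (p1 * / (d1 l * E1 l)) with (p1 / (d1 l * E1 l)). rewrite <- R1.
    assert (R0' : p0 * / (n0 l * E2 l) = - (d0 l / n0 l - Y2 l / E2 l)).
    { rewrite R0. unfold Cdiv. ring. }
    rewrite R0'.
    assert (Q : Y1 l * Y2 l / (E1 l * E2 l) = (Y1 l / E1 l) * (Y2 l / E2 l)) by (field; now split).
    rewrite Q. ring.
  - assert (U : forall f : C -> C, bigO (strip M) (Re sigma) (fun l => f l - 1) ->
       bigO (strip M) 0 (fun l => 1 + (f l - 1))).
    { intros f Hf. bigO_tac. }
    apply bigO_minus; [apply bigO_minus; [apply bigO_plus|]|].
    + apply (bigO_mult' _ w 0); [lra|exact X|]. now apply (U (fun l => d0 l / n0 l)).
    + apply bigO_scal. apply (bigO_mult' _ 1 (Re sigma)); [unfold w; rmin_lra|apply (bigO_tt M); assumption|assumption].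
    + apply (bigO_mult' _ 0 w); [lra| |exact Z]. now apply (U (fun l => Y1 l / E1 l)).
    + apply bigO_scal. apply (bigO_mult' _ 1 (Re sigma)); [unfold w; rmin_lra|apply (bigO_tt M); assumption|assumption].
Qed.

Lemma away_mult (e : R) (f g : C -> C) (l : C) :
  away e (fun m => f m * g m) l -> away e f l /\ away e g l.
Proof.
  intros H. split; intros m Hm; apply H; rewrite Hm; ring.
Qed.

Lemma bounded_below_away (e : R) (A0 B0 : C) (D : C -> Prop) : 0 < e -> Re sigma = 0%R ->
  A0 <> 0 \/ B0 <> 0 -> (forall l, D l -> strip M l /\ away e (fun m => A0 + B0 * tpow m sigma) l) ->
  bounded_below D (fun l => A0 + B0 * tpow l sigma).
Proof.
  intros He H0 HAB HDa. destruct (away_lower M e sigma A0 B0 He hsigma H0 HAB) as [k [Hk H]].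
  exists k, 0%R. split; [assumption|]. intros l Hl _. destruct (HDa l Hl). now apply H.
Qed.

Lemma linear_coefs :
  (bp <> 0 \/ s2 * dp * bm <> 0) /\ (bp <> 0 \/ s2 * dm * bm <> 0) /\
  (ap <> 0 \/ s2 * dp * am <> 0) /\ (ap <> 0 \/ s2 * dm * am <> 0).
Proof.
  repeat split.
  - destruct nondegenerate_b as [H|[_ [H _]]]; [now left|right].
    now replace (s2 * dp * bm) with (dp * (s2 * bm)) by ring.
  - destruct nondegenerate_b as [H|[_ [_ H]]]; [now left|right].
    now replace (s2 * dm * bm) with (dm * (s2 * bm)) by ring.
  - destruct nondegenerate_a as [H|[_ [H _]]]; [now left|right].
    now replace (s2 * dp * am) with (dp * (s2 * am)) by ring.
  - destruct nondegenerate_a as [H|[_ [_ H]]]; [now left|right].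
    now replace (s2 * dm * am) with (dm * (s2 * am)) by ring.
Qed.

Lemma bounded_below_factor (e : R) (A0 B0 : C) (D : C -> Prop) : 0 < e ->
  A0 <> 0 \/ (Re sigma = 0%R /\ B0 <> 0) ->
  (forall l, D l -> strip M l /\ away e (fun m => A0 + B0 * tpow m sigma) l) ->
  bounded_below D (fun l => A0 + B0 * tpow l sigma).
Proof.
  intros He HAB HDa. destruct (Req_dec (Re sigma) 0) as [H0|H0].
  - apply (bounded_below_away e); try assumption. destruct HAB as [H|[_ H]]; [now left|now right].
  - apply (bounded_below_sub (strip M)); [intros l Hl; now apply HDa|].
    apply (bounded_below_linear_exp M); [assumption|lra|]. destruct HAB as [H|[H _]]; [assumption|contradiction].
Qed.

Lemma sol_has_expansion : has_expansion Th0 Th1 Thi sigma s2 r M sol_P y z u.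
Proof.
  destruct linear_coefs as [k1 [k2 [k3 k4]]].
  assert (ND : forall A0 B0 : C, (A0 <> 0 \/ B0 <> 0) -> (A0 = 0 -> Re sigma = 0%R) ->
     A0 <> 0 \/ (Re sigma = 0%R /\ B0 <> 0)).
  { intros A0 B0 [H|H] HR; [now left|]. destruct (classic (A0 = 0)) as [Z|Z]; [right; auto|now left]. }
  assert (Zb : bp = 0 -> Re sigma = 0%R).
  { intros Z. destruct nondegenerate_b as [H|[H _]]; [contradiction|assumption]. }
  split; [|split].
  - intros e He. destruct (Req_dec (Re sigma) 0) as [H0|H0].
    + apply (bigO2_of_bigO M _ _ _ _ 1); [rewrite H0; rmin_lra|].
      apply y_expansion_imaginary.
      * now intros l [Hl _].
      * assumption.
      * now intros l [_ [HP _]].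
      * apply (bounded_below_away e ap (s2 * dp * am)); try assumption.
        intros l [Hl [_ Ha]]. split; [assumption|]. apply away_mult in Ha. apply Ha.
      * apply (bounded_below_away e bp (s2 * dm * bm)); try assumption.
        intros l [Hl [_ Ha]]. split; [assumption|]. apply away_mult in Ha. apply Ha.
    + apply (bigO2_of_bigO M _ _ _ _ (Rmin (1 + Re sigma) (2 - Re sigma)) (Rle_refl _)).
      apply (bigO_sub (strip M)); [now intros l [Hl _]|]. apply y_expansion_positive. lra.
  - apply z_expansion.
  - intros e He.
    destruct (u_expansion_on (fun l => strip M l /\ away e (fun m => Y2 m * E2 m) l))
      as [h [K [N' H]]].
    + now intros l [Hl _].
    + apply (bounded_below_factor e bp (s2 * dp * bm)); [assumption|now apply ND|].
      intros l [Hl Ha]. split; [assumption|]. apply away_mult in Ha. apply Ha.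
    + apply (bounded_below_factor e bp (s2 * dm * bm)); [assumption|now apply ND|].
      intros l [Hl Ha]. split; [assumption|]. apply away_mult in Ha. apply Ha.
    + exists h, K, N'. intros l [Hl HN] _ Ha. apply H; [|exact HN]. split; assumption.
Qed.

End Existence.

Lemma solution_exists (Th0 Th1 Thi sigma s2 r : C) (M : R) :
  Th1 <> 0 -> sigma <> 0 -> s2 <> 0 -> r <> 0 -> 0 <= Re sigma < 1 ->
  nondegenerate Th0 Th1 Thi sigma ->
  exists (N : R) (P : C -> Prop) (y z u : C -> C),
     is_solution Th0 Th1 Thi (sector M N) P y z u /\
     has_expansion Th0 Th1 Thi sigma s2 r M P y z u.
Proof.
  intros h1 h2 h3 h4 h5 h6.
  destruct (hats_exist Th0 Th1 Thi sigma s2 h5 M 0) as [N [V [_ [HV HB]]]].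
  assert (HV1 : forall l, strip M l -> Re l < N -> hats Thi sigma V l)
    by (intros l H1 H2; apply HV; now split).
  destruct (eigen_defect_vanish Th0 Th1 Thi sigma s2 h2 h3 h5 M N V HV1 HB) as [N1 Hrel].
  set (N2 := Rmin N N1).
  assert (HV2 : forall l, strip M l -> Re l < N2 -> hats Thi sigma V l).
  { intros l H1 H2. apply HV1; [assumption|]. lt_min. }
  assert (Hrel2 : forall l, strip M l -> Re l < N2 ->
     forall i, eigen_defect Th0 Th1 Thi sigma V i l = zero_vectors V i l).
  { intros l H1 H2. apply Hrel; [assumption|]. lt_min. }
  destruct (sol_is_solution Th0 Th1 Thi sigma s2 r h1 h2 h3 h4 h5 h6 M N2 V HV2 HB Hrel2)
    as [N' [_ HS]].
  exists N', (sol_P Thi sigma V), (sol_y Thi sigma r V), (sol_z Th0 Thi sigma V), (sol_u Thi sigma r V).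
  split; [exact HS|].
  now apply (sol_has_expansion Th0 Th1 Thi sigma s2 r h1 h2 h3 h4 h5 h6 M N2 V HV2 HB).
Qed.

(** * Propagation of equality *)

(** For each point in turn, the interval is replaced by the outer quarter on the side opposite to
    the point, whose distance from it is at least a quarter of the length. *)
Lemma avoid_list (L : list R) (x y : R) : x < y ->
  exists x' y' e, x <= x' /\ x' < y' /\ y' <= y /\ 0 < e /\
    forall h v, x' <= h <= y' -> In v L -> e <= Rabs (h - v).
Proof.
  revert x y. induction L as [|v L IH]; intros x y Hxy.
  - exists x, y, 1%R. repeat split; try lra. intros h v _ [].
  - assert (H : exists x1 y1 e1, x <= x1 /\ x1 < y1 /\ y1 <= y /\ 0 < e1 /\
      forall h, x1 <= h <= y1 -> e1 <= Rabs (h - v)).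
    { destruct (Rle_dec v ((x + y) / 2)) as [Hv|Hv].
      - exists (x + 3 * (y - x) / 4)%R, y, ((y - x) / 4)%R. repeat split; try lra.
        intros h Hh. assert (T := Rle_abs (h - v)). lra.
      - exists x, (x + (y - x) / 4)%R, ((y - x) / 4)%R. repeat split; try lra.
        intros h Hh. assert (T := Rle_abs (- (h - v))). rewrite Rabs_Ropp in T. lra. }
    destruct H as [x1 [y1 [e1 [h1 [h2 [h3 [h4 h5]]]]]]].
    destruct (IH x1 y1 h2) as [x2 [y2 [e2 [k1 [k2 [k3 [k4 k5]]]]]]].
    exists x2, y2, (Rmin e1 e2). repeat split; try lra; [now apply Rmin_pos|].
    intros h v' Hh [<-|Hv'].
    + eapply Rle_trans; [apply Rmin_l|]. apply h5. lra.
    + eapply Rle_trans; [apply Rmin_r|]. now apply k5.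
Qed.

(** Nested intervals: the interval chosen at stage [n + 1] misses the list [L n], and the supremum
    of the left ends lies in all of them. *)
Lemma avoid_lists (L : nat -> list R) (x y : R) : x < y ->
  exists h, x <= h <= y /\ forall n, ~ In h (L n).
Proof.
  intros Hxy.
  assert (STEP : forall nI : nat * (R * R), exists J : R * R, fst (snd nI) < snd (snd nI) ->
    fst (snd nI) <= fst J /\ fst J < snd J /\ snd J <= snd (snd nI) /\
    forall h, fst J <= h <= snd J -> ~ In h (L (fst nI))).
  { intros [n [p q]]. simpl. destruct (Rlt_dec p q) as [Hpq|Hpq].
    - destruct (avoid_list (L n) p q Hpq) as [x' [y' [e [h1 [h2 [h3 [h4 h5]]]]]]].
      exists (x', y'). intros _. simpl. repeat split; try assumption.
      intros h Hh Hin. specialize (h5 h h Hh Hin).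
      rewrite Rminus_diag, Rabs_R0 in h5. lra.
    - exists (0%R, 0%R). intros H. contradiction. }
  apply choice in STEP. destruct STEP as [f Hf].
  set (J := fix J (n : nat) : R * R := match n with O => (x, y) | S n => f (n, J n) end).
  assert (HJ : forall n, fst (J n) < snd (J n)).
  { induction n as [|n IH]; [assumption|]. apply (Hf (n, J n) IH). }
  assert (HJ2 : forall n, fst (J n) <= fst (J (S n)) /\ snd (J (S n)) <= snd (J n) /\
     forall h, fst (J (S n)) <= h <= snd (J (S n)) -> ~ In h (L n)).
  { intros n. destruct (Hf (n, J n) (HJ n)) as [h1 [h2 [h3 h4]]]. now repeat split. }
  assert (HJ3 : forall n k, fst (J n) <= fst (J (n + k)%nat) /\ snd (J (n + k)%nat) <= snd (J n)).
  { intros n k. induction k as [|k [IH1 IH2]]; [rewrite Nat.add_0_r; lra|].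
    rewrite Nat.add_succ_r. destruct (HJ2 (n + k)%nat) as [T1 [T2 _]]. lra. }
  assert (HJ4 : forall n m, fst (J n) <= snd (J m)).
  { intros n m. destruct (HJ3 n m) as [T1 _]. destruct (HJ3 m n) as [_ T2].
    rewrite Nat.add_comm in T2. assert (T3 := HJ (n + m)%nat). lra. }
  destruct (completeness (fun v => exists n, v = fst (J n))) as [h [H1 H2]].
  - exists (snd (J 0%nat)). intros v [n ->]. apply HJ4.
  - exists (fst (J 0%nat)). now exists 0%nat.
  - assert (HH : forall n, fst (J n) <= h <= snd (J n)).
    { intros n. split; [apply H1; now exists n|]. apply H2. intros v [m ->]. apply HJ4. }
    exists h. split; [apply (HH 0%nat)|]. intros n. destruct (HJ2 n) as [_ [_ T]]. apply T, HH.
Qed.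

Lemma Cmod_lt_of_box (m l : C) (e : R) : 0 < e ->
  Rabs (Re m - Re l) < e / 2 -> Rabs (Im m - Im l) < e / 2 -> Cmod (m - l) < e.
Proof.
  intros He H1 H2. eapply Rle_lt_trans; [apply Cmod_le_abs|].
  replace (Re (m - l)) with (Re m - Re l)%R by reflexivity.
  replace (Im (m - l)) with (Im m - Im l)%R by reflexivity. lra.
Qed.

Lemma C_ext (m l : C) : Re m = Re l -> Im m = Im l -> m = l.
Proof. destruct m, l. simpl. now intros -> ->. Qed.

(** Compactness: finitely many discs, each meeting [Q] at most in its centre, cover the rectangle,
    so the heights of the centres suffice. *)
Lemma discrete_rect (M N : R) (Q : C -> Prop) (x x' y y' : R) :
  discrete_in (sector M N) Q -> x' < N -> - M < y -> y' < M ->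
  exists L : list R, forall m, x <= Re m <= x' -> y <= Im m <= y' -> Q m -> In (Im m) L.
Proof.
  intros HQ Hx Hy Hy'.
  assert (ISO : forall t : R * (R * unit), exists e : posreal,
     x <= fst t <= x' -> y <= fst (snd t) <= y' ->
     forall m, 0 < Cmod (m - (fst t, fst (snd t))) < e -> ~ Q m).
  { intros [t1 [t2 []]]. simpl.
    destruct (classic (x <= t1 <= x' /\ y <= t2 <= y')) as [[H1 H2]|H].
    - destruct (HQ (t1, t2)) as [e [He H]].
      + split; simpl; [apply Rabs_def1; lra|lra].
      + exists (mkposreal e He). intros _ _. exact H.
    - exists (mkposreal 1 Rlt_0_1). intros H1 H2. exfalso. apply H. now split. }
  apply choice in ISO. destruct ISO as [e He].
  (* Half radii, because closeness in both coordinates controls [Cmod] only up to a factor 2. *)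
  destruct (NNPP _ (compactness_list 2 (x, (y, Datatypes.tt)) (x', (y', Datatypes.tt))
    (fun t => pos_div_2 (e t)))) as [L HL].
  exists (map (fun t : R * (R * unit) => fst (snd t)) L). intros m Hm1 Hm2 Qm.
  destruct (HL (Re m, (Im m, Datatypes.tt))) as [[t1 [t2 []]] [Hin [Hb Hc]]].
  { simpl. auto. }
  simpl in Hb, Hc. destruct Hb as [b1 [b2 _]]. destruct Hc as [c1 [c2 _]].
  apply in_map_iff. exists (t1, (t2, Datatypes.tt)). split; [|assumption]. simpl.
  destruct (classic (m = (t1, t2))) as [->|Hne]; [reflexivity|exfalso].
  apply (He (t1, (t2, Datatypes.tt)) b1 b2 m); [|assumption]. simpl. split.
  - apply Cmod_gt_0. intros E. apply Hne. replace m with (m - (t1, t2) + (t1, t2)) by ring.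
    rewrite E. ring.
  - apply Cmod_lt_of_box; [apply cond_pos|exact c1|exact c2].
Qed.

(** The half strip is cut into countably many compact rectangles of length 1. Stopping at [N - 1]
    keeps the first of them away from the edge of the sector. *)
Lemma avoid_line (M N : R) (Q : C -> Prop) (y y' : R) :
  discrete_in (sector M N) Q -> - M < y -> y < y' -> y' < M ->
  exists h, y <= h <= y' /\ forall m, Im m = h -> Re m < N - 1 -> ~ Q m.
Proof.
  intros HQ Hy Hyy Hy'.
  assert (HL : forall n : nat, exists L : list R, forall m,
    N - 1 - INR (S n) <= Re m <= N - 1 - INR n -> y <= Im m <= y' -> Q m -> In (Im m) L).
  { intros n. apply (discrete_rect M N); try assumption. assert (T := pos_INR n). lra. }
  apply choice in HL. destruct HL as [L HL].
  destruct (avoid_lists L y y' Hyy) as [h [Hh1 Hh2]].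
  exists h. split; [assumption|]. intros m Hm1 Hm2 Qm.
  (* [up] gives the integer strictly above, so the rectangle containing [m] has index [k - 1]. *)
  destruct (archimed (N - 1 - Re m)) as [A1 A2].
  set (k := up (N - 1 - Re m)) in *.
  assert (Hk : (1 <= k)%Z).
  { assert (T : 0 < IZR k) by lra. apply lt_IZR in T. lia. }
  assert (Ek : IZR k = INR (S (Z.to_nat (k - 1)))).
  { rewrite INR_IZR_INZ. f_equal. lia. }
  rewrite Ek in A1, A2.
  apply (Hh2 (Z.to_nat (k - 1))). rewrite <- Hm1. apply HL; [|lra|assumption].
  rewrite S_INR in *. lra.
Qed.

(** Connectedness of the unit interval: near each point, [G] at one place implies [G] at any other,
    so the supremum of the places where [G] holds is 1 and satisfies [G]. *)
Lemma real_induction (G : R -> Prop) : G 0%R ->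
  (forall s, 0 <= s <= 1 -> exists rho, 0 < rho /\ forall s1 s2, 0 <= s1 <= 1 -> 0 <= s2 <= 1 ->
     Rabs (s1 - s) < rho -> Rabs (s2 - s) < rho -> G s1 -> G s2) -> G 1%R.
Proof.
  intros H0 Hloc.
  destruct (completeness (fun s => 0 <= s <= 1 /\ G s)) as [s [H1 H2]].
  - exists 1%R. intros s [Hs _]. lra.
  - exists 0%R. split; [lra|assumption].
  - assert (S0 : 0 <= s) by (apply H1; split; [lra|assumption]).
    assert (S1 : s <= 1) by (apply H2; intros t [Ht _]; lra).
    destruct (Hloc s (conj S0 S1)) as [rho [Hr Hs]].
    assert (E : exists s1, s - rho < s1 /\ 0 <= s1 <= 1 /\ G s1).
    { apply NNPP. intros Hn. assert (s <= s - rho); [|lra]. apply H2. intros t [Ht Gt].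
      destruct (Rle_dec t (s - rho)) as [L|L]; [assumption|]. exfalso. apply Hn. exists t.
      repeat split; try lra. assumption. }
    destruct E as [s1 [E1 [E2 E3]]].
    assert (E4 : s1 <= s) by (apply H1; now split).
    assert (R1 : Rabs (s1 - s) < rho) by (apply Rabs_def1; lra).
    set (s2 := Rmin 1 (s + rho / 2)).
    assert (R2 : s <= s2 <= 1) by (split; [apply Rmin_glb; lra|apply Rmin_l]).
    assert (R3 : s2 <= s + rho / 2) by apply Rmin_r.
    assert (G2 : G s2) by (apply (Hs s1 s2); try lra; try assumption; apply Rabs_def1; lra).
    assert (E5 : s2 <= s) by (apply H1; split; [lra|assumption]).
    assert (E6 : s2 = 1%R).
    { revert E5. unfold s2, Rmin. destruct Rle_dec; intros; lra. }
    now rewrite <- E6.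
Qed.

Lemma segment_bounded (f : C -> C) (l v : C) :
  (forall s, 0 <= s <= 1 -> exists u, Cder f (l + s * v) u) ->
  exists B, forall s, 0 <= s <= 1 -> Cmod (f (l + s * v)) <= B.
Proof.
  intros H.
  destruct (continuity_ab_maj (fun s => Cmod (f (l + s * v))) 0 1 ltac:(lra)) as [Mx [HM _]].
  - intros s Hs e He. destruct (H s Hs) as [u Hu].
    destruct (Cder_cont f _ u Hu e He) as [dl [Hd H1]].
    assert (Pv := Cmod_ge_0 v).
    exists (dl / (1 + Cmod v))%R. split; [apply Rdiv_lt_0_compat; lra|].
    intros t [_ Ht]. simpl in *. unfold Rdist in *. apply Rlt_div_r in Ht; [|lra].
    assert (T : Cmod (l + t * v - (l + s * v)) < dl).
    { replace (l + t * v - (l + s * v)) with (RtoC (t - s) * v) by (rewrite RtoC_minus; ring).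
      rewrite Cmod_mult, Cmod_R. assert (T2 := Rabs_pos (t - s)%R). nra. }
    specialize (H1 _ T). eapply Rle_lt_trans; [|exact H1].
    assert (T1 := Cmod_le_sub (f (l + t * v)) (f (l + s * v))).
    assert (T2 := Cmod_le_sub (f (l + s * v)) (f (l + t * v))).
    rewrite (Cmod_sub_comm (f (l + s * v))) in T2. apply Rabs_le. lra.
  - exists (Cmod (f (l + Mx * v))). exact HM.
Qed.

(** * Uniqueness for the hat system along segments away from [t = 0] *)

Section SegmentUnique.

Variables (Thi sigma : C).

Lemma hats_segment_bounded (V : unknown -> C -> C) (l v : C) :
  (forall s, 0 <= s <= 1 -> hats Thi sigma V (l + s * v)) ->
  exists B, 0 <= B /\ forall s, 0 <= s <= 1 -> forall i, Cmod (V i (l + s * v)) <= B.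
Proof.
  intros H.
  assert (H' : forall L : list unknown, exists B, 0 <= B /\ forall s, 0 <= s <= 1 ->
    forall i, In i L -> Cmod (V i (l + s * v)) <= B).
  { induction L as [|i L [B [HB IH]]].
    - exists 0%R. split; [lra|]. intros s _ i [].
    - destruct (segment_bounded (V i) l v) as [B1 H1].
      { intros s Hs. eexists. apply (H s Hs). }
      exists (Rmax B B1). split; [eapply Rle_trans; [exact HB|apply Rmax_l]|].
      intros s Hs j [<-|Hj].
      + eapply Rle_trans; [now apply H1|apply Rmax_r].
      + eapply Rle_trans; [now apply IH|apply Rmax_l]. }
  destruct (H' (One :: Al :: Be :: Ga :: Et :: Mm :: Q0 :: P0 :: Q1 :: P1 :: nil)) as [B [HB HB2]].
  exists B. split; [assumption|]. intros s Hs i. apply HB2; [assumption|].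
  destruct i; simpl; tauto.
Qed.

Lemma hat_rhs_lip (V W : unknown -> C -> C) (B Rd : R) : 0 <= B ->
  exists K, 0 <= K /\ forall l D, 0 <= D -> Cmod l <= Rd ->
    (forall i, Cmod (V i l) <= B) -> (forall i, Cmod (W i l) <= B) ->
    (forall i, Cmod (V i l - W i l) <= D) ->
    forall i, Cmod (hat_rhs Thi sigma V i l - hat_rhs Thi sigma W i l) <= K * D.
Proof.
  intros HB.
  set (amp := fun q : C * C * unknown * unknown =>
    let '(k, p, j, j') := q in (Cmod k * exp (Cmod p * Rd))%R).
  assert (Pamp : forall q, 0 <= amp q).
  { intros [[[k p] j] j']. apply Rmult_le_pos; [apply Cmod_ge_0|left; apply exp_pos]. }
  assert (H' : forall L : list unknown, exists S0, 0 <= S0 /\ forall i, In i L ->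
     rsum (map amp (hat_terms Thi sigma i)) <= S0).
  { induction L as [|i L [S0 [HS IH]]].
    - exists 0%R. split; [lra|]. intros i [].
    - exists (Rmax S0 (rsum (map amp (hat_terms Thi sigma i)))).
      split; [eapply Rle_trans; [exact HS|apply Rmax_l]|].
      intros j [<-|Hj]; [apply Rmax_r|]. eapply Rle_trans; [now apply IH|apply Rmax_l]. }
  destruct (H' (One :: Al :: Be :: Ga :: Et :: Mm :: Q0 :: P0 :: Q1 :: P1 :: nil)) as [S0 [HS HS2]].
  exists (S0 * (2 * B))%R. split; [apply Rmult_le_pos; lra|].
  intros l D HD Hl HV HW HVW i. unfold hat_rhs, rhs. rewrite csum_map_sub.
  eapply Rle_trans.
  - apply csum_bound with (h := amp) (K := (2 * B * D)%R).
    intros [[[k p] j] j'] _.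
    replace (k * Cexp (p * l) * V j l * V j' l - k * Cexp (p * l) * W j l * W j' l)
      with (k * Cexp (p * l) * ((V j l - W j l) * V j' l + W j l * (V j' l - W j' l))) by ring.
    rewrite !Cmod_mult, Cmod_Cexp. unfold amp.
    assert (E : exp (Re (p * l)) <= exp (Cmod p * Rd)).
    { apply exp_le_compat. eapply Rle_trans; [apply Rle_abs|]. eapply Rle_trans; [apply re_le_Cmod|].
      rewrite Cmod_mult. apply Rmult_le_compat_l; [apply Cmod_ge_0|assumption]. }
    assert (F : Cmod ((V j l - W j l) * V j' l + W j l * (V j' l - W j' l)) <= 2 * B * D).
    { eapply Rle_trans; [apply Cmod_triangle|]. rewrite !Cmod_mult.
      assert (T1 : Cmod (V j l - W j l) * Cmod (V j' l) <= D * B).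
      { apply Rmult_le_compat; try apply Cmod_ge_0; auto. }
      assert (T2 : Cmod (W j l) * Cmod (V j' l - W j' l) <= B * D).
      { apply Rmult_le_compat; try apply Cmod_ge_0; auto. }
      lra. }
    assert (Q1 := exp_pos (Re (p * l))).
    apply Rmult_le_compat; [|apply Cmod_ge_0| |exact F].
    + apply Rmult_le_pos; [apply Cmod_ge_0|lra].
    + apply Rmult_le_compat_l; [apply Cmod_ge_0|exact E].
  - replace (S0 * (2 * B) * D)%R with (S0 * (2 * B * D))%R by ring.
    apply Rmult_le_compat_r; [apply Rmult_le_pos; lra|].
    apply HS2. destruct i; simpl; tauto.
Qed.

(** Away from [t = 0] smallness must come from elsewhere: on a compact segment the right-hand side
    is Lipschitz, and iterated integration gives [2 B (k s) ^ n / n!] with [k = K |v|], which tends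
    to 0. *)
Lemma hats_segment_unique (V W : unknown -> C -> C) (l v : C) :
  (forall s, 0 <= s <= 1 -> hats Thi sigma V (l + s * v)) ->
  (forall s, 0 <= s <= 1 -> hats Thi sigma W (l + s * v)) ->
  (forall i, V i l = W i l) -> forall i, V i (l + v) = W i (l + v).
Proof.
  intros HV HW H0.
  destruct (hats_segment_bounded V l v HV) as [B1 [P1 Q1]].
  destruct (hats_segment_bounded W l v HW) as [B2 [P2 Q2]].
  set (B := Rmax B1 B2).
  assert (HB : 0 <= B) by (eapply Rle_trans; [exact P1|apply Rmax_l]).
  assert (BV : forall s, 0 <= s <= 1 -> forall i, Cmod (V i (l + s * v)) <= B).
  { intros s Hs i. eapply Rle_trans; [now apply Q1|apply Rmax_l]. }
  assert (BW : forall s, 0 <= s <= 1 -> forall i, Cmod (W i (l + s * v)) <= B).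
  { intros s Hs i. eapply Rle_trans; [now apply Q2|apply Rmax_r]. }
  destruct (hat_rhs_lip V W B (Cmod l + Cmod v) HB) as [K [HK LIP]].
  assert (Pv := Cmod_ge_0 v). set (k := (K * Cmod v)%R).
  assert (Hk : 0 <= k) by (apply Rmult_le_pos; assumption).
  assert (Hlv : forall s, 0 <= s <= 1 -> Cmod (l + s * v) <= Cmod l + Cmod v).
  { intros s Hs. eapply Rle_trans; [apply Cmod_triangle|].
    rewrite Cmod_mult, Cmod_R, Rabs_pos_eq by lra. nra. }
  assert (IND : forall n s, 0 <= s <= 1 -> forall i,
    Cmod (V i (l + s * v) - W i (l + s * v)) <= 2 * B * ((k * s) ^ n / INR (Factorial.fact n))).
  { induction n as [|n IH]; intros s Hs i.
    - simpl. eapply Rle_trans; [apply Cmod_triangle_sub|].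
      specialize (BV s Hs i). specialize (BW s Hs i). lra.
    - assert (F0 := INR_fact_lt_0 n). assert (F1 := INR_fact_lt_0 (S n)).
      assert (T := segment_increment_le (fun x => V i x - W i x)
        (fun t => hat_rhs Thi sigma V i (l + t * v) - hat_rhs Thi sigma W i (l + t * v))
        (fun t => (2 * B * k ^ S n / INR (Factorial.fact (S n)) * t ^ S n)%R)
        (fun t => (2 * B * k ^ S n / INR (Factorial.fact (S n)) * (INR (S n) * t ^ n))%R)
        l v 0 s (proj1 Hs)).
      assert (E0 : l + 0%R * v = l) by ring.
      rewrite E0, H0 in T. replace (V i (l + s * v) - W i (l + s * v) - (W i l - W i l))
        with (V i (l + s * v) - W i (l + s * v)) in T by ring.
      eapply Rle_trans; [apply T; clear T|].
      + intros t Ht. apply Cder_minus; [apply (HV t)|apply (HW t)]; lra.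
      + intros t Ht. apply derivable_pt_lim_scal.
        replace (INR (S n) * t ^ n)%R with (INR (S n) * t ^ pred (S n))%R by reflexivity.
        apply derivable_pt_lim_pow.
      + intros t Ht. rewrite Cmod_mult.
        set (D := (2 * B * ((k * t) ^ n / INR (Factorial.fact n)))%R).
        assert (HD : 0 <= D).
        { apply Rmult_le_pos; [lra|]. apply Rmult_le_pos; [apply pow_le; apply Rmult_le_pos; lra|].
          left. now apply Rinv_0_lt_compat. }
        assert (L1 : Cmod (hat_rhs Thi sigma V i (l + t * v) - hat_rhs Thi sigma W i (l + t * v)) <= K * D).
        { apply (LIP (l + t * v) D HD); [apply Hlv; lra|apply BV; lra|apply BW; lra|].
          intros j. apply IH. lra. }
        apply Rle_trans with (K * D * Cmod v)%R; [now apply Rmult_le_compat_r|].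
        right. unfold D. rewrite Rpow_mult_distr.
        replace (Factorial.fact (S n)) with (S n * Factorial.fact n)%nat by reflexivity.
        rewrite mult_INR. simpl pow. unfold k at 2. field.
        split; [lra|]. apply not_0_INR. lia.
      + right. rewrite Rpow_mult_distr. simpl pow. field. lra. }
  intros i. assert (Z : Cmod (V i (l + v) - W i (l + v)) <= 0).
  { apply le_epsilon. intros e He.
    destruct (cv_speed_pow_fact k (e / (1 + 2 * B))%R) as [n Hn]; [apply Rdiv_lt_0_compat; lra|].
    specialize (Hn n (Nat.le_refl n)). unfold Rdist in Hn. rewrite Rminus_0_r in Hn.
    assert (T := IND n 1%R ltac:(lra) i). rewrite Rmult_1_r in T.
    replace (l + 1%R * v) with (l + v) in T by ring.
    assert (T2 := Rle_abs (k ^ n / INR (Factorial.fact n))).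
    assert (T3 : k ^ n / INR (Factorial.fact n) <= e / (1 + 2 * B)) by lra.
    apply Rle_div_r in T3; [|lra].
    assert (T4 : 0 <= k ^ n / INR (Factorial.fact n)).
    { apply Rmult_le_pos; [now apply pow_le|]. left. apply Rinv_0_lt_compat, INR_fact_lt_0. }
    lra. }
  assert (Z2 : V i (l + v) - W i (l + v) = 0).
  { apply Cmod_eq_0. apply Rle_antisym; [assumption|apply Cmod_ge_0]. }
  replace (V i (l + v)) with (V i (l + v) - W i (l + v) + W i (l + v)) by ring. rewrite Z2. ring.
Qed.

End SegmentUnique.

(** * From a solution to the hat variables *)

Section FromSolution.

Variables (Th0 Th1 Thi sigma r : C).
Hypothesis hsigma : sigma <> 0.
Hypothesis hr : r <> 0.

Let dp := d Thi sigma.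
Let dm := d Thi (- sigma).

(** Entries of [G^-1 B G] for the traceless matrix [B = ((p, q), (s, - p))]. *)
Definition inv_al (p q s : C) : C := (- (r * Thi * p) + dp * q - r ^ 2 * dm * s) / (r * sigma).
Definition inv_be (p q s : C) : C := (- (2) * r * p + q - r ^ 2 * s) / (r * sigma).
Definition inv_ga (p q s : C) : C :=
  (2 * r * dp * dm * p - dp ^ 2 * q + r ^ 2 * dm ^ 2 * s) / (r * sigma).

Lemma ent_inverse (p q s : C) :
  ent11 Thi sigma (inv_al p q s) (inv_be p q s) (inv_ga p q s) = p /\
  ent12 Thi sigma r (inv_al p q s) (inv_be p q s) (inv_ga p q s) = q /\
  ent21 Thi sigma r (inv_al p q s) (inv_be p q s) (inv_ga p q s) = s.
Proof.
  unfold ent11, ent12, ent21, inv_al, inv_be, inv_ga, dp, dm, d. repeat split; cfield.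
Qed.

Variables (y z u : C -> C).

Definition w0 (l : C) : C := u l / tpow l Thi.
Definition w1 (l : C) : C := w0 l * y l.
Definition z1 (l : C) : C := - (z l + (Th0 + Th1 + Thi) / 2).

(** [f] is evaluated on the entries of the traceless matrix with eigenvalues [Th / 2, - Th / 2],
    upper left entry [x + Th / 2] and eigenvector [(v, 1)] for [- Th / 2]. The data are [z], [w0]
    for [A0] and [z1], [w1] for [A1]. *)
Definition residue_of (f : C -> C -> C -> C) (Th : C) (x v : C) : C := f (x + Th / 2) (- v * (x + Th)) (x / v).

(** The vector components are set to 0, which solves their homogeneous equations. Thus uniqueness
    for the full system applies to the matrix entries alone. *)
Definition hats_of (i : unknown) (l : C) : C :=
  match i with
  | One => 1
  | Al => residue_of inv_al Th1 (z1 l) (w1 l)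
  | Be => residue_of inv_be Th1 (z1 l) (w1 l) / tpow l sigma
  | Ga => residue_of inv_ga Th1 (z1 l) (w1 l) * tpow l sigma
  | Et => residue_of inv_al Th0 (z l) (w0 l) + residue_of inv_al Th1 (z1 l) (w1 l) - sigma / 2
  | Mm => residue_of inv_be Th0 (z l) (w0 l) + residue_of inv_be Th1 (z1 l) (w1 l)
  | _ => 0
  end.

Lemma residue_of_deriv (f : C -> C -> C -> C) (k1 k2 k3 Th : C) (x v : C -> C) (l x' v' : C) :
  (forall p q s, f p q s = k1 * p + k2 * q + k3 * s) ->
  Cder x l x' -> Cder v l v' -> v l <> 0 ->
  Cder (fun m => residue_of f Th (x m) (v m)) l
    (f x' (- v' * (x l + Th) - v l * x') ((x' * v l - x l * v') / (v l * v l))).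
Proof.
  intros Hf Hx Hv H0.
  apply (Cder_ext (fun m => k1 * (x m + Th / 2) + k2 * (- v m * (x m + Th)) + k3 * (x m / v m))
    _ _ _ 1); [lra|intros; unfold residue_of; now rewrite Hf|].
  rewrite Hf. apply Cder_plus; [apply Cder_plus|]; apply Cder_scal.
  - eapply Cder_val; [apply Cder_plus; [exact Hx|apply Cder_const]|]. ring.
  - eapply Cder_val.
    + apply (Cder_mult (fun m => - v m) (fun m => x m + Th)); [apply Cder_opp; exact Hv|].
      apply Cder_plus; [exact Hx|apply Cder_const].
    + ring.
  - now apply Cder_div.
Qed.

Lemma inv_al_lin (p q s : C) : inv_al p q s = (- Thi / sigma) * p + dp / (r * sigma) * q
  + (- r * dm / sigma) * s.
Proof. unfold inv_al. cfield. Qed.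

Lemma inv_be_lin (p q s : C) : inv_be p q s = (- (2) / sigma) * p + / (r * sigma) * q + (- r / sigma) * s.
Proof. unfold inv_be. cfield. Qed.

Lemma inv_ga_lin (p q s : C) : inv_ga p q s = (2 * dp * dm / sigma) * p + (- dp ^ 2 / (r * sigma)) * q
  + (r * dm ^ 2 / sigma) * s.
Proof. unfold inv_ga. cfield. Qed.

Variable l : C.
Hypothesis Hy : y l <> 0.
Hypothesis Hu : u l <> 0.
Hypothesis Dy : Cder y l (tt l * y l - 2 * z l * (y l - 1) ^ 2
        - (y l - 1) * ((Th0 - Th1 + Thi) / 2 * y l - (3 * Th0 + Th1 + Thi) / 2)).
Hypothesis Dz : Cder z l (y l * z l * (z l + (Th0 - Th1 + Thi) / 2)
        - 1 / y l * (z l + Th0) * (z l + (Th0 + Th1 + Thi) / 2)).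
Hypothesis Du : Cder u l (u l * (- 2 * z l - Th0 + y l * (z l + (Th0 - Th1 + Thi) / 2)
               + 1 / y l * (z l + (Th0 + Th1 + Thi) / 2))).

Lemma w_neq_0 : w0 l <> 0 /\ w1 l <> 0.
Proof.
  assert (H : w0 l <> 0).
  { apply Cmult_neq_0; [assumption|]. apply Cinv_neq_0, tpow_neq_0. }
  split; [assumption|]. now apply Cmult_neq_0.
Qed.

Lemma hats_of_hats : hats Thi sigma hats_of l.
Proof.
  destruct w_neq_0 as [H0 H1].
  assert (HT := tpow_neq_0 l sigma).
  set (rhs0 := - 2 * z l - Th0 + y l * (z l + (Th0 - Th1 + Thi) / 2)
               + 1 / y l * (z l + (Th0 + Th1 + Thi) / 2)) in *.
  set (dy := tt l * y l - 2 * z l * (y l - 1) ^ 2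
        - (y l - 1) * ((Th0 - Th1 + Thi) / 2 * y l - (3 * Th0 + Th1 + Thi) / 2)) in *.
  set (dz := y l * z l * (z l + (Th0 - Th1 + Thi) / 2)
        - 1 / y l * (z l + Th0) * (z l + (Th0 + Th1 + Thi) / 2)) in *.
  assert (D0 : Cder w0 l (w0 l * (rhs0 - Thi))).
  { eapply Cder_val; [apply (Cder_div u (fun x => tpow x Thi));
      [exact Du|apply Cder_tpow|apply tpow_neq_0]|]. unfold w0. cfield. }
  assert (D1 : Cder w1 l (w0 l * (rhs0 - Thi) * y l + w0 l * dy)) by now apply Cder_mult.
  assert (Dz1 : Cder z1 l (- dz)).
  { apply Cder_opp. eapply Cder_val; [apply Cder_plus; [exact Dz|apply Cder_const]|]. ring. }
  assert (A0 := residue_of_deriv inv_al _ _ _ Th0 z w0 l _ _ inv_al_lin Dz D0 H0).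
  assert (A1 := residue_of_deriv inv_al _ _ _ Th1 z1 w1 l _ _ inv_al_lin Dz1 D1 H1).
  assert (B0 := residue_of_deriv inv_be _ _ _ Th0 z w0 l _ _ inv_be_lin Dz D0 H0).
  assert (B1 := residue_of_deriv inv_be _ _ _ Th1 z1 w1 l _ _ inv_be_lin Dz1 D1 H1).
  assert (G1 := residue_of_deriv inv_ga _ _ _ Th1 z1 w1 l _ _ inv_ga_lin Dz1 D1 H1).
  split; [reflexivity|].
  destruct (hat_rhs_eqs Thi sigma hats_of l eq_refl) as [E0 [E1 [E2 [E3 [E4 [E5 [E6 [E7 [E8 E9]]]]]]]]].
  assert (Ew : w1 l = w0 l * y l) by reflexivity.
  intros i. destruct i.
  - rewrite E0. exact (Cder_const 1 l).
  - rewrite E3. eapply Cder_val; [exact A1|].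
    unfold hats_of, residue_of, inv_al, inv_be, inv_ga, z1, S11, S12, S21, dz, dy, rhs0, dp, dm, d.
    rewrite Ew. cfield.
  - rewrite E4. eapply Cder_val.
    { apply (Cder_div (fun m => residue_of inv_be Th1 (z1 m) (w1 m)) (fun m => tpow m sigma));
        [exact B1|apply Cder_tpow|exact HT]. }
    unfold hats_of, residue_of, inv_al, inv_be, inv_ga, z1, S11, S12, S21, dz, dy, rhs0, dp, dm, d.
    rewrite Ew. cfield.
  - rewrite E5. eapply Cder_val.
    { apply (Cder_mult (fun m => residue_of inv_ga Th1 (z1 m) (w1 m)) (fun m => tpow m sigma));
        [exact G1|apply Cder_tpow]. }
    unfold hats_of, residue_of, inv_al, inv_be, inv_ga, z1, S11, S12, S21, dz, dy, rhs0, dp, dm, d.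
    rewrite Ew. cfield.
  - rewrite E1. eapply Cder_val.
    { apply (Cder_minus (fun m => residue_of inv_al Th0 (z m) (w0 m) + residue_of inv_al Th1 (z1 m) (w1 m))
        (fun _ => sigma / 2)); [|apply Cder_const].
      apply (Cder_plus (fun m => residue_of inv_al Th0 (z m) (w0 m))); [exact A0|exact A1]. }
    unfold hats_of, residue_of, inv_al, inv_be, inv_ga, z1, S11, S12, S21, dz, dy, rhs0, dp, dm, d.
    rewrite Ew. cfield.
  - rewrite E2. eapply Cder_val.
    { apply (Cder_plus (fun m => residue_of inv_be Th0 (z m) (w0 m))); [exact B0|exact B1]. }
    unfold hats_of, residue_of, inv_al, inv_be, inv_ga, z1, S11, S12, S21, dz, dy, rhs0, dp, dm, d.
    rewrite Ew. cfield.
  - rewrite E6. eapply Cder_val; [exact (Cder_const 0 l)|]. simpl. ring.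
  - rewrite E7. eapply Cder_val; [exact (Cder_const 0 l)|]. simpl. ring.
  - rewrite E8. eapply Cder_val; [exact (Cder_const 0 l)|]. simpl. ring.
  - rewrite E9. eapply Cder_val; [exact (Cder_const 0 l)|]. simpl. ring.
Qed.

End FromSolution.

(** * Limits of the hat variables of a solution on a line *)

Lemma Cmult_cancel_l (k x y : C) : k <> 0 -> k * x = k * y -> x = y.
Proof.
  intros Hk H. replace x with (/ k * (k * x)) by (field; assumption). rewrite H. field. assumption.
Qed.

Lemma Cplus_cancel_r (x y k : C) : x + k = y + k -> x = y.
Proof. intros H. replace x with (x + k - k) by ring. rewrite H. ring. Qed.

Section Recover.

Variables (Th0 Th1 Thi sigma r : C).
Hypothesis hTh0 : Th0 <> 0.
Hypothesis hTh1 : Th1 <> 0.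
Hypothesis hsigma : sigma <> 0.
Hypothesis hr : r <> 0.

(** The diagonal entry gives [x]. Then [v] is read from the lower left entry [x / v], or, when
    [x = 0], from the upper right entry, which is then [- v Th]. *)
Lemma residue_inj (Th x v x' v' : C) : Th <> 0 -> v <> 0 -> v' <> 0 ->
  x + Th / 2 = x' + Th / 2 -> - v * (x + Th) = - v' * (x' + Th) -> x / v = x' / v' ->
  x = x' /\ v = v'.
Proof.
  intros HT Hv Hv' E1 E2 E3.
  assert (Ex : x = x').
  { replace x with (x + Th / 2 - Th / 2) by ring. rewrite E1. ring. }
  subst x'. split; [reflexivity|].
  destruct (classic (x = 0)) as [->|Hx].
  - apply (Cmult_cancel_l (- Th)); [now apply Copp_neq_0|].
    replace (- Th * v) with (- v * (0 + Th)) by ring. rewrite E2. ring.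
  - apply (Cmult_cancel_l (x / v)); [apply Cmult_neq_0; [assumption|now apply Cinv_neq_0]|].
    rewrite E3 at 2. field. now split.
Qed.

Let ta := inv_al Thi sigma r.
Let tb := inv_be sigma r.
Let tg := inv_ga Thi sigma r.

Lemma residue_of_inj (Th x v x' v' : C) : Th <> 0 -> v <> 0 -> v' <> 0 ->
  residue_of ta Th x v = residue_of ta Th x' v' -> residue_of tb Th x v = residue_of tb Th x' v' ->
  residue_of tg Th x v = residue_of tg Th x' v' -> x = x' /\ v = v'.
Proof.
  intros HT Hv Hv' E1 E2 E3. unfold residue_of in E1, E2, E3.
  destruct (ent_inverse Thi sigma r hsigma hr (x + Th / 2) (- v * (x + Th)) (x / v)) as [A1 [A2 A3]].
  destruct (ent_inverse Thi sigma r hsigma hr (x' + Th / 2) (- v' * (x' + Th)) (x' / v')) as [B1 [B2 B3]].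
  fold ta tb tg in A1, A2, A3, B1, B2, B3. rewrite E1, E2, E3 in A1, A2, A3.
  apply (residue_inj Th x v x' v'); try assumption; congruence.
Qed.

(** For [A0] the hat variables supply only two entries; the third follows from the upper left entry
    in the original basis, which is known once [x] is. *)
Lemma residue_of_inj_diag (Th x v v' : C) : Th <> 0 -> v <> 0 -> v' <> 0 ->
  residue_of ta Th x v = residue_of ta Th x v' -> residue_of tb Th x v = residue_of tb Th x v' -> v = v'.
Proof.
  intros HT Hv Hv' E1 E2.
  apply (residue_of_inj Th x v x v'); try assumption.
  unfold residue_of in *.
  destruct (ent_inverse Thi sigma r hsigma hr (x + Th / 2) (- v * (x + Th)) (x / v)) as [A1 _].
  destruct (ent_inverse Thi sigma r hsigma hr (x + Th / 2) (- v' * (x + Th)) (x / v')) as [B1 _].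
  assert (S : forall g a0 b0 p, ent11 Thi sigma a0 b0 g = p ->
     g = - sigma * p - (a0 * Thi - d Thi sigma * d Thi (- sigma) * b0)).
  { intros g a0 b0 p <-. unfold ent11. cfield. }
  apply S in A1. apply S in B1. fold ta tb tg in A1, B1. rewrite A1, B1, E1, E2. reflexivity.
Qed.

Lemma hats_recover (y z u y' z' u' : C -> C) (l : C) :
  y l <> 0 -> u l <> 0 -> y' l <> 0 -> u' l <> 0 ->
  (forall i, hats_of Th0 Th1 Thi sigma r y z u i l = hats_of Th0 Th1 Thi sigma r y' z' u' i l) ->
  y l = y' l /\ z l = z' l /\ u l = u' l.
Proof.
  intros Hy Hu Hy' Hu' H.
  destruct (w_neq_0 Thi y u l Hy Hu) as [W0 W1].
  destruct (w_neq_0 Thi y' u' l Hy' Hu') as [W0' W1'].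
  assert (HT := tpow_neq_0 l sigma).
  assert (E1 := H Al). assert (E2 := H Be). assert (E3 := H Ga). assert (E4 := H Et).
  assert (E5 := H Mm). simpl in E1, E2, E3, E4, E5.
  assert (E2' : residue_of tb Th1 (z1 Th0 Th1 Thi z l) (w1 Thi y u l)
     = residue_of tb Th1 (z1 Th0 Th1 Thi z' l) (w1 Thi y' u' l)).
  { apply (Cmult_cancel_l (/ tpow l sigma)); [now apply Cinv_neq_0|].
    rewrite Cmult_comm, (Cmult_comm (/ tpow l sigma)). exact E2. }
  assert (E3' : residue_of tg Th1 (z1 Th0 Th1 Thi z l) (w1 Thi y u l)
     = residue_of tg Th1 (z1 Th0 Th1 Thi z' l) (w1 Thi y' u' l)).
  { apply (Cmult_cancel_l (tpow l sigma)); [assumption|].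
    rewrite Cmult_comm, (Cmult_comm (tpow l sigma)). exact E3. }
  destruct (residue_of_inj Th1 _ _ _ _ hTh1 W1 W1' E1 E2' E3') as [Ez Ew].
  assert (Ezz : z l = z' l).
  { unfold z1 in Ez. replace (z l) with (- (- (z l + (Th0 + Th1 + Thi) / 2)) - (Th0 + Th1 + Thi) / 2)
      by ring. rewrite Ez. ring. }
  assert (E4' : residue_of ta Th0 (z l) (w0 Thi u l) = residue_of ta Th0 (z l) (w0 Thi u' l)).
  { fold ta in E4, E1. rewrite E1 in E4. unfold Cminus in E4. apply Cplus_cancel_r in E4.
    apply Cplus_cancel_r in E4. now rewrite <- Ezz in E4. }
  assert (E5' : residue_of tb Th0 (z l) (w0 Thi u l) = residue_of tb Th0 (z l) (w0 Thi u' l)).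
  { fold tb in E5. rewrite E2' in E5. apply Cplus_cancel_r in E5. now rewrite <- Ezz in E5. }
  assert (Ew0 := residue_of_inj_diag Th0 _ _ _ hTh0 W0 W0' E4' E5').
  split; [|split; [assumption|]].
  - unfold w1 in Ew. rewrite Ew0 in Ew. now apply (Cmult_cancel_l (w0 Thi u' l)).
  - unfold w0 in Ew0. apply (Cmult_cancel_l (/ tpow l Thi)).
    + apply Cinv_neq_0, tpow_neq_0.
    + rewrite Cmult_comm, (Cmult_comm (/ tpow l Thi)). exact Ew0.
Qed.

End Recover.

Definition approx (D : C -> Prop) (x : R) (f f' : C -> C) : Prop :=
  bigO D 0 f' /\ bigO D x (fun l => f l - f' l).

Section Close.

Variables (D : C -> Prop) (x : R).
Hypothesis Hx : 0 < x.

Lemma approx_const (k : C) : approx D x (fun _ => k) (fun _ => k).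
Proof. split; [apply bigO_const|]. apply bigO_zero. intros. ring. Qed.

Lemma approx_refl (f : C -> C) : bigO D 0 f -> approx D x f f.
Proof. intros H. split; [assumption|]. apply bigO_zero. intros. ring. Qed.

Lemma approx_plus (f f' g g' : C -> C) : approx D x f f' -> approx D x g g' ->
  approx D x (fun l => f l + g l) (fun l => f' l + g' l).
Proof.
  intros [F1 F2] [G1 G2]. split; [now apply bigO_plus|].
  apply (bigO_eq D x (fun l => (f l - f' l) + (g l - g' l))); [intros; ring|now apply bigO_plus].
Qed.

Lemma approx_mult (f f' g g' : C -> C) : approx D x f f' -> approx D x g g' ->
  approx D x (fun l => f l * g l) (fun l => f' l * g' l).
Proof.
  intros [F1 F2] [G1 G2]. split; [apply (bigO_mult' D 0 0); try assumption; lra|].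
  apply bigO_diff_mult; try assumption; [lra|]. apply (bigO_of_diff D 0 x f f'); [lra|assumption..].
Qed.

Lemma approx_inv (f f' : C -> C) : bounded_below D f' -> approx D x f f' ->
  approx D x (fun l => / f l) (fun l => / f' l).
Proof. intros L [F1 F2]. split; [now apply bigO_inv|now apply bigO_diff_inv]. Qed.

Lemma approx_ext (N : R) (f f' g g' : C -> C) :
  (forall l, D l -> Re l < N -> g l = f l /\ g' l = f' l) -> approx D x f f' -> approx D x g g'.
Proof.
  intros E [F1 F2]. split.
  - apply (bigO_ext D 0 N f'); [|assumption]. intros l H1 H2. symmetry. now apply E.
  - apply (bigO_ext D x N (fun l => f l - f' l)); [|assumption]. intros l H1 H2.
    destruct (E l H1 H2) as [-> ->]. reflexivity.
Qed.

End Close.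

Section Residue.

Variables (Thi sigma r : C) (M : R) (D : C -> Prop).
Hypothesis hsigma : sigma <> 0.
Hypothesis hr : r <> 0.
Hypothesis hRe : 0 <= Re sigma < 1.
Hypothesis HD : left_strip M D.
Variables (Th : C) (x v xm vm : C -> C).
Hypothesis Lvm : bounded_below D vm.
Hypothesis Bvm : bigO D 0 vm.
Hypothesis BX : bigO D 0 (fun l => (vm l + r) / tpow l sigma).
Hypothesis BZ : bigO D 0 (fun l => tpow l sigma * xm l).
Hypothesis Hv : bigO D 1 (fun l => v l - vm l).
Hypothesis Hx : bigO D (1 - 2 * Re sigma) (fun l => x l - xm l).

Let dp := d Thi sigma.
Let dm := d Thi (- sigma).
Let ta := inv_al Thi sigma r.
Let tb := inv_be sigma r.
Let tg := inv_ga Thi sigma r.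

(* In terms of [(v + r) / T], [T x] and [v], which are known up to [O(t / T)], the rescaled entries
   have no negative powers of [T = t ^ sigma]. *)
Lemma residue_of_close :
  approx D (1 - Re sigma) (fun l => residue_of ta Th (x l) (v l)) (fun l => residue_of ta Th (xm l) (vm l)) /\
  approx D (1 - Re sigma) (fun l => residue_of tb Th (x l) (v l) / tpow l sigma)
    (fun l => residue_of tb Th (xm l) (vm l) / tpow l sigma) /\
  approx D (1 - Re sigma) (fun l => residue_of tg Th (x l) (v l) * tpow l sigma)
    (fun l => residue_of tg Th (xm l) (vm l) * tpow l sigma).
Proof.
  assert (Hdl : 0 < 1 - Re sigma) by lra.
  assert (cX : approx D (1 - Re sigma) (fun l => (v l + r) / tpow l sigma)
     (fun l => (vm l + r) / tpow l sigma)).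
  { split; [assumption|]. apply (bigO_eq D _ (fun l => (v l - vm l) / tpow l sigma)).
    - intros l. cfield.
    - bigO_tac. }
  assert (cZ : approx D (1 - Re sigma) (fun l => tpow l sigma * x l) (fun l => tpow l sigma * xm l)).
  { split; [assumption|]. apply (bigO_eq D _ (fun l => tpow l sigma * (x l - xm l))).
    - intros l. ring.
    - bigO_tac. }
  assert (cv : approx D (1 - Re sigma) v vm).
  { split; [assumption|]. apply (bigO_weaken D 1); [lra|assumption]. }
  assert (civ := approx_inv D _ Hdl v vm Lvm cv).
  assert (cT : approx D (1 - Re sigma) (fun l => tpow l sigma) (fun l => tpow l sigma)).
  { apply approx_refl. apply (bigO_weaken D (Re sigma)); [lra|]. now apply (bigO_tpow M). }
  assert (Lv : bounded_below D v) by (apply (bounded_below_perturb D 1 vm); [lra|assumption|assumption]).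
  destruct (bounded_below_neq_0 _ _ Lv) as [N1 H1]. destruct (bounded_below_neq_0 _ _ Lvm) as [N2 H2].
  set (X := fun (w : C -> C) l => (w l + r) / tpow l sigma) in *.
  set (Z := fun (w : C -> C) l => tpow l sigma * w l) in *.
  set (N := Rmin N1 N2).
  assert (NZ : forall l, D l -> Re l < N -> v l <> 0 /\ vm l <> 0).
  { intros l Hl HN. split.
    - apply H1; [assumption|lt_min].
    - apply H2; [assumption|lt_min]. }
  set (k := - / (r * sigma)).
  assert (cdv : approx D (1 - Re sigma) (fun l => dp * v l + r * dm) (fun l => dp * vm l + r * dm)).
  { apply approx_plus; [apply approx_mult; [lra|apply approx_const|assumption]|apply approx_const]. }
  split; [|split].
  - apply (approx_ext D _ N (fun l => k * ((Z x l * / v l) * ((dp * v l + r * dm) * X v l)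
       + Th * (r * Thi / 2 + dp * v l)))
       (fun l => k * ((Z xm l * / vm l) * ((dp * vm l + r * dm) * X vm l)
       + Th * (r * Thi / 2 + dp * vm l)))).
    + intros l Hl HN. destruct (NZ l Hl HN) as [V1 V2].
      split; unfold k, Z, X, residue_of, ta, inv_al, dp, dm, d; cfield.
    + repeat first [exact cX | exact cZ | exact cv | exact civ | exact cdv | apply approx_const
        | apply approx_plus | apply approx_mult; [lra| |]].
  - apply (approx_ext D _ N (fun l => k * ((Z x l * / v l) * (X v l * X v l) + Th * X v l))
       (fun l => k * ((Z xm l * / vm l) * (X vm l * X vm l) + Th * X vm l))).
    + intros l Hl HN. destruct (NZ l Hl HN) as [V1 V2].
      split; unfold k, Z, X, residue_of, tb, inv_be; cfield.
    + repeat first [exact cX | exact cZ | exact cv | exact civ | exact cdv | apply approx_const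
        | apply approx_plus | apply approx_mult; [lra| |]].
  - apply (approx_ext D _ N (fun l => - k * ((Z x l * / v l) * ((dp * v l + r * dm) * (dp * v l + r * dm))
         + tpow l sigma * (Th * (r * dp * dm + v l * (dp * dp)))))
       (fun l => - k * ((Z xm l * / vm l) * ((dp * vm l + r * dm) * (dp * vm l + r * dm))
         + tpow l sigma * (Th * (r * dp * dm + vm l * (dp * dp)))))).
    + intros l Hl HN. destruct (NZ l Hl HN) as [V1 V2].
      split; unfold k, Z, X, residue_of, tg, inv_ga, dp, dm, d; cfield.
    + repeat first [exact cX | exact cZ | exact cv | exact civ | exact cdv | exact cT
        | apply approx_const | apply approx_plus | apply approx_mult; [lra| |]].
Qed.

End Residue.

(** * Exact identities between the leading terms and the limits *)

Section MainTerms.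

Variables (bp cp dp sigma s2 r T : C).
Hypothesis hsigma : sigma <> 0.
Hypothesis hr : r <> 0.
Hypothesis hs2 : s2 <> 0.
Hypothesis hT : T <> 0.

Let bm := bp - sigma.
Let cm := cp - sigma.
Let dm := dp - sigma.
Let th0 := bp - cp.
Let th1 := bp + cp - sigma.
Let thi := 2 * dp - sigma.
Let x0 := (cp + s2 * dp * cm * T) * (bp + s2 * dm * bm * T) / (sigma ^ 2 * s2 * T).
Let v0 := - r * ((bp + s2 * dm * bm * T) / (bp + s2 * dp * bm * T)).
Let x1 := - (x0 + (th0 + th1 + thi) / 2).
Let v1 := - r * ((bp * cp + s2 * dm * (bm * cm) * T) / (bp * cp + s2 * dp * (bm * cm) * T)).

Lemma thi_dp : (thi + sigma) / 2 = dp /\ (thi + - sigma) / 2 = dm.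
Proof. unfold thi, dm. split; cfield. Qed.

Hypothesis h1 : bp + s2 * dp * bm * T <> 0.
Hypothesis h2 : bp + s2 * dm * bm * T <> 0.
Hypothesis h3 : bp * cp + s2 * dp * (bm * cm) * T <> 0.
Hypothesis h4 : bp * cp + s2 * dm * (bm * cm) * T <> 0.

Ltac nz := first [assumption
  | let E := fresh in intro E; first
    [ apply h1; rewrite <- E; unfold bm, cm, dm; ring
    | apply h2; rewrite <- E; unfold bm, cm, dm; ring
    | apply h3; rewrite <- E; unfold bm, cm, dm; ring
    | apply h4; rewrite <- E; unfold bm, cm, dm; ring ] ].

(** The matrices built from the leading terms have the limits as their rescaled entries exactly, for
    every [T]: all powers of [T] cancel. So closeness to the leading terms already determines the
    limits. *)
Lemma main_residue0 :
  residue_of (inv_al thi sigma r) th0 x0 v0 = - (bm * cp + bp * cm) / (2 * sigma) /\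
  residue_of (inv_be sigma r) th0 x0 v0 / T = s2 * bm * cm / sigma.
Proof.
  destruct thi_dp as [E1 E2].
  unfold residue_of, inv_al, inv_be, d. rewrite E1, E2.
  split; unfold x0, v0, th0, thi, bm, cm, dm; field; repeat split; nz.
Qed.

Lemma main_residue1 :
  residue_of (inv_al thi sigma r) th1 x1 v1 = sigma / 2 + (bm * cp + bp * cm) / (2 * sigma) /\
  residue_of (inv_be sigma r) th1 x1 v1 / T = - (s2 * bm * cm / sigma) /\
  residue_of (inv_ga thi sigma r) th1 x1 v1 * T = bp * cp / (sigma * s2).
Proof.
  destruct thi_dp as [E1 E2].
  unfold residue_of, inv_al, inv_be, inv_ga, d. rewrite E1, E2.
  repeat split; unfold x1, x0, v1, th0, th1, thi, bm, cm, dm; field; repeat split; nz.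
Qed.

End MainTerms.

Section Leads.

Variables (Th0 Th1 Thi sigma s2 r : C).

Let Y1 := y_num1 Th0 Th1 Thi sigma s2.
Let Y2 := y_num2 Th0 Th1 Thi sigma s2.
Let E1 := y_den1 Th0 Th1 Thi sigma s2.
Let E2 := y_den2 Th0 Th1 Thi sigma s2.

Definition z_lead (l : C) : C :=
  (c Th0 Th1 sigma + s2 * d Thi sigma * c Th0 Th1 (- sigma) * tpow l sigma) * E2 l
    / (sigma ^ 2 * s2 * tpow l sigma).
Definition v_lead0 (l : C) : C := - r * (E2 l / Y2 l).
Definition v_lead1 (l : C) : C := - r * (Y1 l / E1 l).
Definition y_lead (l : C) : C := Y1 l * Y2 l / (E1 l * E2 l).

End Leads.

Lemma main_residues (Th0 Th1 Thi sigma s2 r l : C) :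
  sigma <> 0 -> s2 <> 0 -> r <> 0 ->
  y_num1 Th0 Th1 Thi sigma s2 l <> 0 -> y_num2 Th0 Th1 Thi sigma s2 l <> 0 ->
  y_den1 Th0 Th1 Thi sigma s2 l <> 0 -> y_den2 Th0 Th1 Thi sigma s2 l <> 0 ->
  let z_lead := z_lead Th0 Th1 Thi sigma s2 in let v_lead0 := v_lead0 Th0 Th1 Thi sigma s2 r in
  let v_lead1 := v_lead1 Th0 Th1 Thi sigma s2 r in
  let x1 := - (z_lead l + (Th0 + Th1 + Thi) / 2) in
  residue_of (inv_al Thi sigma r) Th0 (z_lead l) (v_lead0 l) = sigma / 2 - hat_limit Th0 Th1 sigma s2 Al /\
  residue_of (inv_be sigma r) Th0 (z_lead l) (v_lead0 l) / tpow l sigma = - hat_limit Th0 Th1 sigma s2 Be /\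
  residue_of (inv_al Thi sigma r) Th1 x1 (v_lead1 l) = hat_limit Th0 Th1 sigma s2 Al /\
  residue_of (inv_be sigma r) Th1 x1 (v_lead1 l) / tpow l sigma = hat_limit Th0 Th1 sigma s2 Be /\
  residue_of (inv_ga Thi sigma r) Th1 x1 (v_lead1 l) * tpow l sigma = hat_limit Th0 Th1 sigma s2 Ga.
Proof.
  intros hsigma hs2 hr hY1 hY2 hE1 hE2 zl vl0 vl1 x1. assert (HT := tpow_neq_0 l sigma).
  unfold x1, zl, vl0, vl1, z_lead, v_lead0, v_lead1, hat_limit. cbv zeta iota.
  unfold y_num1, y_num2, y_den1, y_den2, a in *.
  set (T := tpow l sigma) in *. clearbody T.
  set (bp := b Th0 Th1 sigma) in *. set (cp := c Th0 Th1 sigma) in *. set (dp := d Thi sigma) in *.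
  assert (e1 : b Th0 Th1 (- sigma) = bp - sigma) by (unfold bp, b; cfield).
  assert (e2 : c Th0 Th1 (- sigma) = cp - sigma) by (unfold cp, c; cfield).
  assert (e3 : d Thi (- sigma) = dp - sigma) by (unfold dp, d; cfield).
  (* With [bp], [cp], [dp] as the independent parameters, all quantities become rational expressions
     without relations between the variables. *)
  assert (e4 : Th0 = bp - cp) by (unfold bp, cp, b, c; cfield).
  assert (e5 : Th1 = bp + cp - sigma) by (unfold bp, cp, b, c; cfield).
  assert (e6 : Thi = 2 * dp - sigma) by (unfold dp, d; cfield).
  rewrite e1, e2, e3 in *. clearbody bp cp dp. clear e1 e2 e3. subst Th0 Th1 Thi.
  destruct (main_residue0 bp cp dp sigma s2 r T) as [A1 A2]; try assumption.
  destruct (main_residue1 bp cp dp sigma s2 r T) as [B1 [B2 B3]]; try assumption.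
  rewrite A1, A2, B1, B2, B3. repeat split; cfield.
Qed.

Section LineAsymptotics.

Variables (Th0 Th1 Thi sigma s2 r : C) (M : R) (D : C -> Prop).
Hypothesis hsigma : sigma <> 0.
Hypothesis hs2 : s2 <> 0.
Hypothesis hr : r <> 0.
Hypothesis hRe : 0 <= Re sigma < 1.
Hypothesis HD : left_strip M D.

Let Y1 := y_num1 Th0 Th1 Thi sigma s2.
Let Y2 := y_num2 Th0 Th1 Thi sigma s2.
Let E1 := y_den1 Th0 Th1 Thi sigma s2.
Let E2 := y_den2 Th0 Th1 Thi sigma s2.

Let zlead := z_lead Th0 Th1 Thi sigma s2.
Let vlead0 := v_lead0 Th0 Th1 Thi sigma s2 r.
Let vlead1 := v_lead1 Th0 Th1 Thi sigma s2 r.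
Let ylead := y_lead Th0 Th1 Thi sigma s2.

Hypothesis LY1 : bounded_below D Y1.
Hypothesis LY2 : bounded_below D Y2.
Hypothesis LE1 : bounded_below D E1.
Hypothesis LE2 : bounded_below D E2.
Variables (y z u : C -> C).
Hypothesis Hw : bigO D 1 (fun l => w0 Thi u l - vlead0 l).
Hypothesis Hy : bigO D 1 (fun l => y l - ylead l).
Hypothesis Hz : bigO D (1 - 2 * Re sigma) (fun l => z l - zlead l).

Lemma line_bigO0 (A0 B0 : C) : bigO D 0 (fun l => A0 + B0 * tpow l sigma).
Proof. bigO_tac. Qed.

Lemma line_hats :
  bigO D (1 - Re sigma) (fun l => hats_of Th0 Th1 Thi sigma r y z u Al l - hat_limit Th0 Th1 sigma s2 Al) /\
  bigO D (1 - Re sigma) (fun l => hats_of Th0 Th1 Thi sigma r y z u Be l - hat_limit Th0 Th1 sigma s2 Be) /\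
  bigO D (1 - Re sigma) (fun l => hats_of Th0 Th1 Thi sigma r y z u Ga l - hat_limit Th0 Th1 sigma s2 Ga) /\
  bigO D (1 - Re sigma) (hats_of Th0 Th1 Thi sigma r y z u Et) /\
  bigO D 1 (hats_of Th0 Th1 Thi sigma r y z u Mm).
Proof.
  assert (bY1 : bigO D 0 Y1) by apply line_bigO0. assert (bY2 : bigO D 0 Y2) by apply line_bigO0.
  assert (bE1 : bigO D 0 E1) by apply line_bigO0. assert (bE2 : bigO D 0 E2) by apply line_bigO0.
  assert (iY2 := bigO_inv _ _ LY2). assert (iE1 := bigO_inv _ _ LE1). assert (iE2 := bigO_inv _ _ LE2).
  destruct (bounded_below_neq_0 _ _ LY1) as [N1 H1]. destruct (bounded_below_neq_0 _ _ LY2) as [N2 H2].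
  destruct (bounded_below_neq_0 _ _ LE1) as [N3 H3]. destruct (bounded_below_neq_0 _ _ LE2) as [N4 H4].
  set (N := Rmin (Rmin N1 N2) (Rmin N3 N4)).
  assert (NZ : forall l, D l -> Re l < N -> Y1 l <> 0 /\ Y2 l <> 0 /\ E1 l <> 0 /\ E2 l <> 0).
  { intros l Hl HN.
    assert (Ga := Rlt_le_trans _ _ _ HN (Rmin_l _ _)). assert (Gb := Rlt_le_trans _ _ _ HN (Rmin_r _ _)).
    repeat split.
    - apply H1; [assumption|]. lt_min.
    - apply H2; [assumption|]. lt_min.
    - apply H3; [assumption|]. lt_min.
    - apply H4; [assumption|]. lt_min. }
  assert (dpm' : d Thi sigma - d Thi (- sigma) = sigma) by (unfold d; cfield).
  assert (Hmr : - r <> 0) by now apply Copp_neq_0.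
  assert (Lv0 : bounded_below D vlead0).
  { apply (bounded_below_mult D (fun _ => - r)); [now apply bounded_below_const|].
    apply (bounded_below_mult D E2 (fun l => / Y2 l)); [assumption|now apply bounded_below_inv]. }
  assert (Lv1 : bounded_below D vlead1).
  { apply (bounded_below_mult D (fun _ => - r)); [now apply bounded_below_const|].
    apply (bounded_below_mult D Y1 (fun l => / E1 l)); [assumption|now apply bounded_below_inv]. }
  assert (Bv0 : bigO D 0 vlead0).
  { apply bigO_scal. apply (bigO_mult' D 0 0 0 E2 (fun l => / Y2 l)); [lra|assumption|assumption]. }
  assert (Bv1 : bigO D 0 vlead1).
  { apply bigO_scal. apply (bigO_mult' D 0 0 0 Y1 (fun l => / E1 l)); [lra|assumption|assumption]. }
  assert (BX0 : bigO D 0 (fun l => (vlead0 l + r) / tpow l sigma)).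
  { apply (bigO_ext D 0 N (fun l => r * s2 * sigma * b Th0 Th1 (- sigma) * / Y2 l)).
    - intros l Hl HN. destruct (NZ l Hl HN) as [_ [n2 _]]. unfold vlead0, v_lead0. fold Y1 Y2 E1 E2.
      transitivity (r * (Y2 l - E2 l) / Y2 l / tpow l sigma); [|cfield].
      replace (Y2 l - E2 l) with (s2 * sigma * b Th0 Th1 (- sigma) * tpow l sigma).
      + cfield.
      + rewrite <- dpm' at 1. unfold Y2, E2, y_num2, y_den2. ring.
    - bigO_tac. }
  assert (BX1 : bigO D 0 (fun l => (vlead1 l + r) / tpow l sigma)).
  { apply (bigO_ext D 0 N (fun l => r * s2 * sigma * a Th0 Th1 (- sigma) * / E1 l)).
    - intros l Hl HN. destruct (NZ l Hl HN) as [_ [_ [n3 _]]]. unfold vlead1, v_lead1. fold Y1 Y2 E1 E2.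
      transitivity (r * (E1 l - Y1 l) / E1 l / tpow l sigma); [|cfield].
      replace (E1 l - Y1 l) with (s2 * sigma * a Th0 Th1 (- sigma) * tpow l sigma).
      + cfield.
      + rewrite <- dpm' at 1. unfold E1, Y1, y_num1, y_den1. ring.
    - bigO_tac. }
  assert (BZ0 : bigO D 0 (fun l => tpow l sigma * zlead l)).
  { apply (bigO_eq D 0 (fun l => (c Th0 Th1 sigma + s2 * d Thi sigma * c Th0 Th1 (- sigma) * tpow l sigma)
       * E2 l / (sigma ^ 2 * s2))).
    - intros l. unfold zlead, z_lead. fold Y1 Y2 E1 E2. cfield.
    - bigO_tac. }
  assert (BZ1 : bigO D 0 (fun l => tpow l sigma * - (zlead l + (Th0 + Th1 + Thi) / 2))).
  { apply (bigO_eq D 0 (fun l => - (tpow l sigma * zlead l) - (Th0 + Th1 + Thi) / 2 * tpow l sigma));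
      [intros; ring|]. bigO_tac. }
  assert (Hz1 : bigO D (1 - 2 * Re sigma) (fun l => z1 Th0 Th1 Thi z l
     - (- (zlead l + (Th0 + Th1 + Thi) / 2)))).
  { apply (bigO_eq D _ (fun l => - (z l - zlead l))); [intros; unfold z1; ring|now apply bigO_opp]. }
  assert (Hw1 : bigO D 1 (fun l => w1 Thi y u l - vlead1 l)).
  { apply (bigO_ext D 1 N (fun l => w0 Thi u l * y l - vlead0 l * ylead l)).
    - intros l Hl HN. destruct (NZ l Hl HN) as [n1 [n2 [n3 n4]]].
      unfold w1. f_equal. f_equal. unfold vlead0, ylead, vlead1, v_lead0, y_lead, v_lead1. fold Y1 Y2 E1 E2. field. repeat split; assumption.
    - apply bigO_diff_mult; try assumption; [lra| |].
      + apply (bigO_of_diff D 0 1 _ vlead0); [lra|assumption..].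
      + apply (bigO_ext D 0 N (fun l => Y1 l * Y2 l * (/ E1 l * / E2 l))).
        * intros l Hl HN. destruct (NZ l Hl HN) as [n1 [n2 [n3 n4]]]. unfold ylead, y_lead. fold Y1 Y2 E1 E2.
          field. now split.
        * bigO_tac. }
  destruct (residue_of_close Thi sigma r M D hsigma hr hRe HD Th0 z (w0 Thi u) zlead vlead0
    Lv0 Bv0 BX0 BZ0 Hw Hz) as [[_ A1] [[_ A2] _]].
  destruct (residue_of_close Thi sigma r M D hsigma hr hRe HD Th1 (z1 Th0 Th1 Thi z) (w1 Thi y u)
    (fun l => - (zlead l + (Th0 + Th1 + Thi) / 2)) vlead1 Lv1 Bv1 BX1 BZ1 Hw1 Hz1)
    as [[_ C1] [[_ C2] [_ C3]]].
  assert (MR : forall l, D l -> Re l < N -> _) by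
    (intros l Hl HN; destruct (NZ l Hl HN) as [n1 [n2 [n3 n4]]]; exact (main_residues Th0 Th1 Thi sigma s2 r l hsigma hs2 hr n1 n2 n3 n4)).
  split; [|split; [|split; [|split]]].
  - refine (bigO_ext D _ N _ _ _ C1). intros l Hl HN. cbv beta. unfold vlead0, vlead1, zlead. destruct (MR l Hl HN) as [_ [_ [-> _]]]. reflexivity.
  - refine (bigO_ext D _ N _ _ _ C2). intros l Hl HN. cbv beta. unfold vlead0, vlead1, zlead. destruct (MR l Hl HN) as [_ [_ [_ [-> _]]]].
    reflexivity.
  - refine (bigO_ext D _ N _ _ _ C3). intros l Hl HN. cbv beta. unfold vlead0, vlead1, zlead. destruct (MR l Hl HN) as [_ [_ [_ [_ ->]]]].
    reflexivity.
  - refine (bigO_ext D _ N _ _ _ (bigO_plus _ _ _ _ A1 C1)). intros l Hl HN. cbv beta. unfold vlead0, vlead1, zlead.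
    destruct (MR l Hl HN) as [-> [_ [-> _]]]. unfold hats_of. ring.
  (* [Mm] is not divided by [t ^ sigma], unlike the two quantities estimated here; multiplying their
     sum by [t ^ sigma] raises its order to 1. *)
  - assert (K : bigO D (1 - Re sigma + Re sigma) (fun l => hats_of Th0 Th1 Thi sigma r y z u Mm l)).
    { refine (bigO_ext D _ N _ _ _ (bigO_mult _ _ _ _ _ (bigO_plus _ _ _ _ A2 C2) (bigO_tpow M D sigma HD))).
      intros l Hl HN. cbv beta. unfold vlead0, vlead1, zlead. destruct (MR l Hl HN) as [_ [-> [_ [-> _]]]]. unfold hats_of. cfield. }
    apply (bigO_weaken D (1 - Re sigma + Re sigma)); [lra|exact K].
Qed.

End LineAsymptotics.

Lemma bigO_of_bigO2 (M N : R) (D E : C -> Prop) (f : C -> C) (p q : R) :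
  (forall l, D l -> strip M l) -> (forall l, D l -> Re l < N -> E l) ->
  bigO2 M E f p q -> bigO D (Rmin p q) f.
Proof.
  intros HD HE [K [N1 H]]. exists (Rabs K * 2)%R, (Rmin 0 (Rmin N N1)). intros l Hl HN.
  assert (G0 := Rlt_le_trans _ _ _ HN (Rmin_l _ _)). assert (G := Rlt_le_trans _ _ _ HN (Rmin_r _ _)).
  assert (G1 := Rlt_le_trans _ _ _ G (Rmin_l _ _)). assert (G2 := Rlt_le_trans _ _ _ G (Rmin_r _ _)).
  assert (S : sector M N1 l) by (split; [now apply HD|assumption]).
  eapply Rle_trans; [apply (H l S); now apply HE|].
  unfold tpow. rewrite !Cmod_Cexp.
  assert (R1 : forall p : R, Re (p * l) = (p * Re l)%R) by (intros; destruct l; simpl; ring).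
  rewrite !R1.
  assert (T1 : exp (p * Re l) <= exp (Rmin p q * Re l)).
  { apply exp_le_compat. assert (T := Rmin_l p q). nra. }
  assert (T2 : exp (q * Re l) <= exp (Rmin p q * Re l)).
  { apply exp_le_compat. assert (T := Rmin_r p q). nra. }
  assert (P1 := exp_pos (p * Re l)). assert (P2 := exp_pos (q * Re l)).
  apply Rle_trans with (Rabs K * (exp (p * Re l) + exp (q * Re l)))%R.
  { apply Rmult_le_compat_r; [lra|apply Rle_abs]. }
  rewrite Rmult_assoc. apply Rmult_le_compat_l; [apply Rabs_pos|lra].
Qed.

(** For imaginary [sigma] the modulus of [t ^ sigma] depends on [Im l] only and determines it, while
    at a zero the value of [t ^ sigma] is prescribed. *)
Lemma zero_height (sigma A0 B0 : C) : sigma <> 0 -> Re sigma = 0%R -> A0 <> 0 \/ B0 <> 0 ->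
  exists h, forall m, A0 + B0 * tpow m sigma = 0 -> Im m = h.
Proof.
  intros Hs H0 HAB.
  destruct (classic (exists m, A0 + B0 * tpow m sigma = 0)) as [[m0 Hm0]|Hn].
  - exists (Im m0). intros m Hm.
    assert (HB : B0 <> 0).
    { intros HB. rewrite HB in Hm0. destruct HAB as [HA|HA]; [|contradiction].
      apply HA. rewrite <- Hm0. ring. }
    assert (E : tpow m sigma = tpow m0 sigma).
    { apply (Cmult_cancel_l B0); [assumption|]. apply (Cplus_cancel_r _ _ A0).
      rewrite Cplus_comm, Hm, Cplus_comm, Hm0. reflexivity. }
    apply (f_equal Cmod) in E. unfold tpow in E. rewrite !Cmod_Cexp in E.
    apply exp_inv in E.
    assert (Hi : Im sigma <> 0%R).
    { intros Hi. apply Hs. apply C_ext; simpl; assumption. }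
    assert (R1 : forall x, Re (sigma * x) = (- (Im sigma * Im x))%R).
    { intros x. replace (Re (sigma * x)) with (Re sigma * Re x - Im sigma * Im x)%R
        by (destruct sigma, x; simpl; ring). rewrite H0. ring. }
    rewrite !R1 in E. apply Rmult_eq_reg_l with (Im sigma); [lra|assumption].
  - exists 0%R. intros m Hm. exfalso. apply Hn. now exists m.
Qed.

Definition far_away (sigma : C) (h e : R) (A0 B0 : C) : Prop :=
  exists N : R, forall l, Im l = h -> Re l < N -> away e (fun m => A0 + B0 * tpow m sigma) l.

Lemma heights_imaginary (M : R) (sigma : C) (L : list (C * C)) : 0 < M -> sigma <> 0 ->
  Re sigma = 0%R -> (forall q, In q L -> fst q <> 0 \/ snd q <> 0) ->
  exists y1 y2 e, - M < y1 /\ y1 < y2 /\ y2 < M /\ 0 < e /\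
    forall h, y1 <= h <= y2 -> forall q, In q L -> far_away sigma h e (fst q) (snd q).
Proof.
  intros HM Hs H0 HL.
  assert (H : forall q : C * C, exists h, In q L -> forall m, fst q + snd q * tpow m sigma = 0 -> Im m = h).
  { intros q. destruct (classic (In q L)) as [Hq|Hq].
    - destruct (zero_height sigma (fst q) (snd q) Hs H0 (HL q Hq)) as [h Hh]. now exists h.
    - exists 0%R. intros Hq'. contradiction. }
  apply choice in H. destruct H as [hh Hh].
  destruct (avoid_list (map hh L) (- M / 2) (M / 2)) as [y1 [y2 [e [h1 [h2 [h3 [h4 h5]]]]]]]; [lra|].
  exists y1, y2, e. repeat split; try lra. intros h Hh12 q Hq. exists 0%R.
  intros l Hl _ m Hm. specialize (Hh q Hq m Hm).
  specialize (h5 h (hh q) Hh12 (in_map hh L q Hq)).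
  eapply Rle_trans; [exact h5|]. rewrite <- Hl, <- Hh.
  change (Im l - Im m)%R with (Im (l - m)). apply Im_le_Cmod.
Qed.

(** For [Re sigma > 0] the factor tends to [A0 <> 0], so its zeros in a strip stay to the right of
    some vertical line. The wider strip [M + 1] catches the zeros within distance 1 of the line
    considered. *)
Lemma heights_positive (M : R) (sigma A0 B0 : C) (h : R) : 0 < M -> 0 < Re sigma ->
  - M < h < M -> A0 <> 0 -> far_away sigma h 1 A0 B0.
Proof.
  intros HM Hs Hh HA.
  destruct (bounded_below_neq_0 _ _ (bounded_below_linear_exp (M + 1) sigma A0 B0 (strip (M + 1)) (strip_left (M + 1)) Hs HA))
    as [N HN].
  exists (N - 1)%R. intros l Hl HlN m Hm.
  destruct (Rle_dec 1 (Cmod (l - m))) as [G|G]; [assumption|exfalso]. apply Rnot_le_lt in G.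
  rewrite Cmod_sub_comm in G.
  assert (T1 := re_le_Cmod (m - l)). assert (T2 := Im_le_Cmod (m - l)).
  replace (Re (m - l)) with (Re m - Re l)%R in T1 by reflexivity.
  replace (Im (m - l)) with (Im m - Im l)%R in T2 by reflexivity.
  apply (HN m); [| |exact Hm].
  - unfold strip. rewrite Hl in T2. assert (T3 := Rle_abs (Im m - h)).
    assert (T4 := Rle_abs (- (Im m - h))). rewrite Rabs_Ropp in T4. apply Rabs_def1; lra.
  - assert (T3 := Rle_abs (Re m - Re l)). lra.
Qed.

Lemma away_prod (e : R) (f g : C -> C) (l : C) : away e f l -> away e g l ->
  away e (fun m => f m * g m) l.
Proof.
  intros Hf Hg m Hm. destruct (classic (f m = 0)) as [Z|Z]; [now apply Hf|].
  apply Hg. apply (Cmult_cancel_l (f m)); [assumption|]. rewrite Hm. ring.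
Qed.

(** * Comparison of two solutions on a common line *)

Section Line.

Variables (Th0 Th1 Thi sigma s2 r : C).
Hypothesis hTh0 : Th0 <> 0.
Hypothesis hTh1 : Th1 <> 0.
Hypothesis hsigma : sigma <> 0.
Hypothesis hs2 : s2 <> 0.
Hypothesis hr : r <> 0.
Hypothesis hRe : 0 <= Re sigma < 1.
Hypothesis hnd : nondegenerate Th0 Th1 Thi sigma.
Variable M : R.
Hypothesis hM : 0 < M.

Let bp := b Th0 Th1 sigma.
Let bm := b Th0 Th1 (- sigma).
Let ap := a Th0 Th1 sigma.
Let am := a Th0 Th1 (- sigma).
Let dp := d Thi sigma.
Let dm := d Thi (- sigma).

Let factors : list (C * C) :=
  (bp, s2 * dp * bm) :: (bp, s2 * dm * bm) :: (ap, s2 * dp * am) :: (ap, s2 * dm * am) :: nil.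

(** A whole interval of heights is produced, because [avoid_line] must still find in it a height
    that misses the exceptional sets of both solutions. *)
Lemma choose_heights : exists y1 y2 e, - M < y1 /\ y1 < y2 /\ y2 < M /\ 0 < e /\
    forall h, y1 <= h <= y2 -> forall q, In q factors -> far_away sigma h e (fst q) (snd q).
Proof.
  destruct (Req_dec (Re sigma) 0) as [H0|H0].
  - apply heights_imaginary; try assumption.
    destruct (linear_coefs Th0 Th1 Thi sigma s2 hTh1 hsigma hs2 hnd) as [k1 [k2 [k3 k4]]].
    intros q [<-|[<-|[<-|[<-|[]]]]]; assumption.
  - exists (- M / 2)%R, (M / 2)%R, 1%R. repeat split; try lra.
    intros h Hh q Hq. apply (heights_positive M); try lra.
    destruct (nondegenerate_a Th0 Th1 Thi sigma s2 hTh1 hsigma hs2 hnd) as [Ha|[Ha _]]; [|contradiction].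
    destruct (nondegenerate_b Th0 Th1 Thi sigma s2 hsigma hs2 hnd) as [Hb|[Hb _]]; [|contradiction].
    destruct Hq as [<-|[<-|[<-|[<-|[]]]]]; assumption.
Qed.

Let Y2 := y_num2 Th0 Th1 Thi sigma s2.
Let E2 := y_den2 Th0 Th1 Thi sigma s2.
Let Y1 := y_num1 Th0 Th1 Thi sigma s2.
Let E1 := y_den1 Th0 Th1 Thi sigma s2.

Section OneSolution.

Variables (N h e : R) (P : C -> Prop) (y z u : C -> C).
Hypothesis Hsol : is_solution Th0 Th1 Thi (sector M N) P y z u.
Hypothesis Hexp : has_expansion Th0 Th1 Thi sigma s2 r M P y z u.
Hypothesis Hh : - M < h < M.
Hypothesis He : 0 < e.
Hypothesis Hfar : forall q, In q factors -> far_away sigma h e (fst q) (snd q).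
Hypothesis HP : forall m, Im m = h -> Re m < N - 1 -> ~ P m.

Definition line (l : C) : Prop := Im l = h.

Lemma line_left : left_strip M line.
Proof.
  unfold line. split.
  - intros l Hl. rewrite Hl. apply Rabs_le. lra.
  - intros l s Hl _. simpl. rewrite Rplus_0_r. exact Hl.
Qed.

Lemma line_strip (l : C) : line l -> strip M l.
Proof. unfold line, strip. intros ->. apply Rabs_def1; lra. Qed.

Lemma far_all : exists N1, N1 <= N - 1 /\ forall l, line l -> Re l < N1 ->
  away e Y2 l /\ away e E2 l /\ away e E1 l /\ away e Y1 l.
Proof.
  destruct (Hfar _ (or_introl eq_refl)) as [N1 H1].
  destruct (Hfar _ (or_intror (or_introl eq_refl))) as [N2 H2].
  destruct (Hfar _ (or_intror (or_intror (or_introl eq_refl)))) as [N3 H3].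
  destruct (Hfar _ (or_intror (or_intror (or_intror (or_introl eq_refl))))) as [N4 H4].
  exists (Rmin (N - 1) (Rmin (Rmin N1 N2) (Rmin N3 N4))). split; [apply Rmin_l|].
  intros l Hl HN. apply Rlt_le_trans with (2 := Rmin_r _ _) in HN.
  assert (Ga := Rlt_le_trans _ _ _ HN (Rmin_l _ _)). assert (Gb := Rlt_le_trans _ _ _ HN (Rmin_r _ _)).
  split; [|split; [|split]].
  - apply (H1 l Hl). lt_min.
  - apply (H2 l Hl). lt_min.
  - apply (H3 l Hl). lt_min.
  - apply (H4 l Hl). lt_min.
Qed.

Lemma line_bounded_below : bounded_below line Y2 /\ bounded_below line E2 /\ bounded_below line E1 /\ bounded_below line Y1.
Proof.
  destruct far_all as [N1 [_ H]].
  assert (ND : forall A0 B0 : C, (A0 <> 0 \/ (Re sigma = 0%R /\ B0 <> 0)) ->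
     (forall l, line l -> Re l < N1 -> away e (fun m => A0 + B0 * tpow m sigma) l) ->
     bounded_below line (fun l => A0 + B0 * tpow l sigma)).
  { intros A0 B0 HAB Haw.
    assert (K : bounded_below (fun l => line l /\ Re l < N1) (fun l => A0 + B0 * tpow l sigma)).
    { apply (bounded_below_factor sigma hsigma hRe M e A0 B0); try assumption.
      intros l [Hl HN]. split; [now apply line_strip|now apply Haw]. }
    destruct K as [k [N2 [Hk K]]]. exists k, (Rmin N1 N2). split; [assumption|].
    intros l Hl HN. apply K; [split; [assumption|]|].
    - lt_min.
    - lt_min. }
  assert (Na := nondegenerate_a Th0 Th1 Thi sigma s2 hTh1 hsigma hs2 hnd).
  assert (Nb := nondegenerate_b Th0 Th1 Thi sigma s2 hsigma hs2 hnd).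
  fold bp bm ap am dp dm in Na, Nb.
  split; [|split; [|split]]; apply ND; try (intros l Hl HN; now apply H);
    [destruct Nb as [Z|[Z1 [Z2 Z3]]]|destruct Nb as [Z|[Z1 [Z2 Z3]]]
    |destruct Na as [Z|[Z1 [Z2 Z3]]]|destruct Na as [Z|[Z1 [Z2 Z3]]]];
    try (left; exact Z); right; (split; [assumption|]).
  - replace (s2 * d Thi sigma * b Th0 Th1 (- sigma)) with (dp * (s2 * bm)) by (unfold dp, bm; ring).
    assumption.
  - replace (s2 * d Thi (- sigma) * b Th0 Th1 (- sigma)) with (dm * (s2 * bm)) by (unfold dm, bm; ring).
    assumption.
  - replace (s2 * d Thi sigma * a Th0 Th1 (- sigma)) with (dp * (s2 * am)) by (unfold dp, am; ring).
    assumption.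
  - replace (s2 * d Thi (- sigma) * a Th0 Th1 (- sigma)) with (dm * (s2 * am)) by (unfold dm, am; ring).
    assumption.
Qed.

(** The exponents [1 + Re sigma] and [2 - Re sigma] are at least 1, so the errors and the linear
    term of [y_main] are all of order [t]; only the leading quotient is needed for the limits. *)
Lemma line_y : bigO line 1 (fun l => y l - y_lead Th0 Th1 Thi sigma s2 l).
Proof.
  destruct far_all as [N1 [HN1 H]]. destruct Hexp as [Hy _]. specialize (Hy e He).
  apply (bigO_of_bigO2 M N1 line) in Hy.
  - assert (HL := line_left).
    apply (bigO_eq line 1 (fun l => (y l - y_main Th0 Th1 Thi sigma s2 l)
      + (1 - Th1 - Th0) / (1 - sigma) ^ 2 * tt l)).
    + intros l. unfold y_main, y_lead. ring.
    + apply bigO_plus; [|bigO_tac]. eapply bigO_weaken; [|exact Hy]. rmin_lra.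
  - apply line_strip.
  - intros l Hl HN. split; [apply HP; [exact Hl|lra]|].
    destruct (H l Hl HN) as [_ [K1 [K2 _]]]. now apply away_prod.
Qed.

(** The second term of [z_main] has order [t ^ (1 - 2 Re sigma)] and both error terms are at least
    as small. *)
Lemma line_z : bigO line (1 - 2 * Re sigma) (fun l => z l - z_lead Th0 Th1 Thi sigma s2 l).
Proof.
  destruct Hexp as [_ [Hz _]].
  apply (bigO_of_bigO2 M (N - 1) line) in Hz.
  - assert (HL := line_left).
    assert (H1s : 1 - sigma <> 0).
    { intros H. assert (H' : Re (1 - sigma) = 0%R) by now rewrite H. unfold Re in *. simpl in H'. lra. }
    apply (bigO_eq line _ (fun l => (z l - z_main Th0 Th1 Thi sigma s2 l)
      + 2 * (b Th0 Th1 sigma * c Th0 Th1 sigma / (sigma ^ 2 * (1 - sigma) * s2)) ^ 2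
        * tt l / tpow l sigma / tpow l sigma)).
    + intros l. unfold z_main, z_lead, y_den2. cfield.
    + apply bigO_plus; [eapply bigO_weaken; [|exact Hz]; rmin_lra|bigO_tac].
  - apply line_strip.
  - intros l Hl HN. apply HP; [exact Hl|lra].
Qed.

Lemma line_w : bigO line 1 (fun l => w0 Thi u l - v_lead0 Th0 Th1 Thi sigma s2 r l).
Proof.
  destruct far_all as [N1 [HN1 H]]. destruct Hexp as [_ [_ Hu]].
  destruct (Hu e He) as [hh [K [N2 HK]]].
  assert (HL := line_left).
  destruct line_bounded_below as [LY2 _].
  assert (Bh : bigO line 1 hh).
  { exists K, (Rmin N1 N2). intros l Hl HN.
    assert (G1 := Rlt_le_trans _ _ _ HN (Rmin_l _ _)). assert (G2 := Rlt_le_trans _ _ _ HN (Rmin_r _ _)).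
    destruct (H l Hl G1) as [K1 [K2 _]].
    destruct (HK l) as [_ K3].
    - split; [now apply line_strip|assumption].
    - apply HP; [exact Hl|lra].
    - now apply away_prod.
    - eapply Rle_trans; [exact K3|]. right. f_equal. unfold tt, tpow. rewrite Cmod_Cexp.
      f_equal. destruct l. simpl. ring. }
  assert (BE : bigO line 0 E2) by (unfold E2, y_den2; bigO_tac).
  assert (BY := bigO_inv _ _ LY2).
  apply (bigO_ext line 1 (Rmin N1 N2) (fun l => - r * (E2 l * / Y2 l) * hh l)); [|bigO_tac].
  intros l Hl HN.
  assert (G1 := Rlt_le_trans _ _ _ HN (Rmin_l _ _)). assert (G2 := Rlt_le_trans _ _ _ HN (Rmin_r _ _)).
  destruct (H l Hl G1) as [K1 [K2 _]].
  destruct (HK l) as [K3 _].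
  - split; [now apply line_strip|assumption].
  - apply HP; [exact Hl|lra].
  - now apply away_prod.
  - unfold w0. rewrite K3. unfold u_main, v_lead0. fold E2 Y2.
    transitivity (- r * (E2 l / Y2 l) * hh l * (tpow l Thi * / tpow l Thi)).
    + rewrite Cinv_r by apply tpow_neq_0. unfold Cdiv. ring.
    + transitivity (- r * (E2 l / Y2 l) * (1 + hh l) * (tpow l Thi * / tpow l Thi) - - r * (E2 l / Y2 l)).
      * rewrite Cinv_r by apply tpow_neq_0. ring.
      * unfold Cdiv. ring.
Qed.

Lemma solution_hats (l : C) : sector M N l -> ~ P l ->
  y l <> 0 /\ u l <> 0 /\ hats Thi sigma (hats_of Th0 Th1 Thi sigma r y z u) l.
Proof.
  intros Hl Pl. destruct Hsol as [_ [_ HS]].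
  destruct (HS l Hl Pl) as [A1 [A2 [A3 [A4 A5]]]].
  split; [assumption|]. split; [assumption|].
  apply hats_of_hats; try assumption; now apply Cder_is_derive.
Qed.

Let V := hats_of Th0 Th1 Thi sigma r y z u.

Lemma solution_line_hats :
  (forall l, line l -> Re l < N - 1 -> hats Thi sigma V l) /\
  (forall i, bigO line (hat_weight sigma i) (V i)) /\
  (forall i, exists k x, 0 < x /\ bigO line x (fun l => V i l - k) /\
     k = match i with One => 1 | Al | Be | Ga => hat_limit Th0 Th1 sigma s2 i | _ => 0 end).
Proof.
  destruct line_bounded_below as [LY2 [LE2 [LE1 LY1]]].
  destruct (line_hats Th0 Th1 Thi sigma s2 r M line hsigma hs2 hr hRe line_left
    LY1 LY2 LE1 LE2 y z u line_w line_y line_z) as [A1 [A2 [A3 [A4 A5]]]].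
  split; [|split].
  - intros l Hl HN. apply solution_hats; [|now apply HP].
    split; [now apply line_strip|lra].
  - assert (K : forall f k, bigO line (1 - Re sigma) (fun l => f l - k) -> bigO line 0 f).
    { intros f k Hf. apply (bigO_of_diff line 0 (1 - Re sigma) f (fun _ => k)); [lra|apply bigO_const|assumption]. }
    intros []; simpl; try (apply bigO_zero; reflexivity).
    + exact (bigO_const line 1).
    + exact (K _ _ A1).
    + exact (K _ _ A2).
    + exact (K _ _ A3).
    + apply (bigO_weaken line (1 - Re sigma)); [unfold hat_gap; lra|exact A4].
    + apply (bigO_weaken line 1); [unfold hat_gap; lra|exact A5].
  - intros i. eexists. exists (1 - Re sigma)%R. split; [lra|]. split; [|reflexivity].
    destruct i; try (apply bigO_zero; intros; simpl; ring); try assumption.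
    + apply (bigO_eq line _ (V Et)); [intros; ring|exact A4].
    + apply (bigO_eq line _ (V Mm)); [intros; ring|]. apply (bigO_weaken line 1); [lra|exact A5].
Qed.

End OneSolution.

Lemma line_unique (N N' : R) (P P' : C -> Prop) (y z u y' z' u' : C -> C) :
  is_solution Th0 Th1 Thi (sector M N) P y z u ->
  has_expansion Th0 Th1 Thi sigma s2 r M P y z u ->
  is_solution Th0 Th1 Thi (sector M N') P' y' z' u' ->
  has_expansion Th0 Th1 Thi sigma s2 r M P' y' z' u' ->
  exists h N1, - M < h < M /\ forall l, Im l = h -> Re l < N1 -> forall i,
    hats_of Th0 Th1 Thi sigma r y z u i l = hats_of Th0 Th1 Thi sigma r y' z' u' i l.
Proof.
  intros S1 X1 S2 X2.
  destruct choose_heights as [y1 [y2 [e [k1 [k2 [k3 [k4 k5]]]]]]].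
  set (Nm := Rmin N N').
  assert (HQ : discrete_in (sector M Nm) (fun m => P m \/ P' m)).
  { intros l [L1 L2].
    destruct (proj1 S1 l) as [e1 [E1' I1]]; [split; [assumption|lt_min]|].
    destruct (proj1 S2 l) as [e2 [E2' I2]]; [split; [assumption|lt_min]|].
    exists (Rmin e1 e2). split; [now apply Rmin_pos|]. intros m [Hm0 Hm] [Q|Q]; revert Q.
    - apply I1. split; [assumption|]. lt_min.
    - apply I2. split; [assumption|]. lt_min. }
  destruct (avoid_line M Nm _ y1 y2 HQ k1 k2 k3) as [h [Hh HP]].
  assert (Hh' : - M < h < M) by lra.
  assert (NmN : Nm <= N) by apply Rmin_l. assert (NmN' : Nm <= N') by apply Rmin_r.
  assert (W1 : is_solution Th0 Th1 Thi (sector M Nm) P y z u).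
  { destruct S1 as [A1 [A2 A3]]. split; [|split].
    - intros l [L1 L2]. apply A1. split; [assumption|lra].
    - intros l [L1 L2]. apply A2. split; [assumption|lra].
    - intros l [L1 L2]. apply A3. split; [assumption|lra]. }
  assert (W2 : is_solution Th0 Th1 Thi (sector M Nm) P' y' z' u').
  { destruct S2 as [A1 [A2 A3]]. split; [|split].
    - intros l [L1 L2]. apply A1. split; [assumption|lra].
    - intros l [L1 L2]. apply A2. split; [assumption|lra].
    - intros l [L1 L2]. apply A3. split; [assumption|lra]. }
  assert (HP1 : forall m, Im m = h -> Re m < Nm - 1 -> ~ P m).
  { intros m M1 M2 Q. apply (HP m M1 M2). now left. }
  assert (HP2 : forall m, Im m = h -> Re m < Nm - 1 -> ~ P' m).
  { intros m M1 M2 Q. apply (HP m M1 M2). now right. }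
  destruct (solution_line_hats Nm h e P y z u W1 X1 Hh' k4 (k5 h Hh) HP1) as [A1 [A2 A3]].
  destruct (solution_line_hats Nm h e P' y' z' u' W2 X2 Hh' k4 (k5 h Hh) HP2) as [B1 [B2 B3]].
  destruct (hats_unique Thi sigma M (line h) hRe (line_left h Hh')
    (hats_of Th0 Th1 Thi sigma r y z u) (hats_of Th0 Th1 Thi sigma r y' z' u') (Nm - 1))
    as [N1 HN1].
  - intros l Hl HN. split; [now apply A1|now apply B1].
  - exact A2.
  - exact B2.
  - intros i. destruct (A3 i) as [k [x [Hx [Bx Ek]]]]. destruct (B3 i) as [k' [x' [Hx' [Bx' Ek']]]].
    exists (Rmin x x'). split; [now apply Rmin_pos|].
    apply (bigO_eq (line h) _ (fun l => (hats_of Th0 Th1 Thi sigma r y z u i l - k)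
       - (hats_of Th0 Th1 Thi sigma r y' z' u' i l - k'))).
    + intros l. rewrite Ek, Ek'. ring.
    + now apply bigO_minus_min.
  - exists h, N1. split; [assumption|]. intros l Hl HN i. now apply HN1.
Qed.

End Line.

(** * Uniqueness *)

Section Propagate.

Variables (M N : R) (Q Eq : C -> Prop).
Hypothesis HQ : discrete_in (sector M N) Q.
Hypothesis Hseg : forall m v, (forall s, 0 <= s <= 1 -> sector M N (m + s * v) /\ ~ Q (m + s * v)) ->
  Eq m -> Eq (m + v).

Definition clear_disc (p : C) (e : R) : Prop :=
  forall m, 0 < Cmod (m - p) < e -> sector M N m /\ ~ Q m.

Lemma clear_disc_exists (p : C) : sector M N p -> exists e, 0 < e /\ clear_disc p e.
Proof.
  intros Hp. destruct (HQ p Hp) as [e1 [H1 I1]]. destruct (sector_open M N p Hp) as [e2 [H2 I2]].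
  exists (Rmin e1 e2). split; [now apply Rmin_pos|]. intros m [Hm0 Hm]. split.
  - apply I2. lt_min.
  - apply I1. split; [assumption|]. lt_min.
Qed.

Lemma clear_segment (p w1 w2 : C) (e : R) : clear_disc p e ->
  Cmod w1 < e -> Cmod w2 < e ->
  (forall s : R, 0 <= s <= 1 -> w1 + s * (w2 - w1) <> 0) -> Eq (p + w1) -> Eq (p + w2).
Proof.
  intros Hc H1 H2 Hn HE.
  replace (p + w2) with (p + w1 + (w2 - w1)) by ring. apply Hseg; [|assumption].
  intros s Hs. apply Hc. replace (p + w1 + s * (w2 - w1) - p) with (w1 + s * (w2 - w1)) by ring.
  split; [now apply Cmod_gt_0, Hn|].
  replace (w1 + s * (w2 - w1)) with (RtoC (1 - s) * w1 + s * w2) by (rewrite RtoC_minus; ring).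
  eapply Rle_lt_trans; [apply Cmod_triangle|]. rewrite !Cmod_mult, !Cmod_R, !Rabs_pos_eq by lra.
  destruct (Req_dec s 0) as [->|Hs0]; nra.
Qed.

Lemma Ci_combination (x y : R) : RtoC x + RtoC y * Ci = 0 -> x = 0%R /\ y = 0%R.
Proof.
  intros H. split.
  - apply (f_equal Re) in H. simpl in H. lra.
  - apply (f_equal Im) in H. simpl in H. lra.
Qed.

(* If the segment from [w1] to [w2] passes through [0], go through [i w1]. *)
Lemma clear_disc_connected (p m1 m2 : C) (e : R) : clear_disc p e ->
  0 < Cmod (m1 - p) < e -> 0 < Cmod (m2 - p) < e -> Eq m1 -> Eq m2.
Proof.
  intros Hc [P1 L1] [P2 L2] HE. set (q1 := m1 - p) in *. set (q2 := m2 - p) in *.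
  assert (N1 : q1 <> 0) by now apply Cmod_gt_0.
  replace m2 with (p + q2) by (unfold q2; ring).
  replace m1 with (p + q1) in HE by (unfold q1; ring). clearbody q1 q2.
  destruct (classic (exists s : R, 0 <= s <= 1 /\ q1 + s * (q2 - q1) = 0)) as [[s [Hs Z]]|Hn].
  - assert (Hs0 : s <> 0%R).
    { intros ->. apply N1. rewrite <- Z. ring. }
    assert (Cs : RtoC s <> 0) by (intros H; apply RtoC_inj in H; contradiction).
    set (k := ((1 - s) / s)%R).
    assert (E2 : q2 = - RtoC k * q1).
    { unfold k. rewrite RtoC_div, RtoC_minus by assumption.
      transitivity ((q1 + s * (q2 - q1) - (1 - s) * q1) / s); [field; assumption|].
      rewrite Z. field. assumption. }
    assert (Hk : 0 < k).
    { assert (Hk0 : 0 <= k) by (unfold k; apply Rmult_le_pos; [lra|left; apply Rinv_0_lt_compat; lra]).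
      destruct Hk0 as [Hk0|Hk0]; [assumption|exfalso].
      rewrite <- Hk0 in E2. rewrite E2 in P2. replace (- 0 * q1) with (RtoC 0) in P2 by ring.
      rewrite Cmod_0 in P2. lra. }
    assert (Li : Cmod (Ci * q1) < e) by (rewrite Cmod_mult, Cmod_Ci; lra).
    assert (HM : Eq (p + Ci * q1)).
    { apply (clear_segment p q1 (Ci * q1) e Hc L1 Li); [|assumption].
      intros t Ht Z'. replace (q1 + t * (Ci * q1 - q1)) with (q1 * (RtoC (1 - t) + t * Ci)) in Z'
        by (rewrite RtoC_minus; ring).
      assert (Z2 : RtoC (1 - t) + t * Ci = 0).
      { apply (Cmult_cancel_l q1); [assumption|]. rewrite Z'. ring. }
      apply Ci_combination in Z2. lra. }
    apply (clear_segment p (Ci * q1) q2 e Hc Li L2); [|assumption].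
    intros t Ht Z'. rewrite E2 in Z'.
    replace (Ci * q1 + t * (- k * q1 - Ci * q1)) with (q1 * (RtoC (- (t * k)) + RtoC (1 - t) * Ci)) in Z'
      by (rewrite RtoC_opp, RtoC_mult, RtoC_minus; ring).
    assert (Z2 : RtoC (- (t * k)) + RtoC (1 - t) * Ci = 0).
    { apply (Cmult_cancel_l q1); [assumption|]. rewrite Z'. ring. }
    apply Ci_combination in Z2. destruct Z2 as [Z3 Z4]. assert (t = 1%R) by lra. subst t. lra.
  - apply (clear_segment p q1 q2 e Hc L1 L2); [|assumption].
    intros s Hs Z. apply Hn. now exists s.
Qed.

(** Equality itself is not meaningful at points of [Q], which a path may have to cross; having
    points of equality arbitrarily near is, and it passes through isolated exceptional points. *)
Definition accum (l : C) : Prop := forall e, 0 < e -> exists m, 0 < Cmod (m - l) < e /\ Eq m.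

Lemma accum_transfer (p : C) (e : R) (l1 l2 : C) : clear_disc p e ->
  Cmod (l1 - p) < e -> Cmod (l2 - p) < e -> accum l1 -> accum l2.
Proof.
  intros Hc H1 H2 HA e2 He2.
  assert (X1 : exists m1, 0 < Cmod (m1 - p) < e /\ Eq m1).
  { destruct (classic (l1 = p)) as [->|Hne].
    - apply HA. eapply Rle_lt_trans; [apply Cmod_ge_0|exact H1].
    - assert (P1 : 0 < Cmod (l1 - p)).
      { apply Cmod_gt_0. intros Z. apply Hne. replace l1 with (l1 - p + p) by ring. rewrite Z. ring. }
      destruct (HA (Rmin (Cmod (l1 - p)) (e - Cmod (l1 - p)))) as [m [[_ Hm] Em]].
      { apply Rmin_pos; lra. }
      assert (G1 := Rlt_le_trans _ _ _ Hm (Rmin_l _ _)).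
      assert (G2 := Rlt_le_trans _ _ _ Hm (Rmin_r _ _)).
      exists m. split; [|assumption]. split.
      + apply Cmod_gt_0. intros Z. replace m with p in G1.
        * rewrite Cmod_sub_comm in G1. lra.
        * replace m with (m - p + p) by ring. rewrite Z. ring.
      + replace (m - p) with ((m - l1) + (l1 - p)) by ring.
        eapply Rle_lt_trans; [apply Cmod_triangle|]. lra. }
  destruct X1 as [m1 [Hm1 E1]].
  set (k := (Rmin e2 (e - Cmod (l2 - p)) / 2)%R).
  assert (Hk : 0 < Rmin e2 (e - Cmod (l2 - p))) by (apply Rmin_pos; lra).
  assert (K1 : k < e2).
  { unfold k. assert (T := Rmin_l e2 (e - Cmod (l2 - p))). lra. }
  assert (K2 : k < e - Cmod (l2 - p)).
  { unfold k. assert (T := Rmin_r e2 (e - Cmod (l2 - p))). lra. }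
  assert (K0 : 0 < k) by (unfold k; lra). clearbody k.
  (* A small horizontal shift of [l2] avoids the centre [p] of the disc: of the two shifts [k] and
     [k / 2], at most one hits it. *)
  assert (X2 : exists q : R, 0 < q <= k /\ l2 + q - p <> 0).
  { destruct (classic (l2 + k - p = 0)) as [Z|Z].
    - exists (k / 2)%R. split; [lra|]. intros Z2.
      assert (Z3 : RtoC k - RtoC (k / 2) = 0).
      { transitivity ((l2 + k - p) - (l2 + (k / 2)%R - p)); [ring|]. rewrite Z, Z2. ring. }
      rewrite <- RtoC_minus in Z3. apply RtoC_inj in Z3. lra.
    - exists k. split; [lra|assumption]. }
  destruct X2 as [q [Hq Hn]]. exists (l2 + q).
  assert (Cq : Cmod (RtoC q) = q) by (rewrite Cmod_R; apply Rabs_pos_eq; lra).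
  split.
  - replace (l2 + q - l2) with (RtoC q) by ring. rewrite Cq. lra.
  - apply (clear_disc_connected p m1 (l2 + q) e Hc Hm1); [|assumption]. split.
    + now apply Cmod_gt_0.
    + replace (l2 + q - p) with ((l2 - p) + q) by ring.
      eapply Rle_lt_trans; [apply Cmod_triangle|]. rewrite Cq. lra.
Qed.

Lemma sector_convex (l1 l2 : C) (s : R) : sector M N l1 -> sector M N l2 -> 0 <= s <= 1 ->
  sector M N (l1 + s * (l2 - l1)).
Proof.
  intros [A1 A2] [B1 B2] Hs.
  assert (R1 : Re (l1 + s * (l2 - l1)) = ((1 - s) * Re l1 + s * Re l2)%R)
    by (destruct l1, l2; simpl; ring).
  assert (I1 : Im (l1 + s * (l2 - l1)) = ((1 - s) * Im l1 + s * Im l2)%R)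
    by (destruct l1, l2; simpl; ring).
  apply Rabs_def2 in A1. apply Rabs_def2 in B1. split.
  - rewrite I1. apply Rabs_def1; destruct (Req_dec s 0) as [->|Hs0]; nra.
  - rewrite R1. destruct (Req_dec s 0) as [->|Hs0]; nra.
Qed.

(** [accum] is carried along the segment from [l1] to [l2] by real induction, each step within one
    punctured disc. *)
Lemma propagate (l1 l2 : C) : sector M N l1 -> sector M N l2 -> accum l1 -> ~ Q l2 -> Eq l2.
Proof.
  intros H1 H2 HA Hl2.
  assert (A2 : accum (l1 + 1%R * (l2 - l1))).
  { apply (real_induction (fun s => accum (l1 + s * (l2 - l1)))).
    - replace (l1 + 0%R * (l2 - l1)) with l1 by ring. assumption.
    - intros s Hs. set (p := l1 + s * (l2 - l1)).
      destruct (clear_disc_exists p (sector_convex l1 l2 s H1 H2 Hs)) as [e [He Hc]].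
      assert (Pv := Cmod_ge_0 (l2 - l1)).
      exists (e / (1 + Cmod (l2 - l1)))%R. split; [apply Rdiv_lt_0_compat; lra|].
      assert (NEAR : forall t, Rabs (t - s) < e / (1 + Cmod (l2 - l1)) ->
         Cmod (l1 + t * (l2 - l1) - p) < e).
      { intros t Ht. apply Rlt_div_r in Ht; [|lra]. unfold p.
        replace (l1 + t * (l2 - l1) - (l1 + s * (l2 - l1))) with (RtoC (t - s) * (l2 - l1))
          by (rewrite RtoC_minus; ring).
        rewrite Cmod_mult, Cmod_R. assert (T := Rabs_pos (t - s)%R). nra. }
      intros s1 s2 _ _ N1 N2. now apply (accum_transfer p e); [|apply NEAR|apply NEAR]. }
  replace (l1 + 1%R * (l2 - l1)) with l2 in A2 by ring.
  (* From a nearby point of equality one last segment leads to [l2]; it meets the centre of the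
     punctured disc only at its end, which is not in [Q]. *)
  destruct (clear_disc_exists l2 H2) as [e [He Hc]].
  destruct (A2 e He) as [m [[Hm0 Hm] Em]].
  replace l2 with (m + (l2 - m)) by ring. apply Hseg; [|assumption].
  intros s Hs. destruct (Req_dec s 1) as [->|Hs1].
  - replace (m + 1%R * (l2 - m)) with l2 by ring. now split.
  - apply Hc. replace (m + s * (l2 - m) - l2) with (RtoC (1 - s) * (m - l2))
      by (rewrite RtoC_minus; ring).
    rewrite Cmod_mult, Cmod_R, Rabs_pos_eq by lra. split; [apply Rmult_lt_0_compat; lra|nra].
Qed.

End Propagate.

Theorem theorem7p1 (Th0 Th1 Thi sigma s2 r : C)
  (hTh0 : forall n : Z, Th0 <> RtoC (IZR n))
  (hTh1 : forall n : Z, Th1 <> RtoC (IZR n))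
  (hsigma : sigma <> 0) (hs2 : s2 <> 0) (hr : r <> 0)
  (hRe : (0 <= Re sigma < 1)%R)
  (hnd : nondegenerate Th0 Th1 Thi sigma)
  (M : R) (hM : (0 < M)%R) :
  (exists (N : R) (P : C -> Prop) (y z u : C -> C),
     is_solution Th0 Th1 Thi (sector M N) P y z u /\
     has_expansion Th0 Th1 Thi sigma s2 r M P y z u) /\
  (forall (N N' : R) (P P' : C -> Prop) (y z u y' z' u' : C -> C),
     is_solution Th0 Th1 Thi (sector M N) P y z u ->
     has_expansion Th0 Th1 Thi sigma s2 r M P y z u ->
     is_solution Th0 Th1 Thi (sector M N') P' y' z' u' ->
     has_expansion Th0 Th1 Thi sigma s2 r M P' y' z' u' ->
     forall l : C, sector M N l -> sector M N' l -> ~ P l -> ~ P' l ->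
       y l = y' l /\ z l = z' l /\ u l = u' l).
Proof.
  assert (h0 := hTh0 0%Z). assert (h1 := hTh1 0%Z).
  split; [now apply solution_exists|].
  intros N N' P P' y z u y' z' u' S1 X1 S2 X2 l HN HN' HP HP'.
  destruct (line_unique Th0 Th1 Thi sigma s2 r h1 hsigma hs2 hr hRe hnd M hM
    N N' P P' y z u y' z' u' S1 X1 S2 X2) as [h [N1 [Hh HE]]].
  set (V := hats_of Th0 Th1 Thi sigma r y z u) in *.
  set (W := hats_of Th0 Th1 Thi sigma r y' z' u') in *.
  set (Nm := Rmin N N').
  assert (SEC : forall m, sector M Nm m -> sector M N m /\ sector M N' m).
  { intros m [L1 L2]. split; (split; [assumption|]); eapply Rlt_le_trans; try exact L2;
      [apply Rmin_l|apply Rmin_r]. }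
  assert (HQ : discrete_in (sector M Nm) (fun m => P m \/ P' m)).
  { intros m Hm. destruct (SEC m Hm) as [K1 K2].
    destruct (proj1 S1 m K1) as [e1 [E1 I1]]. destruct (proj1 S2 m K2) as [e2 [E2 I2]].
    exists (Rmin e1 e2). split; [now apply Rmin_pos|]. intros q [Hq0 Hq] [Z|Z]; revert Z.
    - apply I1. split; [assumption|]. lt_min.
    - apply I2. split; [assumption|]. lt_min. }
  assert (Hseg : forall m v, (forall s, 0 <= s <= 1 -> sector M Nm (m + s * v) /\
       ~ (P (m + s * v) \/ P' (m + s * v))) ->
     (forall i, V i m = W i m) -> forall i, V i (m + v) = W i (m + v)).
  { intros m v Hs. apply (hats_segment_unique Thi sigma); intros s Hs01;
      destruct (Hs s Hs01) as [K1 K2]; destruct (SEC _ K1) as [K3 K4].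
    - apply (solution_hats Th0 Th1 Thi sigma r hsigma hr M N P y z u S1); tauto.
    - apply (solution_hats Th0 Th1 Thi sigma r hsigma hr M N' P' y' z' u' S2); tauto. }
  (* The starting point lies on the line of agreement, inside both sectors and to the left of
     [N1]. *)
  set (x0 := (Rmin Nm N1 - 1)%R). set (l1 := (x0, h) : C).
  assert (X0 : x0 < Nm /\ x0 < N1).
  { unfold x0. assert (T1 := Rmin_l Nm N1). assert (T2 := Rmin_r Nm N1). lra. }
  assert (EQ : forall i, V i l = W i l).
  { apply (propagate M Nm (fun m => P m \/ P' m) (fun m => forall i, V i m = W i m) HQ Hseg l1 l).
    - split; simpl; [apply Rabs_def1; lra|lra].
    - split; [apply HN|]. apply Rmin_glb_lt; [apply HN|apply HN'].
    (* The two solutions agree everywhere to the left of [l1] on the line, in particular at distance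
       [e / 2]. *)
    - intros e He. exists (l1 - RtoC (e / 2)). split.
      + replace (l1 - RtoC (e / 2) - l1) with (- RtoC (e / 2)) by ring.
        rewrite Cmod_opp, Cmod_R, Rabs_pos_eq by lra. lra.
      + intros i. apply HE; simpl; lra.
    - tauto. }
  destruct (solution_hats Th0 Th1 Thi sigma r hsigma hr M N P y z u S1 l HN HP) as [A1 [A2 _]].
  destruct (solution_hats Th0 Th1 Thi sigma r hsigma hr M N' P' y' z' u' S2 l HN' HP') as [B1 [B2 _]].
  now apply (hats_recover Th0 Th1 Thi sigma r h0 h1 hsigma hr).
Qed.
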